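(* The following decision problem is $\mathsf{NP}$-complete: given two nondeterministic parity automata $\mathcal{A}$ and $\mathcal{B}$ over a common finite alphabet (with the number of priorities not fixed but part of the input), decide whether $\mathcal{A}$ simulates $\mathcal{B}$.
   Context: A nondeterministic parity automaton $\mathcal{A}=(Q,\Sigma,q_0,\Delta,\Omega)$ consists of a finite set of states $Q$, a finite alphabet $\Sigma$, an initial state $q_0$, a transition relation $\Delta\subseteq Q\times\Sigma\times Q$, and a priority function $\Omega:\Delta\to[i,j]\subseteq\mathbb{N}$. A run on an infinite word is an infinite sequence of transitions starting at $q_0$ reading the letters of the word in order; it is accepting if the highest priority occurring infinitely often along it is even. Simulation game between $\mathcal{A}=(Q,\Sigma,q_0,\Delta_A,\Omega_A)$ and $\mathcal{B}=(P,\Sigma,p_0,\Delta_B,\Omega_B)$: positions are pairs $(p,q)\in P\times Q$, starting at $(p_0,q_0)$; in each of infinitely many rounds from $(p_i,q_i)$, Adam chooses a letter $a\in\Sigma$ and a transition $p_i\xrightarrow{a}p_{i+1}$ of $\mathcal{B}$, then Eve chooses a transition $q_i\xrightarrow{a}q_{i+1}$ of $\mathcal{A}$ on the same letter. Eve wins the infinite play if her constructed run in $\mathcal{A}$ is accepting or Adam's constructed run in $\mathcal{B}$ is not accepting. $\mathcal{A}$ simulates $\mathcal{B}$ if Eve has a winning strategy in this game. *)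

(* Defs.v *)
From mathcomp Require Import all_boot.
Set Implicit Arguments.
Unset Strict Implicit.
Unset Printing Implicit Defensive.

Definition trans := (nat * nat * nat * nat)%type.
Definition t_src (t : trans) : nat := t.1.1.1.
Definition t_let (t : trans) : nat := t.1.1.2.
Definition t_dst (t : trans) : nat := t.1.2.
Definition t_pri (t : trans) : nat := t.2.

Record NPA := mkNPA {
  nst : nat;
  init : nat;
  delta : seq trans
}.

(* Well-formedness over the alphabet {0,..,k-1}: the initial state is a
   state, transitions mention states and letters in range, and the
   priority is a function of the triple (q,a,q') (no triple listed twice). *)
Definition wf_NPA (k : nat) (A : NPA) : Prop :=
  init A < nst A /\
  (forall t, t \in delta A ->
     [/\ t_src t < nst A, t_let t < k & t_dst t < nst A]) /\
  uniq [seq t.1 | t <- delta A].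

Fixpoint is_path (A : NPA) (q : nat) (s : seq trans) : bool :=
  match s with
  | [::] => true
  | t :: s' => [&& t \in delta A, t_src t == q & is_path A (t_dst t) s']
  end.

Definition is_run (A : NPA) (r : nat -> trans) : Prop :=
  forall n, is_path A (init A) (mkseq r n).

Definition accepting (r : nat -> trans) : Prop :=
  exists m, ~~ odd m /\
    (forall N, exists2 n, N <= n & t_pri (r n) = m) /\
    (exists N, forall n, N <= n -> t_pri (r n) <= m).

(* A strategy of Eve maps the history of Adam's moves so far (the
   transitions of B chosen in rounds 0..i, the last one being the current
   one) to her answer, a transition of A. *)
Definition eve_strategy := seq trans -> trans.

Definition eve_answers (sigma : eve_strategy) (h : seq trans) : seq trans :=
  mkseq (fun i => sigma (take i.+1 h)) (size h).

Definition legal_strategy (A B : NPA) (sigma : eve_strategy) : Prop :=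
  forall h, is_path B (init B) h ->
    is_path A (init A) (eve_answers sigma h) /\
    [seq t_let t | t <- eve_answers sigma h] = [seq t_let t | t <- h].

Definition eve_run (sigma : eve_strategy) (rho : nat -> trans) : nat -> trans :=
  fun n => sigma (mkseq rho n.+1).

Definition simulates (A B : NPA) : Prop :=
  exists sigma : eve_strategy,
    legal_strategy A B sigma /\
    forall rho, is_run B rho -> accepting (eve_run sigma rho) \/ ~ accepting rho.

(* Input alphabet of the problem: Some b = bit b, None = separator. *)
Definition sym := option bool.

Fixpoint nbits (fuel n : nat) : seq bool :=
  match fuel with
  | 0 => [::]
  | f.+1 => if n is 0 then [::] else odd n :: nbits f n./2
  end.
Definition bits (n : nat) : seq bool := nbits n n.

Definition enc_nats (s : seq nat) : seq sym :=
  flatten [seq rcons (map Some (bits n)) None | n <- s].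

Definition ser_NPA (A : NPA) : seq nat :=
  [:: nst A, init A, size (delta A) &
     flatten [seq [:: t_src t; t_let t; t_dst t; t_pri t] | t <- delta A]].

Definition enc_instance (k : nat) (A B : NPA) : seq sym :=
  enc_nats (k :: ser_NPA A ++ ser_NPA B).

Definition SIM (x : seq sym) : Prop :=
  exists k A B, x = enc_instance k A B /\ wf_NPA k A /\ wf_NPA k B /\
                simulates A B.

Inductive move := MoveL | MoveR | MoveN.

(* Deterministic single-tape Turing machine with input alphabet Sigma.
   halted q = Some b : q is a halting state with answer b. *)
Record TM (Sigma : Type) := mkTM {
  tape : finType;
  state : finType;
  blank : tape;
  inp : Sigma -> tape;
  start : state;
  halted : state -> option bool;
  tstep : state -> tape -> state * tape * move
}.
Arguments tape {Sigma} t.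
Arguments state {Sigma} t.
Arguments blank {Sigma} t.
Arguments inp {Sigma} t _.
Arguments start {Sigma} t.
Arguments halted {Sigma} t _.
Arguments tstep {Sigma} t _ _.

(* Configuration: state, left part of the tape (nearest cell first),
   right part starting at the head (blank-padded implicitly). *)
Definition config (Sigma : Type) (M : TM Sigma) :=
  (state M * seq (tape M) * seq (tape M))%type.

Definition step (Sigma : Type) (M : TM Sigma) (c : config M) : config M :=
  let: (q, l, r) := c in
  if halted M q is Some _ then c else
  let: (q', w, mv) := tstep M q (head (blank M) r) in
  let r' := w :: behead r in
  match mv with
  | MoveN => (q', l, r')
  | MoveR => (q', w :: l, behead r)
  | MoveL => match l with
             | [::] => (q', [::], r')
             | x :: l' => (q', l', x :: r')
             end
  end.

Definition run (Sigma : Type) (M : TM Sigma) (n : nat) (c : config M) :=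
  iter n (step (M:=M)) c.
Arguments run {Sigma} M n c.

Definition init_config (Sigma : Type) (M : TM Sigma) (x : seq Sigma) : config M :=
  (start M, [::], map (inp M) x).
Arguments init_config {Sigma} M x.

Definition poly_bound (c n : nat) : nat := c * n ^ c + c.

Definition poly_decides (Sigma : Type) (M : TM Sigma) (L : seq Sigma -> Prop) :=
  exists c, forall x, exists n b,
    n <= poly_bound c (size x) /\
    halted M (run M n (init_config M x)).1.1 = Some b /\
    (b = true <-> L x).

Definition in_P (Sigma : Type) (L : seq Sigma -> Prop) : Prop :=
  exists M : TM Sigma, poly_decides M L.

Definition in_NP (Sigma : finType) (L : seq Sigma -> Prop) : Prop :=
  exists (V : seq (Sigma + bool)%type -> Prop) (c : nat),
    in_P V /\
    forall x, L x <-> exists w : seq bool,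
      size w <= poly_bound c (size x) /\ V (map inl x ++ map inr w).

Fixpoint strip_blanks (T : eqType) (b : T) (s : seq T) : seq T :=
  match s with
  | [::] => [::]
  | x :: s' => let s'' := strip_blanks b s' in
               if (s'' == [::]) && (x == b) then [::] else x :: s''
  end.

Definition poly_computable (S1 S2 : Type) (f : seq S1 -> seq S2) : Prop :=
  exists (M : TM S1) (out : S2 -> tape M) (c : nat),
    injective out /\ (forall s, out s != blank M) /\
    forall x, exists n,
      n <= poly_bound c (size x) /\
      let: (q, l, r) := run M n (init_config M x) in
      [/\ halted M q != None, all (eq_op^~ (blank M)) l &
          strip_blanks (blank M) r = map out (f x)].

Definition poly_reduces (S1 S2 : Type) (L1 : seq S1 -> Prop) (L2 : seq S2 -> Prop) :=
  exists f : seq S1 -> seq S2, poly_computable f /\ forall x, L1 x <-> L2 (f x).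

Definition NP_hard (S2 : Type) (L2 : seq S2 -> Prop) : Prop :=
  forall (S1 : finType) (L1 : seq S1 -> Prop), in_NP L1 -> poly_reduces L1 L2.

Definition NP_complete (S : finType) (L : seq S -> Prop) : Prop :=
  in_NP L /\ NP_hard L.

(* Main.v *)
Require Import Defs.
From mathcomp Require Import all_boot.
From mathcomp Require Import zify boolp.
Set Implicit Arguments.
Unset Strict Implicit.
Unset Printing Implicit Defensive.

(* Membership in NP.  Eve's winning condition (her run is accepting or Adam's is not) is a Rabin
   condition, so that she wins iff she wins positionally, and this is witnessed by ranks: for every
   even priority b of B and odd priority a of A, a rank of the positions that never increases on the
   rounds with priorities at most b and a, where the rounds inside one level avoid a (odd levels) or
   avoid b (even levels).  Ranks are polynomial and are checked round by round.

   Hardness.  Adam picks a clause, Eve answers by one of its literals, and the priorities of the round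
   are chosen so that Adam wins iff the largest variable picked infinitely often is picked with both
   signs.  A ranking yields one literal per clause, and two opposite literals would violate the rank
   condition; hence Eve wins iff the clauses are satisfiable, to which every problem in NP reduces by
   the Cook-Levin tableau.

   Both the verifier and the reduction must be run by Turing machines: functions on lists and numbers
   are computed on prefix codes of binary trees by stack programs, each stack being one track of the
   tape of a Turing machine. *)

(** * Polynomially bounded functions *)

(** Eve loses a play iff some even b is the largest recurring priority of Adam's run and some odd a
    that of hers. For a single pair (b, a) a rank that excludes this is easy to find; the difficulty
    is that one and the same answer of Eve must respect the ranks of all pairs, so the rankings are
    built for all pairs simultaneously, by induction on the game, from a strategy that may depend on
    the whole history.

    Numbers of an instance are written in binary, so its number of states and its priorities may be
    exponential in its length. Certificates therefore mention only the initial state, targets of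
    transitions and priorities that occur. The numbers made by the reduction are small and are kept
    in unary until the instance is written.

    Beyond a few primitive programs, computability is obtained from closure properties whose only
    loops are folds with polynomially bounded intermediate results. *)

Definition polyn (p : nat -> nat) : Prop :=
  exists a k, forall n, p n <= a * n.+1 ^ k.

Lemma polyn_le p q : (forall n, p n <= q n) -> polyn q -> polyn p.
Proof. by move=> le [a [k h]]; exists a, k => n; apply: leq_trans (le n) (h n). Qed.

Lemma polyn_const c : polyn (fun _ => c).
Proof. by exists c, 0 => n; rewrite expn0 muln1. Qed.

Lemma polyn_id : polyn id.
Proof. by exists 1, 1 => n; rewrite expn1 mul1n. Qed.

Lemma leq_expS n k l : k <= l -> n.+1 ^ k <= n.+1 ^ l.
Proof. by move=> le; rewrite leq_pexp2l. Qed.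

Lemma polyn_add p q : polyn p -> polyn q -> polyn (fun n => p n + q n).
Proof.
move=> [a [k h]] [b [l g]]; exists (a + b), (k + l) => n.
rewrite mulnDl leq_add //.
  by apply: leq_trans (h n) _; rewrite leq_mul // leq_expS ?leq_addr.
by apply: leq_trans (g n) _; rewrite leq_mul // leq_expS ?leq_addl.
Qed.

Lemma polyn_mul p q : polyn p -> polyn q -> polyn (fun n => p n * q n).
Proof.
move=> [a [k h]] [b [l g]]; exists (a * b), (k + l) => n.
by rewrite expnD mulnACA leq_mul.
Qed.

Lemma polyn_exp p k : polyn p -> polyn (fun n => p n ^ k).
Proof.
move=> hp; elim: k => [|k ih]; first exact: polyn_const 1.
by apply: polyn_le (polyn_mul hp ih) => n; rewrite expnS.
Qed.

Lemma polyn_comp p q : polyn p -> polyn q -> polyn (fun n => p (q n)).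
Proof.
move=> [a [k h]] [b [l g]]; exists (a * b.+1 ^ k), (l * k) => n.
apply: leq_trans (h _) _; rewrite -mulnA leq_mul // expnM -expnMn.
case: k {h} => // k; rewrite leq_exp2r // mulSn addnC -addn1 leq_add //.
by rewrite expn_gt0.
Qed.

Lemma polyn_bound c : polyn (poly_bound c).
Proof.
rewrite /poly_bound; apply: polyn_add (polyn_const c).
by apply: polyn_mul (polyn_const c) (polyn_exp c polyn_id).
Qed.

Lemma polynP p : polyn p -> exists c, forall n, p n <= poly_bound c n.
Proof.
(* The factor [2 ^ k] pays for n + 1 <= 2n when n is positive; the additive constant of [poly_bound]
   covers n = 0. *)
move=> [a [k h]]; exists (a * 2 ^ k + k) => n; apply: leq_trans (h n) _.
rewrite /poly_bound; case: n => [|n].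
  rewrite exp1n muln1; apply: leq_trans (leq_addl _ _).
  by rewrite -[X in X <= _]muln1 (leq_trans _ (leq_addr _ _)) // leq_mul // expn_gt0.
apply: leq_trans (leq_addr _ _).
apply: (@leq_trans (a * 2 ^ k * n.+1 ^ k)).
  rewrite -mulnA leq_mul // -expnMn; case: k {h} => // k; rewrite leq_exp2r //; lia.
by rewrite leq_mul ?leq_addr // leq_expS // leq_addl.
Qed.

Lemma leq_poly_bound c m n : m <= n -> poly_bound c m <= poly_bound c n.
Proof.
by move=> le; rewrite /poly_bound leq_add2r leq_mul //; case: c => // c; rewrite leq_exp2r.
Qed.

Lemma polyn_succ p : polyn p -> polyn (fun n => (p n).+1).
Proof. exact: polyn_add (polyn_const 1). Qed.

Lemma polyn_mono p : polyn p ->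
  exists q, [/\ polyn q, forall n, p n <= q n & forall m n, m <= n -> q m <= q n].
Proof.
move=> [a [k h]]; exists (fun n => a * n.+1 ^ k); split=> //.
  by exists a, k.
by move=> m n le; rewrite leq_mul //; case: k {h} => // k; rewrite leq_exp2r.
Qed.

Ltac polyn_tac :=
  repeat first
    [ exact: polyn_const | exact: polyn_id | exact: polyn_bound | assumption
    | apply: polyn_succ | apply: polyn_add | apply: polyn_mul | apply: polyn_exp
    | match goal with
      | H : polyn ?p |- polyn (fun n => ?p _) => apply: (polyn_comp H)
      end
    | apply: (polyn_comp (polyn_bound _)) ].

(** * Stack programs and their compilation to Turing machines *)

Section Contents.
Variables (Sigma : Type) (M : TM Sigma).

Definition pos (c : config M) := size c.1.2.
Definition cont (c : config M) j := nth (blank M) (rev c.1.2 ++ c.2) j.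

Lemma cont_head c : cont c (pos c) = head (blank M) c.2.
Proof. by rewrite /cont /pos nth_cat size_rev ltnn subnn nth0. Qed.

(** The truncated predecessor agrees with [step], where a left move at the left end leaves the head
    in place. *)
Definition shift (mv : Defs.move) (i : nat) :=
  match mv with MoveL => i.-1 | MoveR => i.+1 | MoveN => i end.

Lemma step_spec c q' w mv :
  halted M c.1.1 = None -> tstep M c.1.1 (cont c (pos c)) = (q', w, mv) ->
  [/\ (step c).1.1 = q', pos (step c) = shift mv (pos c) &
      forall j, cont (step c) j = if j == pos c then w else cont c j].
Proof.
rewrite cont_head; case: c => [[q l] r] /= -> ->.
have E j x : nth (blank M) (rev l ++ x :: behead r) j =
    if j == size l then x else nth (blank M) (rev l ++ r) j.
  rewrite !nth_cat size_rev.
  case: (ltngtP j (size l)) => // [lt|->]; last by rewrite subnn.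
  rewrite -(subnSK lt) /=; by case: (r) => //=; rewrite nth_nil.
case: mv => /=; rewrite /pos /cont /=.
- case: l E => [|x l] E /=; split=> // j; first exact: E.
  by rewrite -E rev_cons -cats1 -catA.
- by split=> // j; rewrite -E rev_cons -cats1 -catA.
- by split=> // j; rewrite -E.
Qed.

Lemma step_halted c b : halted M c.1.1 = Some b -> step c = c.
Proof. by case: c => [[q l] r] /= ->. Qed.

Lemma run_halted n c b : halted M c.1.1 = Some b -> run M n c = c.
Proof. by move=> h; elim: n => //= n ->; apply: step_halted h. Qed.

Lemma run_add m n c : run M (m + n) c = run M n (run M m c).
Proof. by rewrite /run addnC iterD. Qed.

(** The two lists of a configuration may differ from the intended ones by trailing blanks, so
    simulation is stated through state, head position and cell contents only. *)
Definition repr c q i F := [/\ c.1.1 = q, pos c = i & forall j, cont c j = F j].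

Lemma repr_step c q i F q' w mv :
  repr c q i F -> halted M q = None -> tstep M q (F i) = (q', w, mv) ->
  repr (run M 1 c) q' (shift mv i) (fun j => if j == i then w else F j).
Proof.
move=> [<- <- eF] h; rewrite -eF => ctrl.
rewrite /repr -[run M 1 c]/(step c).
by have [-> -> e] := step_spec h ctrl; split=> // j; rewrite e eF.
Qed.

Lemma repr_ext c q i F F' : F =1 F' -> repr c q i F -> repr c q i F'.
Proof. by move=> e [h1 h2 h3]; split=> // j; rewrite h3. Qed.

End Contents.

(** [IO] holds the input and later the output, [MS] the pending values; [RX], [RY] and [RZ] are
    scratch space and [RC] serves as a counter. *)
Inductive reg := IO | MS | RX | RY | RZ | RC.

(** A tuple rather than a function on [reg]: products give tape cells their [finType] structure, and
    updates of concrete stores compute. *)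
Definition regs (T : Type) := (T * T * T * T * T * T)%type.

Definition rget T (r : reg) (v : regs T) : T :=
  let: (a, b, c, d, e, f) := v in
  match r with IO => a | MS => b | RX => c | RY => d | RZ => e | RC => f end.

Definition rset T (r : reg) (x : T) (v : regs T) : regs T :=
  let: (a, b, c, d, e, f) := v in
  match r with
  | IO => (x, b, c, d, e, f) | MS => (a, x, c, d, e, f) | RX => (a, b, x, d, e, f)
  | RY => (a, b, c, x, e, f) | RZ => (a, b, c, d, x, f) | RC => (a, b, c, d, e, x)
  end.

Definition rmap T U (g : T -> U) (v : regs T) : regs U :=
  let: (a, b, c, d, e, f) := v in (g a, g b, g c, g d, g e, g f).

Lemma rget_map T U (g : T -> U) r v : rget r (rmap g v) = g (rget r v).
Proof. by case: v => [[[[[a b] c] d] e] f]; case: r. Qed.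

Lemma rget_set T r (x : T) v : rget r (rset r x v) = x.
Proof. by case: v => [[[[[a b] c] d] e] f]; case: r. Qed.

Lemma rset_get T r (v : regs T) : rset r (rget r v) v = v.
Proof. by case: v => [[[[[a b] c] d] e] f]; case: r. Qed.

Lemma rmap_set T U (g : T -> U) r x v : rmap g (rset r x v) = rset r (g x) (rmap g v).
Proof. by case: v => [[[[[a b] c] d] e] f]; case: r. Qed.

Section Stack.
Variable S : finType.

(** Booleans are the letters of codes of trees; [S] supplies the letters of the input and output
    words. *)
Definition sym2 := (bool + S)%type.
Local Notation G := sym2.
Definition store := regs (seq G).

(* [Case] and [While] branch on the top of a stack. *)
Inductive cmd :=
  | Push of reg & G
  | Pop of reg
  | Skip
  | Seq of cmd & cmd
  | Case of reg & (option G -> cmd)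
  | While of reg & (option G -> bool) & cmd.

Inductive prim := PPush of reg & G | PPop of reg | PPeek of reg.

Definition preg o := match o with PPush r _ => r | PPop r => r | PPeek r => r end.
Definition obs o (s : store) : option G :=
  match o with PPush _ _ => None | _ => ohead (rget (preg o) s) end.
Definition act o (s : store) : store :=
  match o with
  | PPush r a => rset r (a :: rget r s) s
  | PPop r => rset r (behead (rget r s)) s
  | PPeek _ => s
  end.

(** Program points become states of a Turing machine, hence must form a finite type. In [Case] and
    [While], [None] is the point where the test is made. *)
Fixpoint ctrl (c : cmd) : finType :=
  match c with
  | Push _ _ | Pop _ | Skip => unit
  | Seq c1 c2 => (ctrl c1 + ctrl c2)%type
  | Case _ g => option {x : option G & ctrl (g x)}
  | While _ _ c => option (ctrl c)
  end.

Fixpoint entry (c : cmd) : ctrl c :=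
  match c return ctrl c with
  | Push _ _ | Pop _ | Skip => tt
  | Seq c1 c2 => inl (entry c1)
  | Case _ g => None
  | While _ _ c => None
  end.

Fixpoint op (c : cmd) : ctrl c -> prim :=
  match c return ctrl c -> prim with
  | Push r a => fun _ => PPush r a
  | Pop r => fun _ => PPop r
  | Skip => fun _ => PPeek IO
  | Seq c1 c2 => fun q => match q with inl q1 => op q1 | inr q2 => op q2 end
  | Case r g => fun q => match q with None => PPeek r | Some p => op (tagged p) end
  | While r _ c => fun q => match q with None => PPeek r | Some p => op p end
  end.

(* [None] means that the command has terminated. *)
Fixpoint next_ctrl (c : cmd) : ctrl c -> option G -> option (ctrl c) :=
  match c return ctrl c -> option G -> option (ctrl c) with
  | Push _ _ | Pop _ | Skip => fun _ _ => None
  | Seq c1 c2 => fun q o =>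
      match q with
      | inl q1 => Some (if next_ctrl q1 o is Some q1' then inl q1' else inr (entry c2))
      | inr q2 => omap inr (next_ctrl q2 o)
      end
  | Case r g => fun q o =>
      match q with
      | None => Some (Some (Tagged (fun x => ctrl (g x)) (entry (g o))))
      | Some p => omap (fun q' => Some (Tagged (fun x => ctrl (g x)) q')) (next_ctrl (tagged p) o)
      end
  | While r p c => fun q o =>
      match q with
      | None => if p o then Some (Some (entry c)) else None
      | Some q1 => Some (next_ctrl q1 o)
      end
  end.

Inductive runs (c : cmd) : ctrl c -> store -> store -> nat -> Prop :=
  | runs_last q s : next_ctrl q (obs (op q) s) = None -> runs q s (act (op q) s) 1
  | runs_more q q' s s' n : next_ctrl q (obs (op q) s) = Some q' ->
      runs q' (act (op q) s) s' n -> runs q s s' n.+1.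

Lemma runs_seq2 c1 c2 (q : ctrl c2) s s' n :
  runs q s s' n -> @runs (Seq c1 c2) (inr q) s s' n.
Proof.
elim=> {q s s' n} [q s h|q q' s s' n h _ ih].
  by apply: (@runs_last (Seq c1 c2) (inr q)); rewrite /= h.
by apply: (@runs_more (Seq c1 c2) (inr q)) ih; rewrite /= h.
Qed.

Lemma runs_seq1 c1 c2 (q : ctrl c1) s s1 s' n m :
  runs q s s1 n -> runs (entry c2) s1 s' m -> @runs (Seq c1 c2) (inl q) s s' (n + m).
Proof.
move=> r1 r2; elim: r1 r2 => {q s s1 n} [q s h|q q' s s1 n h _ ih] r2.
  by apply: (@runs_more (Seq c1 c2) (inl q)) (runs_seq2 c1 r2); rewrite /= h.
by apply: (@runs_more (Seq c1 c2) (inl q)) (ih r2); rewrite /= h.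
Qed.

Lemma runs_case r g x (q : ctrl (g x)) s s' n : runs q s s' n ->
  @runs (Case r g) (Some (Tagged (fun x => ctrl (g x)) q)) s s' n.
Proof.
set inj := fun q : ctrl (g x) => Some (Tagged (fun x => ctrl (g x)) q).
elim=> {q s s' n} [q s h|q q' s s' n h _ ih].
  by apply: (@runs_last (Case r g) (inj q)); rewrite /= h.
by apply: (@runs_more (Case r g) (inj q)) ih; rewrite /= h.
Qed.

Lemma runs_while r p c (q : ctrl c) s s1 s' n m :
  runs q s s1 n -> @runs (While r p c) None s1 s' m -> @runs (While r p c) (Some q) s s' (n + m).
Proof.
move=> r1 r2; elim: r1 r2 => {q s s1 n} [q s h|q q' s s1 n h _ ih] r2.
  by apply: (@runs_more (While r p c) (Some q)) r2; rewrite /= h.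
by apply: (@runs_more (While r p c) (Some q)) (ih r2); rewrite /= h.
Qed.

(** Only an upper bound on the time is recorded, so that estimates can be rounded up at every
    composition. *)
Definition exec c s s' N := exists2 n, n <= N & runs (entry c) s s' n.

Lemma exec_le c s s' N N' : exec c s s' N -> N <= N' -> exec c s s' N'.
Proof. by move=> [n h r] le; exists n => //; apply: leq_trans le. Qed.

Lemma exec_push r a s : exec (Push r a) s (rset r (a :: rget r s) s) 1.
Proof. by exists 1 => //; apply: (@runs_last (Push r a) tt). Qed.

Lemma exec_pop r s : exec (Pop r) s (rset r (behead (rget r s)) s) 1.
Proof. by exists 1 => //; apply: (@runs_last (Pop r) tt). Qed.

Lemma exec_skip s : exec Skip s s 1.
Proof. by exists 1 => //; apply: (@runs_last Skip tt). Qed.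

Lemma exec_seq c1 c2 s s1 s' n m : exec c1 s s1 n -> exec c2 s1 s' m -> exec (Seq c1 c2) s s' (n + m).
Proof.
move=> [n' hn r1] [m' hm r2]; exists (n' + m'); [exact: leq_add|exact: runs_seq1 r1 r2].
Qed.

Lemma exec_case r g s s' n : exec (g (ohead (rget r s))) s s' n -> exec (Case r g) s s' n.+1.
Proof.
move=> [n' hn r1]; exists n'.+1 => //.
by apply: (@runs_more (Case r g) None) (runs_case r r1).
Qed.

Lemma exec_while0 r (p : option G -> bool) c s : ~~ p (ohead (rget r s)) -> exec (While r p c) s s 1.
Proof. by move=> h; exists 1 => //; apply: (@runs_last (While r p c) None); rewrite /= (negbTE h). Qed.

Lemma exec_while1 r (p : option G -> bool) c s s1 s' n m : p (ohead (rget r s)) ->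
  exec c s s1 n -> exec (While r p c) s1 s' m -> exec (While r p c) s s' (n + m).+1.
Proof.
move=> h [n' hn r1] [m' hm r2]; exists (n' + m').+1; first by rewrite ltnS leq_add.
by apply: (@runs_more (While r p c) None) (runs_while r1 r2); rewrite /= h.
Qed.

(* A tape cell holds one symbol of each stack (bottom of the stacks at the left
   end) and a flag marking the leftmost cell. *)
Definition cell := (regs (option G) * bool)%type.
Definition cblank : cell := ((None, None, None, None, None, None), false).
Definition ioc (a : G) : cell := ((Some a, None, None, None, None, None), false).

Variables (Sigma : Type) (inS : Sigma -> S) (c : cmd).

(** A primitive starts at the leftmost cell. [TScan] runs right to the first cell free on the track
    of the stack, [TTop] stands on the top symbol, and [TBack] walks back to the flagged cell while
    remembering the next program point. *)
Definition tst := (unit + bool + (ctrl c + ctrl c) + option (ctrl c))%type.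
Definition TInit : tst := inl (inl (inl tt)).
Definition THalt b : tst := inl (inl (inr b)).
Definition TScan q : tst := inl (inr (inl q)).
Definition TTop q : tst := inl (inr (inr q)).
Definition TBack oq : tst := inr oq.

(** The first step flags the leftmost cell. On termination the flag is erased, so that this cell
    carries a plain output symbol, and the answer tells whether [IO] is nonempty. *)
Definition stack_tstep (t : tst) (x : cell) : tst * cell * Defs.move :=
  match t with
  | inl (inl (inl tt)) => (TScan (entry c), (x.1, true), MoveN)
  | inl (inl (inr b)) => (t, x, MoveN)
  | inl (inr (inl q)) =>
      if rget (preg (op q)) x.1 is Some _ then (TScan q, x, MoveR) else
      match op q with
      | PPush r a => (TBack (next_ctrl q None), (rset r (Some a) x.1, x.2), MoveN)
      | _ => if x.2 then (TBack (next_ctrl q None), x, MoveN) else (TTop q, x, MoveL)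
      end
  | inl (inr (inr q)) =>
      let oq := next_ctrl q (rget (preg (op q)) x.1) in
      match op q with
      | PPop r => (TBack oq, (rset r None x.1, x.2), MoveN)
      | _ => (TBack oq, x, MoveN)
      end
  | inr oq =>
      if x.2 then
        if oq is Some q then (TScan q, x, MoveN)
        else (THalt (isSome (rget IO x.1)), (x.1, false), MoveN)
      else (TBack oq, x, MoveL)
  end.

Definition stack_TM : TM Sigma :=
  @mkTM Sigma cell tst cblank (fun a => ioc (inr (inS a))) TInit
    (fun t => if t is inl (inl (inr b)) then Some b else None) stack_tstep.

Definition cellat (s : store) j : cell := (rmap (fun z => onth (rev z) j) s, j == 0).

Lemma onth_nth (T : Type) (s : seq T) j : onth s j = nth None (map Some s) j.
Proof. by elim: s j => [|x s ih] [|j] //=. Qed.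

Local Notation rep := (@repr Sigma stack_TM).
Local Notation runT := (run stack_TM).

Lemma scan_right n cf q i s :
  rep cf (TScan q) i (cellat s) -> size (rget (preg (op q)) s) = i + n ->
  rep (runT n cf) (TScan q) (i + n) (cellat s).
Proof.
elim: n i cf => [|n ih] i cf h e; first by rewrite addn0.
have hs : stack_tstep (TScan q) (cellat s i) = (TScan q, cellat s i, MoveR).
  rewrite /= rget_map onth_nth (nth_map (inl true)) // size_rev e -addSnnS.
  exact: leq_addr.
have := repr_step h erefl hs; rewrite addnS -addSn => h1.
rewrite -[n.+1]/(1 + n) run_add; apply: ih; last by rewrite e addnS.
by apply: repr_ext h1 => j; case: eqP => // ->.
Qed.

Lemma go_back i cf oq s :
  rep cf (TBack oq) i (cellat s) -> rep (runT i cf) (TBack oq) 0 (cellat s).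
Proof.
elim: i cf => [|i ih] cf h //.
have := repr_step h erefl (erefl : stack_tstep (TBack oq) (cellat s i.+1) = _) => h1.
rewrite -[i.+1]/(1 + i) run_add; apply: ih.
by apply: repr_ext h1 => j; case: eqP => // ->.
Qed.

Lemma onth_rev_cons (T : Type) (a : T) z j :
  onth (rev (a :: z)) j = if j == size z then Some a else onth (rev z) j.
Proof.
rewrite !onth_nth rev_cons map_rcons nth_rcons size_map size_rev.
by case: ltngtP => // h; rewrite nth_default // size_map size_rev ltnW.
Qed.

Definition is_push o := if o is PPush _ _ then true else false.

Lemma reach_top q cf s : ~~ is_push (op q) -> rep cf (TScan q) 0 (cellat s) ->
  match rget (preg (op q)) s with
  | [::] => rep (runT 1 cf) (TBack (next_ctrl q None)) 0 (cellat s)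
  | _ :: z => rep (runT (size z + 2) cf) (TTop q) (size z) (cellat s)
  end.
Proof.
move=> np h; set z := rget _ s.
have h1 : rep (runT (size z) cf) (TScan q) (size z) (cellat s) by apply: scan_right h _.
have endz : rget (preg (op q)) (rmap (fun z0 => onth (rev z0) (size z)) s) = None.
  by rewrite rget_map onth_nth nth_default // size_map size_rev.
have hs : stack_tstep (TScan q) (cellat s (size z)) =
    if z is [::] then (TBack (next_ctrl q None), cellat s (size z), MoveN)
    else (TTop q, cellat s (size z), MoveL).
  by rewrite /= endz; case: (op q) np => // r _; case: (z).
case zz: z hs endz h1 => [|a z'] hs endz h1.
  by apply: repr_ext (repr_step h erefl hs) => j; case: eqP => // ->.
have -> : size z' + 2 = (size z').+1 + 1 by lia.
rewrite run_add.
by apply: repr_ext (repr_step h1 erefl hs) => j; case: eqP => // ->.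
Qed.

Lemma do_prim q cf s : rep cf (TScan q) 0 (cellat s) ->
  exists2 n, n <= 2 * size (rget (preg (op q)) s) + 2 &
  rep (runT n cf) (TBack (next_ctrl q (obs (op q) s))) 0 (cellat (act (op q) s)).
Proof.
move=> h; have := @reach_top q cf s.
case o: (op q) => [r a|r|r] /=.
- move=> _; set z := rget r s.
  have h1 : rep (runT (size z) cf) (TScan q) (size z) (cellat s).
    by apply: scan_right h _; rewrite o.
  exists (size z + (1 + size z)); first by lia.
  rewrite run_add run_add; apply: go_back.
  have hs : stack_tstep (TScan q) (cellat s (size z)) =
      (TBack (next_ctrl q None), (rset r (Some a) (cellat s (size z)).1, (size z == 0)), MoveN).
    by rewrite /= o /= rget_map onth_nth nth_default // size_map size_rev.
  apply: repr_ext (repr_step h1 erefl hs) => j; rewrite /cellat /= rmap_set onth_rev_cons.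
  case: eqP => [->//|_].
  by rewrite -(rget_map (fun z0 => onth (rev z0) j)) rset_get.
- move=> /(_ isT h); case zz: (rget r s) => [|a z] h1; first by exists 1; rewrite //= -zz rset_get.
  exists ((size z + 2) + (1 + size z)); first by rewrite /=; lia.
  rewrite run_add run_add; apply: go_back => /=.
  have hs : stack_tstep (TTop q) (cellat s (size z)) =
      (TBack (next_ctrl q (Some a)), (rset r None (cellat s (size z)).1, (size z == 0)), MoveN).
    by rewrite /= o /= rget_map zz onth_rev_cons eqxx.
  apply: repr_ext (repr_step h1 erefl hs) => j; rewrite /cellat /= rmap_set.
  case: eqP => [->|nj]; first by rewrite onth_nth nth_default // size_map size_rev.
  rewrite -[in LHS](rset_get r (rmap _ s)) rget_map zz onth_rev_cons.
  have/negbTE-> := introN eqP nj.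
  by case: (rmap _ s) => [[[[[? ?] ?] ?] ?] ?]; case: (r).
- move=> /(_ isT h); case zz: (rget r s) => [|a z] h1; first by exists 1.
  exists ((size z + 2) + (1 + size z)); first by rewrite /=; lia.
  rewrite run_add run_add; apply: go_back => /=.
  have hs : stack_tstep (TTop q) (cellat s (size z)) =
      (TBack (next_ctrl q (Some a)), cellat s (size z), MoveN).
    by rewrite /= o /= rget_map zz onth_rev_cons eqxx.
  by apply: repr_ext (repr_step h1 erefl hs) => j; case: eqP => // ->.
Qed.

Definition height (s : store) :=
  let: (x1, x2, x3, x4, x5, x6) := s in
  size x1 + size x2 + size x3 + size x4 + size x5 + size x6.

Lemma size_height r s : size (rget r s) <= height s.
Proof. by case: s => [[[[[? ?] ?] ?] ?] ?]; case: r => /=; lia. Qed.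

Lemma height_act o s : height (act o s) <= (height s).+1.
Proof.
by case: s => [[[[[? ?] ?] ?] ?] ?]; case: o => [] [] *; rewrite /= ?size_behead; lia.
Qed.

(** A primitive costs at most twice the height of its stack plus a constant, and raises the total
    height by at most one; this yields the quadratic overhead. *)
Lemma sim_runs (q : ctrl c) s s' n : runs q s s' n ->
  forall cf, rep cf (TScan q) 0 (cellat s) ->
  exists2 m, m <= n * (2 * (height s + n) + 3) &
  rep (runT m cf) (TBack None) 0 (cellat s').
Proof.
elim=> {q s s' n} [q s h|q q' s s' n h _ ih] cf hr.
  have [m hm hr'] := do_prim hr; exists m; last by rewrite -h.
  have := size_height (preg (op q)) s; lia.
have [m1 hm1 hr1] := do_prim hr.
have hr2 : rep (runT (m1 + 1) cf) (TScan q') 0 (cellat (act (op q) s)).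
  rewrite run_add; rewrite h in hr1.
  have := repr_step hr1 erefl (erefl : stack_tstep (TBack (Some q')) (cellat _ 0) = _).
  by apply: repr_ext => j; case: eqP => // ->.
have [m2 hm2 hr'] := ih _ hr2; exists (m1 + 1 + m2); last by rewrite run_add.
have := size_height (preg (op q)) s; have := height_act (op q) s.
move=> hh hz; rewrite mulSn leq_add //; first by lia.
by apply: leq_trans hm2 _; rewrite leq_mul //; lia.
Qed.

Definition io_store (z : seq G) : store := (z, [::], [::], [::], [::], [::]).

Lemma strip_eq (T : eqType) (b : T) r t :
  (forall j, nth b r j = nth b t j) -> b \notin t -> strip_blanks b r = t.
Proof.
elim: r t => [|x r ih] [|y t] //= e.
- by have := e 0; rewrite /= => <-; rewrite inE eqxx.
- move=> _; rewrite (ih [::]) // => [|j]; last by have := e j.+1; rewrite /= nth_nil => ->.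
  by have /= -> := e 0; rewrite !eqxx.
rewrite inE negb_or => /andP[ny nt]; rewrite (ih t) // => [|j]; last exact: (e j.+1).
by have /= -> := e 0; rewrite [y == b]eq_sym (negbTE ny) andbF.
Qed.

(** Stacks grow to the right, so the input word on the tape is an [IO] stack with the last letter on
    top: hence both occurrences of [rev]. The program ends with all other stacks empty and the head
    at the left end, as [poly_computable] requires. *)
Lemma stack_TM_spec x z n :
  exec c (io_store (rev (map (fun a => inr (inS a)) x))) (io_store z) n ->
  exists m, exists b, [/\ m <= (n * (2 * (size x + n) + 3) + 2), b = (z != [::]) &
    let: (q, l, r) := runT m (init_config stack_TM x) in
    [/\ halted stack_TM q = Some b, l = [::] & strip_blanks cblank r = map ioc (rev z)]].
Proof.
move=> [n' le hr].
set s := io_store _ in hr.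
have h0 : rep (init_config stack_TM x) TInit 0 (fun j => ((cellat s j).1, false)).
  split=> // j; rewrite /cont /= /cellat /= revK !onth_nth.
  case: (ltnP j (size x)) => lt.
    move: (lt); case: x {hr s} lt => [//|x0 x] lt _.
    by rewrite (nth_map x0) // -map_comp (nth_map x0) //= nth_nil.
  by rewrite !nth_default ?size_map.
have h1 : rep (runT 1 (init_config stack_TM x)) (TScan (entry c)) 0 (cellat s).
  have := repr_step h0 erefl (erefl : stack_tstep TInit _ = _).
  by apply: repr_ext => j; rewrite /cellat; case: eqP => // ->.
have [m hm h2] := sim_runs hr h1.
set b := isSome (rget IO (cellat (io_store z) 0).1).
have := repr_step h2 erefl (erefl : stack_tstep (TBack None) (cellat (io_store z) 0) = _).
rewrite -!run_add => h3.
exists (1 + m + 1), b; split.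
- rewrite addn1 add1n addn2 !ltnS (leq_trans hm) //.
  have -> : height s = size x by rewrite /= size_rev size_map; lia.
  by rewrite leq_mul //; lia.
- by rewrite /b /=; case: (z) => // a z'; rewrite rev_cons; case: (rev z').
case: (runT _ _) h3 => [[q l] r] [/= -> /size0nil /= l0 e]; rewrite {l}l0 in e *; split=> //.
apply: strip_eq => [j|]; last by apply/negP => /mapP[a _].
have := e j; rewrite /cont /= => ->; rewrite /cellat /= !onth_nth.
rewrite !nth_nil; have E : forall y i, (nth None (map Some y) i, None, None, None, None, None, false) =
    nth cblank (map ioc y) i by elim=> [|a y ih] [|i] //=.
by rewrite -E; case: j => [|j] //=; case: (rev z).
Qed.

End Stack.

(** * Stack programs on codes of trees *)

Inductive tree := Lf | Nd of tree & tree.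

(** Preorder traversal. The code is prefix-free, so pending values can be juxtaposed on one stack
    without separators. *)
Fixpoint code (t : tree) : seq bool :=
  if t is Nd a b then true :: code a ++ code b else [:: false].

Definition tsize t := size (code t).

Lemma tsize_Nd a b : tsize (Nd a b) = (tsize a + tsize b).+1.
Proof. by rewrite /tsize /= size_cat. Qed.

Lemma tsize_gt0 t : 0 < tsize t.
Proof. by case: t. Qed.

Lemma code_cat_inj a b s t : code a ++ s = code b ++ t -> a = b /\ s = t.
Proof.
elim: a b s t => [|a1 ih1 a2 ih2] [|b1 b2] s t //= []; first by move->.
by rewrite -!catA => /ih1[-> /ih2[-> ->]].
Qed.

Lemma code_inj : injective code.
Proof. by move=> a b e; have [] := @code_cat_inj a b [::] [::]; rewrite ?e. Qed.

Definition thd t := if t is Nd a _ then a else Lf.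
Definition ttl t := if t is Nd _ b then b else Lf.

Definition enc_of A := A -> tree.
Definition eT : enc_of tree := id.
Definition eB : enc_of bool := fun b => if b then Nd Lf Lf else Lf.
Definition eP A B (eA : enc_of A) (eB : enc_of B) : enc_of (A * B) :=
  fun p => Nd (eA p.1) (eB p.2).
Definition eL A (eA : enc_of A) : enc_of (seq A) := foldr (fun a t => Nd (eA a) t) Lf.
Definition eN : enc_of nat := fun n => eL eB (bits n).
(** Unary, for sizes, indices and time bounds, where arithmetic is mere iteration; [eN] is for the
    numbers of an instance, which may be exponential in its length. *)
Definition eU : enc_of nat := fun n => iter n (Nd Lf) Lf.

Section Programs.
Variable S : finType.
Local Notation G := (sym2 S).
Local Notation cmd := (cmd S).
Local Notation store := (store S).

Implicit Types (m x y z w io : seq G) (t : tree).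

Lemma exec_eq (c : cmd) s s' s'' n : exec c s s' n -> s' = s'' -> exec c s s'' n.
Proof. by move=> h <-. Qed.

Lemma exec_case_le r g (s s' : store) n N :
  exec (g (ohead (rget r s))) s s' n -> n < N -> exec (Case r g) s s' N.
Proof. by move=> h; apply: exec_le (exec_case h). Qed.

Definition bsym b : G := inl b.
Definition word t : seq G := map bsym (code t).

Lemma size_word t : size (word t) = tsize t.
Proof. by rewrite size_map. Qed.

Lemma word_Nd a b : word (Nd a b) = bsym true :: word a ++ word b.
Proof. by rewrite /word /= map_cat. Qed.

Definition clear X : cmd := While X isSome (Pop S X).

Lemma exec_clear X s : exec (clear X) s (rset X [::] s) (2 * size (rget X s) + 1).
Proof.
elim: (rget X s) {-2}s (erefl (rget X s)) => [|g z ih] s' e.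
  by have := @exec_while0 S X isSome (Pop S X) s'; rewrite e => /(_ isT); rewrite -{2}(rset_get X s') e.
apply: exec_le (exec_while1 _ (exec_pop _ _) (exec_eq (ih _ _) _)) _; rewrite ?rget_set ?e //.
  by case: s' {e} => [[[[[? ?] ?] ?] ?] ?]; case: X {ih}.
by rewrite /=; lia.
Qed.

Definition transfer X Y : cmd :=
  While X isSome (Case X (fun o => if o is Some g then Seq (Pop S X) (Push Y g) else Skip S)).

Lemma exec_transfer X Y s : X <> Y ->
  exec (transfer X Y) s (rset X [::] (rset Y (rev (rget X s) ++ rget Y s) s)) (4 * size (rget X s) + 1).
Proof.
move=> ne; elim: (rget X s) {-2}s (erefl (rget X s)) => [|g z ih] s' e.
  have := @exec_while0 S X isSome
    (Case X (fun o => if o is Some g then Seq (Pop S X) (Push Y g) else Skip S)) s'.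
  rewrite e => /(_ isT) h; apply: exec_eq h _.
  by rewrite /= rset_get -e rset_get.
set s1 := rset Y (g :: rget Y s') (rset X z s').
have e1 : rget X s1 = z.
  by rewrite /s1; case: s' {e s1} => [[[[[? ?] ?] ?] ?] ?]; move: ne; case: X {ih}; case: Y.
have h : exec (Case X (fun o => if o is Some g then Seq (Pop S X) (Push Y g) else Skip S)) s' s1 3.
  apply: exec_case; rewrite e /=; apply: (exec_eq (exec_seq (exec_pop _ _) (exec_push _ _ _))).
  rewrite e /= /s1.
  by case: s' {e s1 e1} => [[[[[? ?] ?] ?] ?] ?]; move: ne; case: X {ih}; case: Y.
apply: exec_le (exec_while1 _ h (exec_eq (ih _ e1) _)) _; rewrite ?e //.
  rewrite rev_cons -cats1 -catA /s1.
  by case: s' {e h s1 e1} => [[[[[? ?] ?] ?] ?] ?]; move: ne; case: X {ih}; case: Y.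
rewrite e1 /=; lia.
Qed.

(* The counter stack holds one mark per tree that remains to be read. *)
Definition mvbody X : cmd :=
  Seq (Pop S RC) (Case MS (fun o => if o is Some (inl true) then
     Seq (Pop S MS) (Seq (Push X (bsym true)) (Seq (Push RC (bsym true)) (Push RC (bsym true))))
   else Seq (Pop S MS) (Push X (bsym false)))).
Definition mvloop X : cmd := While RC isSome (mvbody X).
Definition mvtree X : cmd := Seq (Push RC (bsym true)) (mvloop X).

Section MoveTree.
Variables (X : reg) (s0 : store).
Hypothesis okX : match X with MS | RC => False | _ => True end.
Let st3 cn m x := rset RC cn (rset MS m (rset X x s0)).

(** Phrased with a continuation: a run from the store after moving t extends to one from the store
    before. In this form the induction hypotheses for the two subtrees compose under any counter. *)
Lemma mvloop_tree t cn m x s' n :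
  exec (mvloop X) (st3 cn m (rev (word t) ++ x)) s' n ->
  exec (mvloop X) (st3 (bsym true :: cn) (word t ++ m) x) s' (n + 8 * tsize t).
Proof.
have gC cn' m' x' : rget RC (st3 cn' m' x') = cn' by rewrite /st3 rget_set.
elim: t cn m x s' n => [|a iha b ihb] cn m x s' n h.
  have h1 : exec (mvbody X) (st3 (bsym true :: cn) (word Lf ++ m) x) (st3 cn m (rev (word Lf) ++ x)) 7.
    apply: exec_le (exec_seq (exec_pop _ _) (exec_case (s' := st3 cn m (bsym false :: x)) (n := 2) _)) _ => //.
    rewrite /st3; move: okX; case: s0 => [[[[[? ?] ?] ?] ?] ?]; case: X => //= _;
    exact: exec_seq (exec_pop _ _) (exec_push _ _ _).
  by apply: exec_le (exec_while1 _ h1 h) _; rewrite ?gC // /tsize /=; lia.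
have h1 : exec (mvbody X) (st3 (bsym true :: cn) (word (Nd a b) ++ m) x)
    (st3 (bsym true :: bsym true :: cn) (word a ++ (word b ++ m)) (bsym true :: x)) 7.
  apply: exec_le (exec_seq (exec_pop _ _) (exec_case (n := 4) _)) _ => //.
  rewrite word_Nd /st3; move: okX; case: s0 => [[[[[? ?] ?] ?] ?] ?]; case: X => //= _;
  rewrite -catA; exact: exec_seq (exec_pop _ _) (exec_seq (exec_push _ _ _) (exec_seq (exec_push _ _ _) (exec_push _ _ _))).
apply: exec_le (exec_while1 _ h1 (iha _ _ _ _ _ (ihb _ _ _ _ n _))) _; rewrite ?gC //.
  by move: h; rewrite word_Nd rev_cons rev_cat -cats1 -!catA.
by rewrite tsize_Nd; lia.
Qed.

Lemma exec_mvtree t m x : exec (mvtree X) (st3 [::] (word t ++ m) x)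
  (st3 [::] m (rev (word t) ++ x)) (8 * tsize t + 2).
Proof.
have e : rset RC [:: bsym true] (st3 [::] (word t ++ m) x) = st3 [:: bsym true] (word t ++ m) x.
  by rewrite /st3; case: (rset X x s0) => [[[[[? ?] ?] ?] ?] ?].
have h : exec (mvloop X) (st3 [::] m (rev (word t) ++ x)) (st3 [::] m (rev (word t) ++ x)) 1.
  by apply: exec_while0; rewrite rget_set.
have h1 : exec (Push RC (bsym true)) (st3 [::] (word t ++ m) x) (st3 [:: bsym true] (word t ++ m) x) 1.
  by apply: exec_eq (exec_push _ _ _) _; rewrite -e {2}/st3 rget_set.
by apply: exec_le (exec_seq h1 (mvloop_tree h)) _; lia.
Qed.

End MoveTree.

Definition main_store m : store := ([::], m, [::], [::], [::], [::]).

Lemma exec_mvX io t m y z : exec (mvtree RX) (io, word t ++ m, [::], y, z, [::])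
  (io, m, rev (word t), y, z, [::]) (8 * tsize t + 2).
Proof. by rewrite -[rev _]cats0; exact: (@exec_mvtree RX (io, m, [::], y, z, [::])). Qed.
Lemma exec_mvY io t m x z : exec (mvtree RY) (io, word t ++ m, x, [::], z, [::])
  (io, m, x, rev (word t), z, [::]) (8 * tsize t + 2).
Proof. by rewrite -[rev _]cats0; exact: (@exec_mvtree RY (io, m, x, [::], z, [::])). Qed.
Lemma exec_mvZ io t m x y : exec (mvtree RZ) (io, word t ++ m, x, y, [::], [::])
  (io, m, x, y, rev (word t), [::]) (8 * tsize t + 2).
Proof. by rewrite -[rev _]cats0; exact: (@exec_mvtree RZ (io, m, x, y, [::], [::])). Qed.

Lemma exec_trX io t m y z w : exec (transfer RX MS) (io, m, rev (word t), y, z, w)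
  (io, word t ++ m, [::], y, z, w) (4 * tsize t + 1).
Proof. by apply: exec_le (exec_eq (exec_transfer _ _) _) _; rewrite //= ?revK // size_rev size_word. Qed.
Lemma exec_trY io t m x z w : exec (transfer RY MS) (io, m, x, rev (word t), z, w)
  (io, word t ++ m, x, [::], z, w) (4 * tsize t + 1).
Proof. by apply: exec_le (exec_eq (exec_transfer _ _) _) _; rewrite //= ?revK // size_rev size_word. Qed.
Lemma exec_trZ io t m x y w : exec (transfer RZ MS) (io, m, x, y, rev (word t), w)
  (io, word t ++ m, x, y, [::], w) (4 * tsize t + 1).
Proof. by apply: exec_le (exec_eq (exec_transfer _ _) _) _; rewrite //= ?revK // size_rev size_word. Qed.

Definition drop_top : cmd := Seq (mvtree RY) (clear RY).

Lemma exec_drop io t m x z :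
  exec drop_top (io, word t ++ m, x, [::], z, [::]) (io, m, x, [::], z, [::]) (10 * tsize t + 3).
Proof.
apply: exec_le (exec_seq (exec_mvY _ _ _ _ _) (exec_clear _ _)) _.
by rewrite /= size_rev size_word; lia.
Qed.

Definition swap_top : cmd :=
  Seq (mvtree RX) (Seq (mvtree RY) (Seq (transfer RX MS) (transfer RY MS))).

Lemma exec_swap t1 t2 m : exec swap_top (main_store (word t1 ++ word t2 ++ m)) (main_store (word t2 ++ word t1 ++ m))
  (12 * tsize t1 + 12 * tsize t2 + 6).
Proof.
apply: exec_le (exec_seq (exec_mvX _ _ _ _ _) (exec_seq (exec_mvY _ _ _ _ _)
  (exec_seq (exec_trX _ _ _ _ _ _) (exec_trY _ _ _ _ _ _)))) _; lia.
Qed.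

Definition dup_loop : cmd :=
  While RX isSome (Case RX (fun o => if o is Some g then
    Seq (Pop S RX) (Seq (Push MS g) (Push RY g)) else Skip S)).
Definition dup_top : cmd :=
  Seq (mvtree RX) (Seq dup_loop (Seq (transfer RY RX) (transfer RX MS))).

Lemma exec_dup_loop m x y :
  exec dup_loop ([::], m, x, y, [::], [::]) ([::], rev x ++ m, [::], rev x ++ y, [::], [::]) (5 * size x + 1).
Proof.
elim: x m y => [|g x ih] m y; first exact: exec_while0.
rewrite rev_cons -cats1 -!catA.
apply: exec_le (exec_while1 _ (exec_case (n := 3) _) (ih _ _)) _ => //=; last by lia.
exact: exec_seq (exec_pop _ _) (exec_seq (exec_push _ _ _) (exec_push _ _ _)).
Qed.

Lemma exec_dup t m : exec dup_top (main_store (word t ++ m)) (main_store (word t ++ word t ++ m)) (21 * tsize t + 5).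
Proof.
have h := @exec_dup_loop m (rev (word t)) [::]; rewrite revK cats0 in h.
have h2 : exec (transfer RY RX) ([::], word t ++ m, [::], word t, [::], [::])
    ([::], word t ++ m, rev (word t), [::], [::], [::]) (4 * tsize t + 1).
  by apply: exec_le (exec_eq (exec_transfer _ _) _) _; rewrite //= ?cats0 // size_word.
apply: exec_le (exec_seq (exec_mvX _ _ _ _ _) (exec_seq h (exec_seq h2 (exec_trX _ _ _ _ _ _)))) _.
by rewrite size_rev size_word; lia.
Qed.

Definition hd_top : cmd :=
  Case MS (fun o => if o is Some (inl true) then
    Seq (Pop S MS) (Seq (mvtree RX) (Seq drop_top (transfer RX MS))) else Skip S).

Lemma exec_hd t m : exec hd_top (main_store (word t ++ m)) (main_store (word (thd t) ++ m)) (22 * tsize t + 8).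
Proof.
case: t => [|a b]; first by apply: exec_case_le; [exact: exec_skip | rewrite /tsize /=; lia].
rewrite word_Nd; apply: exec_case_le; rewrite /= -?catA ?tsize_Nd.
  apply: exec_seq; [exact: exec_pop | apply: exec_seq; [exact: exec_mvX | ]].
  by apply: exec_seq; [exact: exec_drop | exact: exec_trX].
by lia.
Qed.

Definition tl_top : cmd :=
  Case MS (fun o => if o is Some (inl true) then Seq (Pop S MS) drop_top else Skip S).

Lemma exec_tl t m : exec tl_top (main_store (word t ++ m)) (main_store (word (ttl t) ++ m)) (10 * tsize t + 6).
Proof.
case: t => [|a b]; first by apply: exec_case_le; [exact: exec_skip | rewrite /tsize /=; lia].
rewrite word_Nd; apply: exec_case_le; rewrite /= -?catA ?tsize_Nd.
  by apply: exec_seq; [exact: exec_pop | exact: exec_drop].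
by lia.
Qed.

Definition push_word z : cmd := foldr (fun g c => Seq c (Push MS g)) (Skip S) z.

Lemma exec_push_words z io m x y u w : exec (push_word z) (io, m, x, y, u, w)
  (io, z ++ m, x, y, u, w) (size z + 1).
Proof.
elim: z => [|g z ih]; first exact: exec_skip.
by apply: exec_le (exec_seq ih (exec_push _ _ _)) _; rewrite /=; lia.
Qed.

Lemma exec_push_word z m : exec (push_word z) (main_store m) (main_store (z ++ m)) (size z + 1).
Proof. exact: exec_push_words. Qed.

(** Every mismatch, as well as every letter by which one word exceeds the other, leaves a mark on
    [RC]. Both words are thus consumed in either case, and they are equal iff [RC] is empty at the
    end. *)
Definition eqtest : cmd :=
  Seq (While RX isSome (Case RX (fun g => Seq (Pop S RX) (Case RY (fun g' => Seq (Pop S RY)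
        (if g == g' then Skip S else Push RC (bsym true)))))))
   (Seq (While RY isSome (Seq (Pop S RY) (Push RC (bsym true))))
    (Case RC (fun o => if o is None then push_word (word (eB true))
                       else Seq (clear RC) (push_word (word (eB false)))))).
Definition eq_top : cmd := Seq (Pop S MS) (Seq (mvtree RX) (Seq (mvtree RY) eqtest)).

Lemma exec_eqtest x y m : exec eqtest ([::], m, x, y, [::], [::])
  (main_store (word (eB (x == y)) ++ m)) (20 * (size x + size y) + 20).
Proof.
rewrite /eqtest; set L1 := While RX _ _; set L2 := While RY _ _.
have h1 k : exists k', [/\ (k' == 0) = (k == 0) && (x == take (size x) y), k' <= k + size x &
    exec L1 ([::], m, x, y, [::], nseq k (bsym true))
     ([::], m, [::], drop (size x) y, [::], nseq k' (bsym true)) (6 * size x + 1)].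
  elim: x y k => [|a x ih] y k.
    by exists k; rewrite take0 drop0 addn0 eqxx andbT; split=> //; apply: exec_while0.
  have h0 : exec (Case RX (fun g => Seq (Pop S RX) (Case RY (fun g' => Seq (Pop S RY)
        (if g == g' then Skip S else Push RC (bsym true))))))
      ([::], m, a :: x, y, [::], nseq k (bsym true))
      ([::], m, x, behead y, [::], nseq (if Some a == ohead y then k else k.+1) (bsym true)) 5.
    apply: exec_case => /=; apply: exec_seq (exec_pop _ _) (exec_case _) => /=.
    apply: exec_seq (exec_pop _ _) _ => /=.
    by case: (Some a == ohead y); [apply: exec_skip | apply: exec_eq (exec_push _ _ _) _].
  have [k' [e le h]] := ih (behead y) (if Some a == ohead y then k else k.+1).
  exists k'; split.
  - rewrite e; case: y {h0 h e le} => [|b y] /=; first by rewrite andbF.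
    by rewrite eqseq_cons -[Some a == Some b]/(a == b); case: (a =P b) => //= _; rewrite ?andbF.
  - by rewrite /=; case: (_ == _) in le; lia.
  have -> : drop (size (a :: x)) y = drop (size x) (behead y) by case: y {h0 h e le}.
  by apply: exec_le (exec_while1 _ h0 h) _ => //=; lia.
have h2 z k : exec L2 ([::], m, [::], z, [::], nseq k (bsym true))
    ([::], m, [::], [::], [::], nseq (k + size z) (bsym true)) (3 * size z + 1).
  elim: z k => [|a z ih] k; first by rewrite addn0; apply: exec_while0.
  rewrite [size _]/= -addSnnS.
  have h0 : exec (Seq (Pop S RY) (Push RC (bsym true))) ([::], m, [::], a :: z, [::], nseq k (bsym true))
     ([::], m, [::], z, [::], nseq k.+1 (bsym true)) 2 by apply: exec_seq (exec_pop _ _) (exec_push _ _ _).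
  by apply: exec_le (exec_while1 _ h0 (ih k.+1)) _ => //=; lia.
have [k [ek lek h]] := h1 0; have {}h2 := h2 (drop (size x) y) k.
apply: exec_le (exec_seq h (exec_seq h2 (exec_case (n := 2 * (k + size y) + 6) _))) _ => /=; last first.
  by rewrite size_drop; lia.
have -> : (x == y) = (k + size (drop (size x) y) == 0).
  rewrite addn_eq0 ek /= size_drop subn_eq0 -{1}(cat_take_drop (size x) y).
  case: leqP => le; first by rewrite andbT drop_oversize // cats0.
  rewrite andbF; apply/eqP => /(congr1 size); rewrite size_cat size_takel ?size_drop ?(ltnW le) //; move: le; rewrite -subn_gt0 => le /eqP; rewrite -{1}[size x]addn0 eqn_add2l eq_sym; move: le; case: (_ - _) => [|?] //.
have eK : k + size (drop (size x) y) <= k + size y by rewrite size_drop; lia.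
case: (k + size (drop (size x) y)) eK => [|n] eK /=.
  by apply: exec_le (exec_push_word (word (eB true)) m) _; rewrite size_word /tsize /=; lia.
apply: exec_le; first by apply: exec_seq; [exact: exec_clear | exact: (exec_push_word (word (eB false)) m)].
by rewrite /= size_nseq; lia.
Qed.

Lemma exec_eq_top a b m : exec eq_top (main_store (word (Nd a b) ++ m)) (main_store (word (eB (code a == code b)) ++ m))
  (30 * tsize (Nd a b) + 20).
Proof.
have -> : (code a == code b) = (rev (word a) == rev (word b)).
  by rewrite (can_eq revK) (inj_eq (inj_map (@inl_inj _ _))).
rewrite word_Nd /= -catA.
apply: exec_le.
  apply: exec_seq; [exact: exec_pop | apply: exec_seq; [exact: exec_mvX | ]].
  by apply: exec_seq; [exact: exec_mvY | exact: exec_eqtest].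
by rewrite tsize_Nd !size_rev !size_word; lia.
Qed.

End Programs.

(** * Polynomial-time functions *)

(* Polynomial-time computability; the arbitrary [m] allows programs to run above pending values. *)
Definition fp A B (eA : enc_of A) (eB : enc_of B) (f : A -> B) : Prop :=
  forall S : finType, exists c : cmd S, exists2 p, polyn p &
  forall a m, exec c (main_store (word S (eA a) ++ m)) (main_store (word S (eB (f a)) ++ m)) (p (tsize (eA a))).

Lemma runs_height S (c : cmd S) (q : ctrl c) s s' n :
  runs q s s' n -> height s' <= height s + n.
Proof.
elim=> {q s s' n} [q s _|q q' s s' n _ _ ih]; first by rewrite addn1 height_act.
by have := height_act (op q) s; lia.
Qed.

Section Basic.
Variables (A B : Type) (eA : enc_of A) (eB' : enc_of B).

(** A program pushes at most one letter per step, so the output is no longer than the input plus the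
    running time. *)
Lemma fp_size (f : A -> B) : fp eA eB' f ->
  exists q, [/\ polyn q, forall a, tsize (eB' (f a)) <= q (tsize (eA a)) &
                forall m n, m <= n -> q m <= q n].
Proof.
move=> /(_ unit)[c [p hp h]].
have [q [hq le mono]] := polyn_mono (polyn_add polyn_id hp); exists q; split=> // a.
apply: leq_trans (le _); have [n hn /runs_height] := h a [::].
by rewrite /= !cats0 !size_word /id; lia.
Qed.

Lemma fp_ext (f g : A -> B) : f =1 g -> fp eA eB' f -> fp eA eB' g.
Proof. by move=> e h S; have [c [p hp hc]] := h S; exists c, p => // a m; rewrite -e. Qed.

Lemma fp_repr (f : A -> B) : (forall a, eB' (f a) = eA a) -> fp eA eB' f.
Proof.
move=> e S; exists (Skip S), (fun _ => 1); first exact: polyn_const.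
by move=> a m; rewrite e; apply: exec_skip.
Qed.

End Basic.

Section Closure.
Variables (A B C : Type) (eA : enc_of A) (eB' : enc_of B) (eC : enc_of C).

Lemma fp_comp (f : A -> B) (g : B -> C) :
  fp eA eB' f -> fp eB' eC g -> fp eA eC (fun a => g (f a)).
Proof.
move=> hf hg S; have [q [hq le _]] := fp_size hf.
have [c1 [p1 hp1 h1]] := hf S; have [c2 [p2 hp2 h2]] := hg S.
have [r [hr ler mono]] := polyn_mono hp2.
exists (Seq c1 c2), (fun n => p1 n + r (q n)).
  exact: polyn_add hp1 (polyn_comp hr hq).
move=> a m; apply: exec_le (exec_seq (h1 a m) (h2 _ m)) _.
by rewrite leq_add2l (leq_trans (ler _)) // mono.
Qed.

Lemma fp_const (b : B) : fp eA eB' (fun _ => b).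
Proof.
move=> S; exists (Seq (drop_top S) (push_word (word S (eB' b)))), (fun n => 10 * n + 3 + (tsize (eB' b) + 1)).
  by polyn_tac.
move=> a m; apply: exec_seq (exec_drop _ _ _ _ _) _.
by rewrite -(size_word S); exact: exec_push_word.
Qed.

Lemma fp_pair (f : A -> B) (g : A -> C) :
  fp eA eB' f -> fp eA eC g -> fp eA (eP eB' eC) (fun a => (f a, g a)).
Proof.
move=> hf hg S; have [q [hq le _]] := fp_size hg.
have [c1 [p1 hp1 h1]] := hf S; have [c2 [p2 hp2 h2]] := hg S.
exists (Seq (dup_top S) (Seq c2 (Seq (swap_top S) (Seq c1 (Push MS (bsym S true)))))).
exists (fun n => 21 * n + 5 + (p2 n + (12 * q n + 12 * n + 6 + (p1 n + 1)))).
  by polyn_tac.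
move=> a m; apply: exec_seq (exec_dup _ _) _; apply: exec_seq (h2 _ _) _.
apply: exec_seq; first by apply: exec_le (exec_swap _ _ _) _; have := le a; lia.
apply: exec_seq (h1 _ _) _; apply: exec_eq (exec_push _ _ _) _.
by rewrite -[eP eB' eC _]/(Nd (eB' (f a)) (eC (g a))) word_Nd /= -catA.
Qed.

End Closure.

Lemma fp_thd : fp eT eT thd.
Proof.
move=> S; exists (hd_top S), (fun n => 22 * n + 8); first by polyn_tac.
by move=> a m; apply: exec_hd.
Qed.

Lemma fp_ttl : fp eT eT ttl.
Proof.
move=> S; exists (tl_top S), (fun n => 10 * n + 6); first by polyn_tac.
by move=> a m; apply: exec_tl.
Qed.

Lemma fp_eqcode A (eA : enc_of A) : fp (eP eA eA) eB (fun p => code (eA p.1) == code (eA p.2)).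
Proof.
move=> S; exists (eq_top S), (fun n => 30 * n + 20); first by polyn_tac.
by move=> [a b] m; apply: exec_eq_top.
Qed.

Lemma fp_if A B (eA : enc_of A) (eB' : enc_of B) (b : A -> bool) (f g : A -> B) :
  fp eA eB b -> fp eA eB' f -> fp eA eB' g -> fp eA eB' (fun a => if b a then f a else g a).
Proof.
move=> hb hf hg S; have [c [p hp h]] := hb S.
have [c1 [p1 hp1 h1]] := hf S; have [c2 [p2 hp2 h2]] := hg S.
(* The code of [true] has three letters and that of [false] one, which explains the numbers of
   pops. *)
exists (Seq (dup_top S) (Seq c (Case MS (fun o => if o is Some (inl true) then
  Seq (Pop S MS) (Seq (Pop S MS) (Seq (Pop S MS) c1)) else Seq (Pop S MS) c2)))).
exists (fun n => 21 * n + 5 + (p n + (p1 n + p2 n + 4))); first by polyn_tac.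
move=> a m; apply: exec_seq (exec_dup _ _) _; apply: exec_seq (h _ _) _.
case: (b a).
- apply: exec_case_le => /=.
    apply: exec_seq; [exact: exec_pop | apply: exec_seq; [exact: exec_pop | ]].
    by apply: exec_seq; [exact: exec_pop | exact: h1].
  by lia.
- apply: exec_case_le => /=; first by apply: exec_seq; [exact: exec_pop | exact: h2].
  by lia.
Qed.

Lemma size_le_eL A (eA : enc_of A) l : size l <= tsize (eL eA l).
Proof. by elim: l => //= a l ih; rewrite tsize_Nd; lia. Qed.

Section Fold.
Variables (A B D : Type) (eA : enc_of A) (eS : enc_of B) (eD : enc_of D).
Variables (f : A -> B -> B) (l : D -> seq A) (s0 : D -> B).

(* Without the bound on the intermediate results, iteration would leave polynomial time. *)
Lemma fp_fold0 (q : nat -> nat) : polyn q ->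
  fp eD (eP (eL eA) eS) (fun d => (l d, s0 d)) ->
  fp (eP eA eS) eS (fun p => f p.1 p.2) ->
  (forall d l1 l2, l d = l1 ++ l2 ->
     tsize (eS (foldl (fun s a => f a s) (s0 d) l1)) <= q (tsize (eD d))) ->
  fp eD eS (fun d => foldl (fun s a => f a s) (s0 d) (l d)).
Proof.
move=> hq h0 hf bound S.
have [q0 [hq0 le0 _]] := fp_size h0.
have [c0 [p0 hp0 hc0]] := h0 S; have [cf [pf0 hpf0 hcf0]] := hf S.
have [pf [hpf lepf monopf]] := polyn_mono hpf0.
have hcf a s m : exec cf (main_store (word S (Nd (eA a) (eS s)) ++ m)) (main_store (word S (eS (f a s)) ++ m))
    (pf (tsize (Nd (eA a) (eS s)))) by apply: exec_le (hcf0 (a, s) m) (lepf _).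
pose tst (o : option (sym2 S)) := o == Some (inl true).
(* The first element, the tail and the state are parked in [RX], [RY] and [RZ], then put back with
   the tail lowest. A pushed [true] turns element and state into a pair for [cf], and the final swap
   brings the tail back to the top for the next round. *)
pose body := Seq (Pop S MS) (Seq (mvtree S RX) (Seq (mvtree S RY) (Seq (mvtree S RZ)
  (Seq (transfer S RY MS) (Seq (transfer S RZ MS) (Seq (transfer S RX MS)
  (Seq (Push MS (bsym S true)) (Seq cf (swap_top S))))))))).
pose loop := While MS tst body.
pose K Q N := 36 * N + 36 * Q + pf (1 + N + Q) + 24.
have hloop d Q N m l1 l2 : l d = l1 ++ l2 -> tsize (eL eA l2) <= N ->
    (forall l1 l2, l d = l1 ++ l2 -> tsize (eS (foldl (fun s a => f a s) (s0 d) l1)) <= Q) ->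
    exec loop (main_store (word S (eL eA l2) ++ word S (eS (foldl (fun s a => f a s) (s0 d) l1)) ++ m))
    (main_store (bsym S false :: word S (eS (foldl (fun s a => f a s) (s0 d) (l d))) ++ m)) (size l2 * K Q N + 1).
  move=> + + le; elim: l2 l1 => [|a l2 ih] l1 e leN.
    by rewrite e cats0; apply: exec_while0.
  have e1 : l d = rcons l1 a ++ l2 by rewrite e cat_rcons.
  have /= := leN; rewrite tsize_Nd => leN'.
  set s := foldl _ _ l1; have les : tsize (eS s) <= Q by exact: le e.
  have := le _ _ e1; have := ih _ e1; rewrite foldl_rcons -/s.
  have ->: tsize (eL eA l2) <= N by lia.
  move=> /(_ isT) ih1 les1; rewrite /=.
  suff h : exec body (main_store (word S (Nd (eA a) (eL eA l2)) ++ word S (eS s) ++ m))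
      (main_store (word S (eL eA l2) ++ word S (eS (f a s)) ++ m)) (K Q N).-1.
    apply: exec_le (exec_while1 _ h ih1) _; first by rewrite word_Nd.
    by rewrite mulSn -addSn addnA leq_add2r leq_add2r /K; lia.
  rewrite word_Nd /= -!catA; apply: exec_le.
  - apply: exec_seq; [exact: exec_pop | apply: exec_seq; [exact: exec_mvX | ]].
    apply: exec_seq; [exact: exec_mvY | apply: exec_seq; [exact: exec_mvZ | ]].
    apply: exec_seq; [exact: exec_trY | apply: exec_seq; [exact: exec_trZ | ]].
    apply: exec_seq; [exact: exec_trX | apply: exec_seq; [exact: exec_push | ]].
    apply: exec_seq; last exact: exec_swap.
    by have := hcf a s (word S (eL eA l2) ++ m); rewrite word_Nd /= -!catA; apply.
  have : pf (tsize (Nd (eA a) (eS s))) <= pf (1 + N + Q) by apply: monopf; rewrite tsize_Nd; lia.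
  by rewrite /K; lia.
exists (Seq c0 (Seq (Pop S MS) (Seq loop (Pop S MS)))).
exists (fun n => p0 n + (1 + (q0 n * K (q n) (q0 n) + 1 + 1))).
  rewrite /K; polyn_tac.
move=> d m; apply: exec_seq (hc0 d m) _.
have := le0 d; rewrite /eP /= tsize_Nd => leN.
rewrite map_cat -/(word S (eL eA (l d))) -/(word S (eS (s0 d))) -catA.
have hl := @hloop d (q (tsize (eD d))) (q0 (tsize (eD d))) m [::] (l d) erefl.
apply: exec_le.
  apply: exec_seq; [exact: exec_pop | apply: exec_seq; [apply: hl | exact: exec_pop]]; first by lia.
  by move=> l1 l2; apply: bound.
have := size_le_eL eA (l d); rewrite leq_add2l !leq_add2r => h.
by rewrite leq_mul //; lia.
Qed.

End Fold.

(** * Lists *)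

Lemma fp_via A B (eA : enc_of A) (eB' : enc_of B) (g : tree -> tree) (f : A -> B) :
  fp eT eT g -> (forall a, g (eA a) = eB' (f a)) -> fp eA eB' f.
Proof.
move=> h e S; have [c [p hp hc]] := h S; exists c, p => // a m.
by rewrite -e; exact: hc.
Qed.

Section Env.
Variables (X : Type) (e : enc_of X).

Lemma fp_id : fp e e (fun x => x).
Proof. exact: fp_repr. Qed.

Section Pairs.
Variables (A B C : Type) (eA : enc_of A) (eB' : enc_of B) (eC : enc_of C).

Lemma fp_fst (f : X -> A * B) : fp e (eP eA eB') f -> fp e eA (fun x => (f x).1).
Proof. by move=> h; apply: fp_comp h _; apply: fp_via fp_thd _; case. Qed.

Lemma fp_snd (f : X -> A * B) : fp e (eP eA eB') f -> fp e eB' (fun x => (f x).2).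
Proof. by move=> h; apply: fp_comp h _; apply: fp_via fp_ttl _; case. Qed.

Lemma fp_cons (f : X -> A) (g : X -> seq A) :
  fp e eA f -> fp e (eL eA) g -> fp e (eL eA) (fun x => f x :: g x).
Proof.
by move=> hf hg; apply: (fp_comp (fp_pair hf hg) (g := fun p => p.1 :: p.2)); apply: fp_repr.
Qed.

Lemma fp_behead (f : X -> seq A) : fp e (eL eA) f -> fp e (eL eA) (fun x => behead (f x)).
Proof. by move=> h; apply: fp_comp h _; apply: fp_via fp_ttl _; case. Qed.

End Pairs.

Definition isLf t := if t is Lf then true else false.

Lemma fp_eqtree A (eA : enc_of A) (f g : X -> A) : fp e eA f -> fp e eA g ->
  fp e eB (fun x => code (eA (f x)) == code (eA (g x))).
Proof. by move=> hf hg; apply: fp_comp (fp_pair hf hg) (fp_eqcode eA). Qed.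

Lemma fp_eq (A : eqType) (eA : enc_of A) (f g : X -> A) : injective eA ->
  fp e eA f -> fp e eA g -> fp e eB (fun x => f x == g x).
Proof.
move=> inj hf hg; apply: fp_ext (fp_eqtree hf hg) => x.
by apply/eqP/eqP => [/code_inj/inj|->].
Qed.

End Env.

Lemma fp_isLf : fp eT eB isLf.
Proof.
apply: fp_ext (fp_eqtree (fp_id eT) (fp_const eT eT Lf)) => -[|a b]; exact: erefl.
Qed.

Section Env2.
Variables (X : Type) (e : enc_of X).

Lemma fp_nilp A (eA : enc_of A) (f : X -> seq A) : fp e (eL eA) f -> fp e eB (fun x => nilp (f x)).
Proof.
move=> h; apply: (fp_comp h); apply: fp_ext (fp_comp (fp_repr (f := eL eA) _) fp_isLf) => //.
by case.
Qed.

Lemma fp_head A (eA : enc_of A) (d : A) (f : X -> seq A) :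
  fp e (eL eA) f -> fp e eA (fun x => head d (f x)).
Proof.
move=> h; apply: (fp_comp h).
pose g t := if isLf t then eA d else thd t.
apply: (fp_via (g := g)); last by case.
by apply: fp_if fp_isLf (fp_const eT eT (eA d)) fp_thd.
Qed.

Lemma fp_andb (f g : X -> bool) : fp e eB f -> fp e eB g -> fp e eB (fun x => f x && g x).
Proof.
by move=> hf hg; apply: fp_ext (fp_if hf hg (fp_const e eB false)) => x; case: (f x).
Qed.
Lemma fp_negb (f : X -> bool) : fp e eB f -> fp e eB (fun x => ~~ f x).
Proof.
by move=> hf; apply: fp_ext (fp_if hf (fp_const e eB false) (fp_const e eB true)) => x; case: (f x).
Qed.
Lemma fp_implb (f g : X -> bool) : fp e eB f -> fp e eB g -> fp e eB (fun x => f x ==> g x).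
Proof.
by move=> hf hg; apply: fp_ext (fp_if hf hg (fp_const e eB true)) => x; case: (f x).
Qed.

(** A step may consult the environment: a copy of x travels inside the state of [fp_fold0]. *)
Lemma fp_foldl A B (eA : enc_of A) (eS : enc_of B) (f : X -> B -> A -> B) l s0 (q : nat -> nat) :
  polyn q -> fp e (eL eA) l -> fp e eS s0 ->
  fp (eP (eP e eS) eA) eS (fun p => f p.1.1 p.1.2 p.2) ->
  (forall x l1 l2, l x = l1 ++ l2 -> tsize (eS (foldl (f x) (s0 x) l1)) <= q (tsize (e x))) ->
  fp e eS (fun x => foldl (f x) (s0 x) (l x)).
Proof.
move=> hq hl h0 hf bound.
have E x s l' : foldl (fun (p : X * B) a => (p.1, f p.1 p.2 a)) (x, s) l' = (x, foldl (f x) s l').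
  by elim: l' s => //= a l' ih s; rewrite ih.
apply: fp_ext (fp_snd (f := fun x => foldl (fun (p : X * B) a => (p.1, f p.1 p.2 a)) (x, s0 x) (l x)) _).
  by move=> x /=; rewrite E.
apply: (@fp_fold0 _ _ _ eA (eP e eS) e (fun a p => (p.1, f p.1 p.2 a)) l (fun x => (x, s0 x))
  (fun n => (n + q n).+1)).
- by apply: polyn_le (polyn_add (polyn_const 1) (polyn_add polyn_id hq)) => n /=; rewrite add1n.
- by apply: fp_pair hl (fp_pair (fp_id e) h0).
- have hid := fp_id (eP eA (eP e eS)).
  apply: fp_pair; first exact: fp_fst (fp_snd hid).
  by apply: (fp_comp (f := fun p => (p.2.1, p.2.2, p.1)) _ hf); apply: fp_pair (fp_fst hid);
    exact: fp_pair (fp_fst (fp_snd hid)) (fp_snd (fp_snd hid)).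
- by move=> x l1 l2 h; rewrite E /eP /= tsize_Nd; have := bound _ _ _ h; rewrite ltnS leq_add2l.
Qed.

(** If a step adds to the state an amount bounded independently of the state, the intermediate
    results stay below the initial size plus the number of steps times that amount. *)
Lemma fp_foldl_add A B (eA : enc_of A) (eS : enc_of B) (f : X -> B -> A -> B) l s0 (q : nat -> nat) :
  polyn q -> fp e (eL eA) l -> fp e eS s0 ->
  fp (eP (eP e eS) eA) eS (fun p => f p.1.1 p.1.2 p.2) ->
  (forall x s a, tsize (eS (f x s a)) <= tsize (eS s) + q (tsize (eP e eA (x, a)))) ->
  fp e eS (fun x => foldl (f x) (s0 x) (l x)).
Proof.
move=> hq hl h0 hf bound.
have [ql [hql leql _]] := fp_size hl; have [qs [hqs leqs _]] := fp_size h0.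
have [r [hr ler mono]] := polyn_mono hq.
apply: (@fp_foldl A B eA eS f l s0 (fun n => qs n + ql n * r (n + ql n + 1))) => //.
  by apply: polyn_add => //; apply: polyn_mul => //; apply: polyn_comp hr _; polyn_tac.
move=> x l1 l2 h; have := leql x; rewrite h => lel.
have hs : size l1 <= ql (tsize (e x)).
  apply: leq_trans lel; apply: leq_trans (size_le_eL eA _).
  by rewrite size_cat leq_addr.
suff : tsize (eS (foldl (f x) (s0 x) l1)) <=
    tsize (eS (s0 x)) + size l1 * r (tsize (e x) + ql (tsize (e x)) + 1).
  by move/leq_trans; apply; rewrite leq_add // leq_mul.
move: (s0 x) lel => s lel; clear -ler mono bound lel.
elim: l1 s lel => /= [|a l1 ih] s; rewrite ?addn0 // tsize_Nd => lel.
apply: leq_trans (ih _ _) _; first by lia.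
rewrite mulSn addnA leq_add2r; apply: leq_trans (bound _ _ _) _; rewrite leq_add2l.
by apply: leq_trans (ler _) _; apply: mono; rewrite /eP /= tsize_Nd; lia.
Qed.

Lemma foldl_catrev A (l s : seq A) : foldl (fun s a => a :: s) s l = catrev l s.
Proof. by elim: l s => //= a l ih s; rewrite ih. Qed.

Lemma fp_rev A (eA : enc_of A) (f : X -> seq A) : fp e (eL eA) f -> fp e (eL eA) (fun x => rev (f x)).
Proof.
move=> h; apply: (@fp_ext _ _ _ _ (fun x => foldl (fun s a => a :: s) [::] (f x))) => [x|]; first by rewrite foldl_catrev.
apply: (fp_foldl_add (q := fun n => n.+1)) (fp_const _ _ _) _ _; first by polyn_tac.
- exact: h.
- have hid := fp_id (eP (eP e (eL eA)) eA).
  exact: fp_cons (fp_snd hid) (fp_snd (fp_fst hid)).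
- by move=> x s a; rewrite /eP /= !tsize_Nd; lia.
Qed.

Lemma fp_map A B (eA : enc_of A) (eB' : enc_of B) (g : X -> A -> B) l :
  fp (eP e eA) eB' (fun p => g p.1 p.2) -> fp e (eL eA) l ->
  fp e (eL eB') (fun x => [seq g x a | a <- l x]).
Proof.
move=> hg hl; have E x l1 s : foldl (fun s a => g x a :: s) s l1 = catrev (map (g x) l1) s.
  by elim: l1 s => //= a l1 ih s; rewrite ih.
have [q [hq le _]] := fp_size hg.
apply: (@fp_ext _ _ _ _ (fun x => rev (foldl (fun s a => g x a :: s) [::] (l x)))) => [x|].
  by rewrite E revK.
apply: fp_rev; apply: (fp_foldl_add (q := fun n => (q n).+1)) (fp_const _ _ _) _ _.
- exact: (polyn_add (polyn_const 1) hq).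
- exact: hl.
- have hid := fp_id (eP (eP e (eL eB')) eA).
  apply: fp_cons (fp_snd (fp_fst hid)).
  by apply: (fp_comp (f := fun p => (p.1.1, p.2)) _ hg); apply: fp_pair (fp_fst (fp_fst hid)) (fp_snd hid).
- by move=> x s a; rewrite [eL _ _]/= tsize_Nd; have := le (x, a); rewrite [_.1]/= [_.2]/=; lia.
Qed.

Lemma fp_cat A (eA : enc_of A) (f g : X -> seq A) :
  fp e (eL eA) f -> fp e (eL eA) g -> fp e (eL eA) (fun x => f x ++ g x).
Proof.
move=> hf hg; apply: (@fp_ext _ _ _ _ (fun x => foldl (fun s a => a :: s) (g x) (rev (f x)))) => [x|].
  by rewrite foldl_catrev catrevE revK.
apply: (fp_foldl_add (q := fun n => n.+1)) (fp_rev hf) hg _ _; first by polyn_tac.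
- have hid := fp_id (eP (eP e (eL eA)) eA).
  exact: fp_cons (fp_snd hid) (fp_snd (fp_fst hid)).
- by move=> x s a; rewrite /eP /= !tsize_Nd; lia.
Qed.

Lemma tsize_bool b : tsize (eB b) <= 3. Proof. by case: b. Qed.

Lemma fp_all A (eA : enc_of A) (p : X -> A -> bool) l :
  fp (eP e eA) eB (fun z => p z.1 z.2) -> fp e (eL eA) l -> fp e eB (fun x => all (p x) (l x)).
Proof.
move=> hp hl; have E x l' b : foldl (fun b a => b && p x a) b l' = b && all (p x) l'.
  by elim: l' b => [|a l' ih] b /=; rewrite ?andbT // ih andbA.
apply: (@fp_ext _ _ _ _ (fun x => foldl (fun b a => b && p x a) true (l x))) => [x|]; first by rewrite E.
apply: (fp_foldl (q := fun n => 3)) hl (fp_const _ _ _) _ _; first by polyn_tac.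
- have hid := fp_id (eP (eP e eB) eA); apply: fp_ext (fp_if (fp_snd (fp_fst hid)) _ (fp_const _ _ false)).
    by move=> [[x b] a] /=; instantiate (1 := fun z => p z.1.1 z.2); case: b.
  by apply: (fp_comp (f := fun p => (p.1.1, p.2)) _ hp); apply: fp_pair (fp_fst (fp_fst hid)) (fp_snd hid).
- by move=> *; apply: tsize_bool.
Qed.

Lemma fp_has A (eA : enc_of A) (p : X -> A -> bool) l :
  fp (eP e eA) eB (fun z => p z.1 z.2) -> fp e (eL eA) l -> fp e eB (fun x => has (p x) (l x)).
Proof.
move=> hp hl; apply: (@fp_ext _ _ _ _ (fun x => ~~ all (fun a => ~~ p x a) (l x))).
  by move=> x; rewrite -has_predC; apply: eq_has => a /=; rewrite negbK.
apply: (fp_comp (g := negb)); last first.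
  by apply: fp_ext (fp_if (fp_id eB) (fp_const _ _ false) (fp_const _ _ true)); case.
apply: fp_all hl; apply: (fp_comp hp).
by apply: fp_ext (fp_if (fp_id eB) (fp_const _ _ false) (fp_const _ _ true)); case.
Qed.

End Env2.

Lemma fp_mem X (e : enc_of X) (A : eqType) (eA : enc_of A) (f : X -> A) l : injective eA ->
  fp e eA f -> fp e (eL eA) l -> fp e eB (fun x => f x \in l x).
Proof.
move=> inj hf hl; apply: (@fp_ext _ _ _ _ (fun x => has (fun a => a == f x) (l x))).
  by move=> x; rewrite has_pred1.
apply: fp_has hl; have hid := fp_id (eP e eA).
by apply: fp_eq inj (fp_snd hid) _; apply: fp_comp (fp_fst hid) hf.
Qed.

Lemma fp_flatten X (e : enc_of X) A (eA : enc_of A) (f : X -> seq (seq A)) :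
  fp e (eL (eL eA)) f -> fp e (eL eA) (fun x => flatten (f x)).
Proof.
move=> hf; have E (l : seq (seq A)) s : foldl cat s l = s ++ flatten l.
  by elim: l s => [|a l ih] s /=; rewrite ?cats0 // ih catA.
apply: (@fp_ext _ _ _ _ (fun x => foldl cat [::] (f x))) => [x|]; first by rewrite E.
apply: (fp_foldl_add (q := fun n => n)) hf (fp_const _ _ _) _ _; first by polyn_tac.
- have hid := fp_id (eP (eP e (eL eA)) (eL eA)).
  exact: fp_cat (fp_snd (fp_fst hid)) (fp_snd hid).
- move=> x s a; rewrite /eP /= tsize_Nd; elim: s => [|b s ih] /=; first by lia.
  by rewrite !tsize_Nd; lia.
Qed.

Lemma fp_undup X (e : enc_of X) (A : eqType) (eA : enc_of A) (f : X -> seq A) : injective eA ->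
  fp e (eL eA) f -> fp e (eL eA) (fun x => undup (f x)).
Proof.
move=> inj hf.
have E l : foldl (fun s a => if a \in s then s else a :: s) [::] (rev l) = undup l.
  by elim: l => //= a l ih; rewrite rev_cons foldl_rcons ih mem_undup.
apply: (@fp_ext _ _ _ _ (fun x => foldl (fun s a => if a \in s then s else a :: s) [::] (rev (f x)))) => //.
apply: (fp_foldl_add (q := fun n => n.+1)) (fp_rev hf) (fp_const _ _ _) _ _; first by polyn_tac.
- have hid := fp_id (eP (eP e (eL eA)) eA).
  apply: fp_if (fp_snd (fp_fst hid)) (fp_cons (fp_snd hid) (fp_snd (fp_fst hid))).
  by apply: fp_mem inj (fp_snd hid) (fp_snd (fp_fst hid)).
- by move=> x s a; case: ifP => _; rewrite /eP /= ?tsize_Nd; lia.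
Qed.

(** * Numbers *)

Lemma eB_inj : injective eB. Proof. by case; case. Qed.
Lemma eU_inj : injective eU.
Proof. by elim=> [|m ih] [|n] //= [/ih->]. Qed.
Lemma eL_inj A (eA : enc_of A) : injective eA -> injective (eL eA).
Proof. by move=> inj; elim=> [|a l ih] [|b l'] //= [/inj-> /ih->]. Qed.
Lemma eP_inj A B (eA : enc_of A) (eB' : enc_of B) : injective eA -> injective eB' -> injective (eP eA eB').
Proof. by move=> i1 i2 [a b] [a' b'] [/i1-> /i2->]. Qed.

Definition bval (s : seq bool) : nat := foldr (fun (b : bool) n => b + n.*2) 0 s.

Lemma nbits_fuel f g n : n <= f -> n <= g -> nbits f n = nbits g n.
Proof.
by elim: f g n => [|f ih] [|g] [|n] //= hf hg; congr cons; apply: ih; lia.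
Qed.

Lemma bits_rec n : 0 < n -> bits n = odd n :: bits n./2.
Proof. by case: n => // n _; rewrite /bits /=; congr cons; apply: nbits_fuel => //; lia. Qed.

Lemma bits_ind (P : nat -> Prop) : P 0 -> (forall n, 0 < n -> P n./2 -> P n) -> forall n, P n.
Proof.
move=> h0 hS n; elim: {n}n.+1 {-2}n (ltnSn n) => // m ih [|n] // lt.
by apply: hS => //; apply: ih; lia.
Qed.

Lemma bitsK n : bval (bits n) = n.
Proof.
elim/bits_ind: n => // n n0 ih; rewrite bits_rec //= ih.
exact: odd_double_half.
Qed.

Lemma bits_inj : injective bits. Proof. exact: can_inj bitsK. Qed.
Lemma eN_inj : injective eN.
Proof. by move=> m n /(eL_inj eB_inj)/bits_inj. Qed.

Lemma bits_cons (b : bool) n : bits (b + n.*2) = if ~~ b && (bits n == [::]) then [::] else b :: bits n.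
Proof.
have -> : (bits n == [::]) = (n == 0) by case: n => [|n] //; rewrite bits_rec.
have [z|n0] := posnP (b + n.*2); first by case: b n z => [] [].
rewrite bits_rec // half_bit_double oddD odd_double addbF oddb.
by case: b n n0 => [] [].
Qed.

Lemma size_bits n : size (bits n) <= n.
Proof. by elim/bits_ind: n => // n n0 ih; rewrite bits_rec //=; lia. Qed.

(** One step of binary increment, from the least significant bit: the carry comes first, then the
    bits produced so far in reverse. *)
Definition bcarry (p : bool * seq bool) (b : bool) := if p.1 then (b, ~~ b :: p.2) else (false, b :: p.2).
Definition binc (s : seq bool) :=
  let p := foldl bcarry (true, [::]) s in rev (if p.1 then true :: p.2 else p.2).

Lemma binc_bits n : binc (bits n) = bits n.+1.
Proof.
rewrite /binc; have noc s acc : foldl bcarry (false, acc) s = (false, catrev s acc).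
  by elim: s acc => //= b s ih acc; rewrite ih.
suff H acc : (let p := foldl bcarry (true, acc) (bits n) in rev (if p.1 then true :: p.2 else p.2))
   = rev acc ++ bits n.+1 by exact: (H [::]).
elim/bits_ind: n acc => [|n n0 ih] acc; first by rewrite /= rev_cons cats1.
rewrite bits_rec // -[foldl _ _ _]/(foldl bcarry (odd n, ~~ odd n :: acc) (bits n./2)).
case o: (odd n).
  have -> : n.+1 = n./2.+1.*2 by rewrite -[in LHS](odd_double_half n) o; lia.
  by rewrite ih [bits _.*2]bits_rec // odd_double doubleK rev_cons cat_rcons.
rewrite noc /= catrevE rev_cat revK rev_cons cat_rcons [bits n.+1]bits_rec //= o /=.
by rewrite uphalf_half o.
Qed.

Section Succ.
Variables (X : Type) (e : enc_of X).

Lemma fp_succ (f : X -> nat) : fp e eU f -> fp e eU (fun x => (f x).+1).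
Proof.
move=> h; apply: (fp_comp h); apply: (fp_via (g := Nd Lf)) => //.
by apply: fp_comp (fp_pair (fp_const eT eT Lf) (fp_id eT)) (fp_repr (f := fun p => Nd p.1 p.2) _).
Qed.

End Succ.

Section Iter.
Variables (X : Type) (e : enc_of X).

Lemma eU_nseq n : eU n = eL eT (nseq n Lf).
Proof. by elim: n => //= n ->. Qed.

Lemma fp_nseq (f : X -> nat) : fp e eU f -> fp e (eL eT) (fun x => nseq (f x) Lf).
Proof. by move=> h; apply: (fp_comp h (g := fun n => nseq n Lf)); apply: fp_repr => n; rewrite eU_nseq. Qed.

Lemma tsize_eU n : tsize (eU n) = n.*2.+1.
Proof. by elim: n => //= n ih; rewrite tsize_Nd ih add1n doubleS. Qed.

Lemma foldl_nseq B (g : B -> B) n s : foldl (fun s (_ : tree) => g s) s (nseq n Lf) = iter n g s.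
Proof. by elim: n s => //= n ih s; rewrite ih -iterSr. Qed.

Lemma fp_iter B (eS : enc_of B) (g : X -> B -> B) n s0 (q : nat -> nat) : polyn q ->
  fp e eU n -> fp e eS s0 -> fp (eP e eS) eS (fun p => g p.1 p.2) ->
  (forall x m, m <= n x -> tsize (eS (iter m (g x) (s0 x))) <= q (tsize (e x))) ->
  fp e eS (fun x => iter (n x) (g x) (s0 x)).
Proof.
move=> hq hn h0 hg bound.
apply: (@fp_ext _ _ _ _ (fun x => foldl (fun s (_ : tree) => g x s) (s0 x) (nseq (n x) Lf))) => [x|].
  by rewrite foldl_nseq.
apply: (fp_foldl hq (fp_nseq hn) h0) => [|x l1 l2 h].
  by apply: (fp_comp (f := fun p => p.1) _ hg); apply: fp_fst (fp_id _).
have le : size l1 <= n x.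
  by have := congr1 size h; rewrite size_nseq size_cat => ->; apply: leq_addr.
have -> : l1 = nseq (size l1) Lf.
  by have := congr1 (take (size l1)) h; rewrite take_size_cat // take_nseq.
by rewrite foldl_nseq; apply: bound.
Qed.

Lemma fp_iter_add B (eS : enc_of B) (g : X -> B -> B) n s0 (q : nat -> nat) : polyn q ->
  fp e eU n -> fp e eS s0 -> fp (eP e eS) eS (fun p => g p.1 p.2) ->
  (forall x s, tsize (eS (g x s)) <= tsize (eS s) + q (tsize (e x))) ->
  fp e eS (fun x => iter (n x) (g x) (s0 x)).
Proof.
move=> hq hn h0 hg bound.
apply: (@fp_ext _ _ _ _ (fun x => foldl (fun s (_ : tree) => g x s) (s0 x) (nseq (n x) Lf))) => [x|].
  by rewrite foldl_nseq.
have [r [hr ler mono]] := polyn_mono hq.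
apply: (fp_foldl_add hr (fp_nseq hn) h0) => [|x s a].
  by apply: (fp_comp (f := fun p => p.1) _ hg); apply: fp_fst (fp_id _).
apply: leq_trans (bound _ _) _; rewrite leq_add2l; apply: leq_trans (ler _) (mono _ _ _).
by rewrite /eP /= tsize_Nd; lia.
Qed.

Lemma tsize_eLU_le b s : (forall k, k \in s -> k <= b) -> tsize (eL eU s) <= (size s * (2 * b + 3)).+1.
Proof.
elim: s => //= k s ih h; rewrite tsize_Nd tsize_eU mulSn.
have := h k (mem_head _ _); have := ih (fun i hi => h i (mem_behead (s := k :: s) hi)); lia.
Qed.

End Iter.

Section Unary.
Variables (X : Type) (e : enc_of X).

Lemma fp_addn (f g : X -> nat) : fp e eU f -> fp e eU g -> fp e eU (fun x => f x + g x).
Proof.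
move=> hf hg; apply: (@fp_ext _ _ _ _ (fun x => iter (f x) succn (g x))) => [x|]; first by rewrite iter_succn addnC.
apply: (fp_iter_add (q := fun n => 2)) hf hg _ _; first by polyn_tac.
  exact: fp_succ (fp_snd (fp_id _)).
by move=> x s; rewrite !tsize_eU; lia.
Qed.
End Unary.

Section Unary2.
Variables (X : Type) (e : enc_of X).

Lemma fp_muln (f g : X -> nat) : fp e eU f -> fp e eU g -> fp e eU (fun x => f x * g x).
Proof.
move=> hf hg; apply: (@fp_ext _ _ _ _ (fun x => iter (f x) (fun s => g x + s) 0)) => [x|].
  by rewrite iter_addn_0 mulnC.
have [q [hq le _]] := fp_size hg.
apply: (fp_iter_add hq) hf (fp_const _ _ _) _ _.
  have hid := fp_id (eP e eU).
  by apply: fp_addn (fp_comp (fp_fst hid) hg) (fp_snd hid).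
by move=> x s; have := le x; rewrite !tsize_eU; lia.
Qed.

Lemma fp_expn (f : X -> nat) k : fp e eU f -> fp e eU (fun x => f x ^ k).
Proof.
move=> h; elim: k => [|k ih]; first exact: fp_const.
by apply: fp_ext (fp_muln h ih) => x; rewrite expnS.
Qed.

Lemma fp_poly_bound c (f : X -> nat) : fp e eU f -> fp e eU (fun x => poly_bound c (f x)).
Proof.
by move=> h; apply: fp_addn (fp_const _ _ _); apply: fp_muln (fp_const _ _ _) (fp_expn _ h).
Qed.

Lemma fp_sizeU A (eA : enc_of A) (f : X -> seq A) : fp e (eL eA) f -> fp e eU (fun x => size (f x)).
Proof.
move=> h; apply: (@fp_ext _ _ _ _ (fun x => foldl (fun n _ => n.+1) 0 (f x))) => [x|].
  by rewrite -[RHS]addn0; elim: (f x) 0 => //= a l ih n; rewrite ih addnS.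
apply: (fp_foldl_add (q := fun n => 2)) h (fp_const _ _ _) _ _; first by polyn_tac.
  exact: fp_succ (fp_snd (fp_fst (fp_id _))).
by move=> x s a; rewrite !tsize_eU; lia.
Qed.

Lemma fp_iota (f : X -> nat) : fp e eU f -> fp e (eL eU) (fun x => iota 0 (f x)).
Proof.
move=> h; pose g (p : nat * seq nat) := (p.1.+1, p.1 :: p.2).
have E n : iter n g (0, [::]) = (n, rev (iota 0 n)).
  elim: n => // n; rewrite iterS => ->.
  have -> : iota 0 n.+1 = rcons (iota 0 n) n by rewrite -cats1 -addn1 iotaD.
  by rewrite rev_rcons.
apply: (@fp_ext _ _ _ _ (fun x => rev (iter (f x) g (0, [::])).2)) => [x|]; first by rewrite E revK.
apply: fp_rev; apply: fp_snd.
have [q [hq le _]] := fp_size h.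
apply: (fp_iter (g := fun _ => g) (q := fun n => (2 * q n).+2 + (q n * (2 * q n + 3)).+1)) h (fp_const _ _ _) _ _.
- by polyn_tac.
- have hid := fp_id (eP e (eP eU (eL eU))); apply: fp_pair.
    by apply: fp_succ; apply: fp_fst (fp_snd hid).
  by apply: fp_cons; [apply: fp_fst (fp_snd hid)|apply: fp_snd (fp_snd hid)].
move=> x m lem; rewrite E /eP /= tsize_Nd tsize_eU.
have := le x; rewrite tsize_eU => leq; rewrite -addSn leq_add //; first by lia.
apply: leq_trans (tsize_eLU_le (b := m) _) _; first by move=> k; rewrite mem_rev mem_iota; lia.
by rewrite size_rev size_iota ltnS leq_mul //; lia.
Qed.

Lemma fp_oddU (f : X -> nat) : fp e eU f -> fp e eB (fun x => odd (f x)).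
Proof.
move=> h; apply: (@fp_ext _ _ _ _ (fun x => iter (f x) negb false)) => [x|].
  by elim: (f x) => //= n ->.
apply: (fp_iter (g := fun _ => negb) (q := fun _ => 3)) h (fp_const _ _ _) _ _; first by polyn_tac.
  by apply: fp_negb; apply: fp_snd (fp_id _).
by move=> x m _; apply: tsize_bool.
Qed.

Lemma fp_binc (f : X -> seq bool) : fp e (eL eB) f -> fp e (eL eB) (fun x => binc (f x)).
Proof.
move=> h; rewrite /binc.
have h1 : fp e (eP eB (eL eB)) (fun x => foldl bcarry (true, [::]) (f x)).
  apply: (fp_foldl_add (f := fun _ => bcarry) (q := fun n => 10)) h (fp_const _ _ _) _ _; first by polyn_tac.
    have hid := fp_id (eP (eP e (eP eB (eL eB))) eB).
    apply: fp_if; first exact: fp_fst (fp_snd (fp_fst hid)).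
      apply: fp_pair (fp_snd hid) (fp_cons (fp_negb (fp_snd hid)) _).
      exact: fp_snd (fp_snd (fp_fst hid)).
    apply: fp_pair (fp_const _ _ _) (fp_cons (fp_snd hid) _).
    exact: fp_snd (fp_snd (fp_fst hid)).
  move=> x [c s] b; rewrite /bcarry /eP /=; case: c; rewrite /= !tsize_Nd.
    by have := tsize_bool b; have := tsize_bool (~~ b); have := tsize_gt0 (eB true); lia.
  by have := tsize_bool b; have := tsize_bool false; have := tsize_gt0 (eB false); lia.
apply: fp_rev; apply: fp_if (fp_fst h1) (fp_cons (fp_const _ _ _) (fp_snd h1)) (fp_snd h1).
Qed.
End Unary2.

Lemma tsize_eLB s : tsize (eL eB s) <= (4 * size s).+1.
Proof. by elim: s => //= b s ih; rewrite tsize_Nd; have := tsize_bool b; lia. Qed.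

(** Unary to binary by counting: [binc] is iterated from the empty word, and every intermediate
    result is short. *)
Lemma fp_bits X (e : enc_of X) (f : X -> nat) : fp e eU f -> fp e eN f.
Proof.
move=> h; suff h1 : fp e (eL eB) (fun x => bits (f x)).
  move=> S; have [c [p hp hc]] := h1 S; exists c, p => //.
apply: (@fp_ext _ _ _ _ (fun x => iter (f x) binc [::])) => [x|].
  by elim: (f x) => //= n ->; rewrite binc_bits.
have [q [hq le _]] := fp_size h.
apply: (fp_iter (g := fun _ => binc) (q := fun n => (4 * q n).+1)) h (fp_const _ _ _) _ _; first by polyn_tac.
  exact: fp_binc (fp_snd (fp_id _)).
move=> x m lem; have -> : iter m binc [::] = bits m by elim: (m) => //= n ->; rewrite binc_bits.
apply: leq_trans (tsize_eLB _) _; have := size_bits m; have := le x; rewrite tsize_eU; lia.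
Qed.

Section Finite.
Variable F : finType.
Definition eF : enc_of F := fun a => eU (enum_rank a).

Lemma eF_inj : injective eF.
Proof. by move=> a b /eU_inj/val_inj/enum_rank_inj. Qed.

Definition eF_bound := 2 * #|F|.+1.

Lemma tsize_eF a : tsize (eF a) <= eF_bound.
Proof.
rewrite /eF_bound tsize_eU; case: (enum_rank a) => i /= lt; have {}lt : i < #|F| := lt.
by move: lt; move: #|F| => n; lia.
Qed.

(** A finite case distinction along [enum F]; the value at [a0] ends the cascade but is never
    reached. *)
Lemma fp_fin B (eB' : enc_of B) (g : F -> B) : fp eF eB' g.
Proof.
case: (pickP F) => [a0 _|no]; last first.
  by move=> S; exists (Skip S), (fun _ => 0) => [|a]; [exact: polyn_const|have := no a].
have h (s : seq F) : fp eF eB' (fun x => foldr (fun a u => if x == a then g a else u) (g a0) s).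
  elim: s => [|a s ih] /=; first exact: fp_const.
  apply: fp_if _ (fp_const _ _ _) ih.
  exact: fp_eq eF_inj (fp_id _) (fp_const _ _ _).
apply: fp_ext (h (enum F)) => x /=.
have : x \in enum F by rewrite mem_enum.
by elim: (enum F) => //= a s ih; rewrite inE; case: eqP => [->|_ /ih].
Qed.
End Finite.

(** * Reading inputs and writing outputs on Turing machines *)

Section ReadInput.
Variables (F S : finType) (inS : F -> S) (dec : S -> tree).
Hypothesis decE : forall a, dec (inS a) = eF a.

(** The last input letter is on top of [IO], so consing letter after letter builds the list in the
    right order. *)
Definition readbody : cmd S := Case IO (fun o => Seq (Pop S IO)
  (if o is Some (inr s) then push_word (bsym S true :: word S (dec s)) else Skip S)).
Definition readin : cmd S := Seq (Push MS (bsym S false)) (While IO isSome readbody).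

Let z (x : seq F) : seq (sym2 S) := rev (map (fun a => inr (inS a)) x).

Lemma exec_readloop x y :
  exec (While IO isSome readbody) (z x, word S (eL (@eF F) y), [::], [::], [::], [::])
   (main_store (word S (eL (@eF F) (x ++ y)))) (size x * (eF_bound F + 6) + 1).
Proof.
elim/last_ind: x y => [|x a ih] y; first exact: exec_while0.
have h : exec readbody (z (rcons x a), word S (eL (@eF F) y), [::], [::], [::], [::])
    (z x, word S (eL (@eF F) (a :: y)), [::], [::], [::], [::]) (eF_bound F + 5).
  rewrite /z map_rcons rev_rcons; apply: exec_case_le => /=.
    apply: exec_seq; first exact: exec_pop.
    rewrite decE; apply: exec_eq; first exact: (exec_push_words (bsym S true :: word S (eF a))).
    by rewrite word_Nd.
  by have := tsize_eF a; rewrite /= size_word; lia.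
rewrite cat_rcons size_rcons mulSn.
apply: exec_le (exec_while1 _ h (ih _)) _; first by rewrite /= /z map_rcons rev_rcons.
by lia.
Qed.

Lemma exec_readin x : exec readin (io_store (z x)) (main_store (word S (eL (@eF F) x))) (size x * (eF_bound F + 6) + 2).
Proof.
have := exec_readloop x [::]; rewrite cats0 => h.
by apply: exec_le; [apply: exec_seq; [exact: exec_push | exact: h] | lia].
Qed.

Lemma tsize_eLF x : tsize (eL (@eF F) x) <= size x * (eF_bound F + 1) + 1.
Proof.
elim: x => //= a x ih; rewrite tsize_Nd mulSn; move: (size x * _) ih => K ih.
by have := tsize_eF a; lia.
Qed.
End ReadInput.

Definition tm_time (F : finType) r n := n * (eF_bound F + 6) + 2 + (r (n * (eF_bound F + 1) + 1) + 10).

Lemma tm_time_bound F r : polyn r -> exists k, forall n,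
  tm_time F r n * (2 * (n + tm_time F r n) + 3) + 2 <= poly_bound k n.
Proof.
move=> hr; have ht : polyn (tm_time F r).
  by apply: polyn_add; [polyn_tac | apply: polyn_add (polyn_const _); apply: polyn_comp hr _; polyn_tac].
by apply: polynP; polyn_tac.
Qed.

Definition answer (S : finType) : cmd S :=
  Seq (Case MS (fun o => if o is Some (inl true) then Push IO (bsym S true) else Skip S)) (clear S MS).

Theorem fp_in_P (F : finType) (f : seq F -> bool) : fp (eL (@eF F)) eB f -> in_P (fun x => f x).
Proof.
move=> /(_ F)[c [p hp hc]].
pose c' := Seq (readin (@eF F)) (Seq c (answer F)).
exists (stack_TM (@id F) c').
have [r [hr ler mono]] := polyn_mono hp.
set t := tm_time F r; have [k hk] := tm_time_bound F hr.
exists k => x.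
have h : exec c' (io_store (rev (map (fun a => inr (id a)) x))) (io_store (if f x then [:: bsym F true] else [::])) (t (size x)).
  apply: exec_seq; first by apply: exec_readin.
  have := hc x [::]; rewrite !cats0 => h.
  apply: exec_le; first (apply: exec_seq; first exact: h).
    apply: (@exec_seq _ _ _ _ ((if f x then [:: bsym F true] else [::]), word F (eB (f x)), [::], [::], [::], [::]) _ 2); first by apply: exec_case; case: (f x); [exact: exec_push | exact: exec_skip].
    by apply: (@exec_le _ _ _ _ _ 7); [exact: exec_clear | case: (f x)].
  have : p (tsize (eL (@eF F) x)) <= r (size x * (eF_bound F + 1) + 1).
    by apply: leq_trans (ler _) (mono _ _ (tsize_eLF x)).
  by case: (f x) => /=; lia.
have [m [b [hm hb hrun]]] := stack_TM_spec h.
exists m, b; split; first by apply: leq_trans hm (hk _).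
case: (run _ _ _) hrun => [[q l] r'] [e _ _]; split=> //.
by rewrite hb; case: (f x).
Qed.

Definition eSym : enc_of sym := fun s => if s is Some b then Nd Lf (eB b) else Lf.

Section WriteOutput.
Variables (F : finType).
Let S := (F + sym)%type.
Let out (s : sym) : sym2 S := inr (inr s).

Definition isone (o : option (sym2 S)) := o == Some (inl true).
Definition writesym : cmd S :=
  Case MS (fun o => if isone o then Seq (Pop S MS) (Seq (Pop S MS)
    (Case MS (fun o => if isone o then
      Seq (Pop S MS) (Seq (Pop S MS) (Seq (Pop S MS) (Push IO (out (Some true)))))
      else Seq (Pop S MS) (Push IO (out (Some false))))))
    else Seq (Pop S MS) (Push IO (out None))).
Definition writeout : cmd S :=
  Seq (While MS isone (Seq (Pop S MS) writesym)) (Pop S MS).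

Lemma exec_writesym s io m : exec writesym (io, word S (eSym s) ++ m, [::], [::], [::], [::])
  (out s :: io, m, [::], [::], [::], [::]) 8.
Proof.
apply: (@exec_case_le _ _ _ _ _ 7) => //.
case: s => [b|] /=; last by apply: exec_le; [apply: exec_seq; [exact: exec_pop|exact: exec_push]|].
apply: (@exec_le _ _ _ _ (1 + (1 + 5))) => //.
apply: exec_seq; [exact: exec_pop | apply: exec_seq; [exact: exec_pop | ]].
apply: (@exec_case_le _ _ _ _ _ 4) => //; case: b => /=; last first.
  by apply: exec_le; [apply: exec_seq; [exact: exec_pop|exact: exec_push]|].
apply: (@exec_le _ _ _ _ (1 + (1 + (1 + 1)))) => //.
apply: exec_seq; [exact: exec_pop | apply: exec_seq; [exact: exec_pop | ]].
by apply: exec_seq; [exact: exec_pop|exact: exec_push].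
Qed.

Lemma exec_writeout l io : exec writeout (io, word S (eL eSym l), [::], [::], [::], [::])
  (io_store (rev (map out l) ++ io)) (10 * size l + 2).
Proof.
suff h : exec (While MS isone (Seq (Pop S MS) writesym)) (io, word S (eL eSym l), [::], [::], [::], [::])
   (rev (map out l) ++ io, [:: bsym S false], [::], [::], [::], [::]) (10 * size l + 1).
  by apply: exec_le (exec_seq h (exec_pop _ _)) _; lia.
elim: l io => [|s l ih] io; first exact: exec_while0.
have h : exec (Seq (Pop S MS) writesym) (io, word S (eL eSym (s :: l)), [::], [::], [::], [::])
  (out s :: io, word S (eL eSym l), [::], [::], [::], [::]) 9.
  rewrite [eL _ _]/= word_Nd; apply: (@exec_seq _ _ _ _ _ _ 1); first exact: exec_pop.
  exact: exec_writesym.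
rewrite [map _ _]/= rev_cons -cats1 -catA.
by apply: exec_le (exec_while1 _ h (ih _)) _ => //=; lia.
Qed.

End WriteOutput.

Theorem fp_computable (F : finType) (f : seq F -> seq sym) :
  fp (eL (@eF F)) (eL eSym) f -> poly_computable f.
Proof.
(* Output symbols get letters of their own, so the output map is injective and avoids the blank; the
   value of [dec] on them is arbitrary, since they never occur in the input. *)
pose S := (F + sym)%type.
pose dec (s : S) := if s is inl a then eF a else Lf.
move=> hf; have [q [hq leq _]] := fp_size hf; have [c [p hp hc]] := hf S.
pose c' := Seq (readin dec) (Seq c (writeout F)).
have [r [hr ler mono]] := polyn_mono (polyn_add hp (polyn_mul (polyn_const 10) hq)).
set t := tm_time F r; have [k hk] := tm_time_bound F hr.
exists (stack_TM (@inl F sym) c'), (fun s => ioc (inr (inr s))), k.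
split; [by move=> s s' [] | split; [by [] | move=> x]].
have h : exec c' (io_store (rev (map (fun a => inr (inl a)) x)))
    (io_store (rev (map (fun s => inr (inr s)) (f x)))) (t (size x)).
  apply: exec_seq; first by apply: exec_readin.
  have := hc x [::]; rewrite !cats0 => h.
  apply: exec_le; first (apply: exec_seq; first exact: h).
    by have := @exec_writeout F (f x) [::]; rewrite cats0 => h2; exact: h2.
  have : p (tsize (eL (@eF F) x)) + 10 * q (tsize (eL (@eF F) x)) <= r (size x * (eF_bound F + 1) + 1).
    by apply: leq_trans (ler _) (mono _ _ (tsize_eLF x)).
  by have := leq x; have := size_le_eL eSym (f x); lia.
have [m [b [hm hb hrun]]] := stack_TM_spec h.
exists m; split; first by apply: leq_trans hm (hk _).
case: (run _ _ _) hrun => [[q' l] r'] [e -> ->]; rewrite revK -map_comp; split=> //.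
by rewrite e.
Qed.

(** * Rankings of games won by Eve *)

Definition limsup_is (s : nat -> nat) m :=
  (forall N, exists2 n, N <= n & s n = m) /\ exists N, forall n, N <= n -> s n <= m.

Lemma limsup_shift s m k : limsup_is (fun n => s (k + n)) m -> limsup_is s m.
Proof.
move=> [h1 [N h2]]; split.
  by move=> N'; have [n le e] := h1 N'; exists (k + n) => //; rewrite (leq_trans le) ?leq_addl.
exists (k + N) => n le; rewrite -(subnKC (leq_trans (leq_addr _ _) le)).
by apply: h2; rewrite leq_subRL // (leq_trans _ le) // leq_addr.
Qed.

Section Game.
Variables (T : finType) (C Ed : Type) (pb pa : Ed -> nat) (tg : Ed -> T) (c0 : C).

(** [mv x c] lets Adam play c at x and [opt x c e] lets Eve answer by the edge e, which fixes the
    priorities of the round and the next position. Both are relations because the induction keeps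
    restricting the moves of one player or the other. *)
Definition arena_mv := T -> C -> Prop.
Definition arena_opt := T -> C -> Ed -> Prop.

Implicit Types (mv : arena_mv) (opt : arena_opt) (x : T) (sigma : seq C -> Ed) (h : seq C) (G : {set T}).

(** A strategy returns the edge of the latest round, so the current position is the target of that
    edge and no recursion along the history is needed. *)
Definition posh x sigma h := if h is _ :: _ then tg (sigma h) else x.

Definition legalh mv x sigma h :=
  forall n, n < size h -> mv (posh x sigma (take n h)) (nth c0 h n).

Definition bad (e : nat -> Ed) := exists b a,
  [/\ ~~ odd b, odd a, limsup_is (pb \o e) b & limsup_is (pa \o e) a].

Definition winning mv opt x sigma :=
  (forall h c, legalh mv x sigma h -> mv (posh x sigma h) c ->
     opt (posh x sigma h) c (sigma (rcons h c))) /\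
  (forall rho, (forall n, legalh mv x sigma (mkseq rho n)) ->
     ~ bad (fun n => sigma (mkseq rho n.+1))).

Definition Win mv opt x := exists sigma, winning mv opt x sigma.

Lemma legalh_nil mv x sigma : legalh mv x sigma [::]. Proof. by []. Qed.

Lemma posh_res x sigma h1 h :
  posh (posh x sigma h1) (fun h => sigma (h1 ++ h)) h = posh x sigma (h1 ++ h).
Proof. by case: h => [|c h] /=; rewrite ?cats0 //; case: h1. Qed.

Lemma legalh_cat mv x sigma h1 h2 : legalh mv x sigma (h1 ++ h2) <->
  legalh mv x sigma h1 /\ legalh mv (posh x sigma h1) (fun h => sigma (h1 ++ h)) h2.
Proof.
split=> [H|[H1 H2] n].
  split=> n lt.
    have := H n; rewrite size_cat nth_cat takel_cat ?(ltnW lt) // lt; apply.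
    exact: ltn_addr.
  rewrite posh_res; have := H (size h1 + n); rewrite size_cat ltn_add2l => /(_ lt).
  by rewrite take_cat nth_cat ltnNge leq_addr /= addKn.
rewrite size_cat => lt; case: (ltnP n (size h1)) => lt1.
  by rewrite nth_cat takel_cat ?(ltnW lt1) // lt1; apply: H1.
have := H2 (n - size h1); rewrite posh_res take_cat nth_cat [n < size h1]ltnNge lt1 /=; apply.
by rewrite ltn_subLR.
Qed.

Lemma legalh_rcons mv x sigma h c :
  legalh mv x sigma (rcons h c) <-> legalh mv x sigma h /\ mv (posh x sigma h) c.
Proof.
rewrite -cats1 legalh_cat; split=> -[h1 h2]; split=> //.
  exact: (h2 0).
by move=> [|n].
Qed.

(** Finite prefixes do not affect [bad]: a play of the residual strategy, prolonged to the left by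
    [h0], is a play of [sigma] with the same largest recurring priorities. *)
Lemma winning_res mv opt x sigma h0 : winning mv opt x sigma -> legalh mv x sigma h0 ->
  winning mv opt (posh x sigma h0) (fun h => sigma (h0 ++ h)).
Proof.
move=> [w1 w2] l0; split=> [h c l|rho l].
  rewrite posh_res -rcons_cat => m; apply: w1 => //.
  by apply/legalh_cat.
pose rho' n := if n < size h0 then nth c0 h0 n else rho (n - size h0).
have E n : mkseq rho' (size h0 + n) = h0 ++ mkseq rho n.
  apply: (@eq_from_nth _ c0); first by rewrite size_cat !size_mkseq.
  move=> i; rewrite size_mkseq => lt; rewrite nth_mkseq // nth_cat /rho'.
  by case: ltnP => // le; rewrite nth_mkseq // ltn_subLR.
move=> [b [a [eb oa lb la]]]; apply: (w2 rho') => [n|].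
  case: (leqP (size h0) n) => le; first by rewrite -(subnKC le) E; apply/legalh_cat.
  have := E 0; rewrite addn0 cats0 => E0.
  have := l0; rewrite -E0 -{1}(subnKC (ltnW le)) /mkseq iotaD map_cat.
  by case/legalh_cat.
exists b, a; split=> //.
  by apply: (@limsup_shift _ _ (size h0)) => /=; under eq_fun do rewrite /= -addnS E.
by apply: (@limsup_shift _ _ (size h0)) => /=; under eq_fun do rewrite /= -addnS E.
Qed.

Lemma winning_mono mv mv' opt x sigma : (forall y c, mv' y c -> mv y c) ->
  winning mv opt x sigma -> winning mv' opt x sigma.
Proof.
move=> sub [w1 w2]; have L h : legalh mv' x sigma h -> legalh mv x sigma h.
  by move=> l n lt; apply: sub; apply: l.
split=> [h c l m|rho l]; first by apply: w1; [apply: L|apply: sub].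
by apply: w2 => n; apply: L.
Qed.

(** A winning strategy never leaves the winning region, because its residuals win. Restricting Eve
    to edges into that region makes the region closed, as the induction requires. *)
Lemma Win_restrict mv opt x : Win mv opt x ->
  Win mv (fun y c e => opt y c e /\ Win mv opt (tg e)) x.
Proof.
move=> [sigma w]; exists sigma; split; last exact: w.2.
move=> h c l m; split; first exact: w.1.
have l' : legalh mv x sigma (rcons h c) by apply/legalh_rcons.
by have := winning_res w l'; rewrite /posh; case: h {l m l'} => [|d h] /= w'; eexists; exact: w'.
Qed.

(* The edge [e] of a play at [x] respects the rank [r b a]: an infinite play along such edges stays in
   one level, so it cannot have both [b] and [a] as its largest recurring priorities. *)
Definition okr (r : nat -> nat -> T -> nat) x e b a :=
  pb e <= b -> pa e <= a -> r b a (tg e) <= r b a x /\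
  (r b a (tg e) = r b a x -> if odd (r b a x) then pa e <> a else pb e <> b).

Definition rankable G mv opt := exists r, forall x c, x \in G -> mv x c ->
  exists2 e, opt x c e & forall b a, ~~ odd b -> odd a -> okr r x e b a.

Definition closed_ar G mv opt := forall x c e, x \in G -> mv x c -> opt x c e -> tg e \in G.

(** * Removing an attractor of Eve from the arena *)

Section Attractor.
Variables (G W : {set T}) (mv : arena_mv) (opt : arena_opt) (fav : Ed -> Prop).
Hypotheses (closed_G : closed_ar G mv opt) (subW : W \subset G).

(** Stage i of Eve's attractor: positions of [W], or of [G] from which she can force within i rounds
    an edge of [fav] or a visit to [W]. *)
Fixpoint attr i : {set T} := if i is j.+1 then
  attr j :|: [set x in G | `[< forall c, mv x c -> exists2 e, opt x c e & fav e \/ tg e \in attr j >]]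
  else W.

Lemma attr_sub i j : i <= j -> attr i \subset attr j.
Proof.
move=> le; rewrite -(subnKC le); elim: (j - i) => [|k ih]; first by rewrite addn0.
by rewrite addnS /= (subset_trans ih) // subsetUl.
Qed.

Definition attrT := attr #|T|.

(** The stages increase, and a stage equal to the next one is final. If none of the stages up to
    [#|T|] were final, each would add a position, giving more than [#|T|] of them. *)
Lemma attr_stable i : attr i \subset attrT.
Proof.
suff [N leN eN] : exists2 N, N <= #|T| & attr N.+1 = attr N.
  have st j : attr (N + j) = attr N.
    by elim: j => [|j ih]; rewrite ?addn0 // addnS /= ih.
  have -> : attrT = attr N by rewrite /attrT -(subnKC leN) st.
  by case: (leqP i N) => [/attr_sub//|/ltnW le]; rewrite -(subnKC le) st.
apply: contrapT => H.
have : forall k, k <= #|T|.+1 -> k <= #|attr k|.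
  elim=> // k ih lt; apply: leq_ltn_trans (ih (ltnW lt)) _; apply: proper_card.
  rewrite properEneq attr_sub // andbT; apply/eqP => e; apply: H.
  by exists k.
by move=> /(_ _ (leqnn _)); rewrite leqNgt ltnS max_card.
Qed.

Definition lev x := find (fun i => x \in attr i) (iota 0 #|T|.+1).

Lemma lev_attr x : x \in attrT -> x \in attr (lev x).
Proof.
move=> xA; have hx : has (fun i => x \in attr i) (iota 0 #|T|.+1).
  by apply/hasP; exists #|T|; rewrite ?mem_iota /= ?add0n ?leqnn.
have lt : lev x < #|T|.+1 by rewrite -[X in _ < X](size_iota 0) -has_find.
by have := nth_find 0 hx; rewrite nth_iota.
Qed.

Lemma lev_le x i : x \in attr i -> lev x <= i.
Proof.
move=> xi; case: (leqP i #|T|) => le.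
  rewrite leqNgt; apply/negP => lt; have := before_find 0 lt.
  by rewrite nth_iota ?ltnS // xi.
apply: leq_trans (ltnW le); rewrite -ltnS -[X in _ < X](size_iota 0) -has_find.
by apply/hasP; exists #|T|; rewrite ?mem_iota /= ?add0n ?leqnn //; apply: (subsetP (attr_stable i)).
Qed.

(* The moves of Adam that leave Eve no way to reach the attractor. *)
Definition mv_out x c := mv x c /\ forall e, opt x c e -> ~ fav e /\ tg e \notin attrT.

(** For each pair, either the edges of [fav] exceed its thresholds and are exempt from [okr], or one
    of the two priorities never occurs in the arena and the constant rank k, of the matching parity,
    is enough. *)
Hypothesis pairs : forall b a, ~~ odd b -> odd a ->
  (forall e, fav e -> ~ (pb e <= b /\ pa e <= a)) \/
  (exists k : bool, forall x c e, x \in G -> mv x c -> opt x c e ->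
     if k then pa e <> a else pb e <> b).

Lemma rankable_attr (rW : nat -> nat -> T -> nat) :
  (forall x c, x \in W -> mv x c -> exists2 e, opt x c e & tg e \in W /\
     forall b a, ~~ odd b -> odd a -> okr rW x e b a) ->
  rankable (G :\: attrT) mv_out opt -> rankable G mv opt.
Proof.
move=> hW [r' hr'].
(* [Q] singles out answers that suit all pairs at once, since [rankable] asks for the edge before
   the pair: follow [rW] inside [W], approach the target or take a favourable edge inside the
   attractor, and elsewhere do one of these or follow [r']. *)
pose Q x e := [/\ x \in W -> tg e \in W /\ forall b a, ~~ odd b -> odd a -> okr rW x e b a,
  x \in attrT :\: W -> fav e \/ (tg e \in attrT /\ lev (tg e) < lev x) &
  x \in G :\: attrT -> [\/ fav e, tg e \in attrT | tg e \in G :\: attrT /\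
    forall b a, ~~ odd b -> odd a -> okr r' x e b a]].
have hQ x c : x \in G -> mv x c -> exists2 e, opt x c e & Q x e.
  move=> xG m; have W0 : W \subset attrT by exact: attr_sub 0 _ _.
  case xW: (x \in W).
    have [e oe he] := hW _ _ xW m; exists e => //; split=> //; rewrite !inE ?xW //.
    by rewrite (subsetP W0).
  case xA: (x \in attrT).
    have := lev_attr xA; case L: (lev x) => [|i] /=; first by rewrite xW.
    rewrite inE => /orP[/lev_le|]; first by rewrite L ltnn.
    rewrite inE xG => /asboolP /(_ _ m)[e oe fe]; exists e => //; split; rewrite ?inE ?xW ?xA //.
    move=> _; case: fe => [|ti]; [by left | right]; split; last by rewrite L ltnS lev_le.
    exact: (subsetP (attr_stable i)).
  have xG' : x \in G :\: attrT by rewrite inE xA.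
  have [mo|nmo] := pselect (mv_out x c).
    have [e oe he] := hr' _ _ xG' mo; exists e => //; split; rewrite ?inE ?xW ?xA //= => _.
    by apply: Or33; split=> //; rewrite ?inE (closed_G xG m oe) andbT; case: (mo.2 e oe).
  apply: contrapT => H; apply: nmo; split=> // e oe; split.
    by move=> fe; apply: H; exists e => //; split; rewrite ?inE ?xW ?xA //= => _; apply: Or31.
  by apply/negP => te; apply: H; exists e => //; split; rewrite ?inE ?xW ?xA //= => _; apply: Or32.
have hr (p : nat * nat) : exists r : T -> nat, ~~ odd p.1 -> odd p.2 ->
    forall x c e, x \in G -> mv x c -> opt x c e -> Q x e -> okr (fun _ _ => r) x e p.1 p.2.
  case: p => b a /=; case eb: (odd b); first by exists (fun _ => 0).
  case oa: (odd a); last by exists (fun _ => 0).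
  case: (pairs (negbT eb) oa) => [ex|[k hk]]; last first.
    exists (fun _ => nat_of_bool k) => _ _ x c e xG m oe _ _ _; split=> // _.
    by have := hk _ _ _ xG m oe; case: (k).
  pose M := \max_(y : T) rW b a y; pose L := \max_(y : T) lev y.
  have leM y : rW b a y <= M by apply: leq_bigmax.
  have leL y : lev y <= L by apply: leq_bigmax.
  (* Three layers: at most [M] on [W], between [M + 1] and [M + L + 1] on the rest of the attractor,
     and above that outside. Passing to a lower layer is a strict decrease; the outer offset is
     even, so parities of [r'] are preserved. *)
  exists (fun x => if x \in W then rW b a x else if x \in attrT then M.+1 + lev x
                   else (M + L).+1.*2 + r' b a x).
  move=> _ _ x c e xG m oe [q1 q2 q3] h1 h2.
  have nf : ~ fav e by move=> /ex; apply.
  case xW: (x \in W).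
    have [tW /(_ b a)] := q1 xW; rewrite eb oa tW => /(_ isT isT h1 h2); exact.
  case xA: (x \in attrT).
    have [//|[tA lt]] : fav e \/ (tg e \in attrT /\ lev (tg e) < lev x).
      by apply: q2; rewrite inE xW xA.
    rewrite tA; case: ifP => _; last by split; [rewrite leq_add2l ltnW | lia].
    by have := leM (tg e); split; lia.
  have [//|tA|[tG /(_ b a)]] : [\/ fav e, tg e \in attrT | tg e \in G :\: attrT /\
    forall b a, ~~ odd b -> odd a -> okr r' x e b a] by apply: q3; rewrite inE xA xG.
    rewrite tA; have := leM (tg e); have := leL (tg e).
    by case: ifP => _; split; lia.
  have W0 : W \subset attrT by exact: attr_sub 0 _ _.
  move: tG; rewrite inE => /andP[tA _]; rewrite (negbTE tA).
  rewrite (negbTE (contra (subsetP W0 _) tA)) eb oa => /(_ isT isT h1 h2)[le eq].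
  by rewrite leq_add2l; split=> // /addnI/eq; rewrite oddD odd_double.
have [R hR] := choice hr; exists (fun b a => R (b, a)) => x c xG m.
have [e oe qe] := hQ _ _ xG m; exists e => // b a eb oa.
exact: (hR (b, a) eb oa _ _ _ xG m oe qe).
Qed.

End Attractor.

Lemma legalh_take mv x sigma h n : legalh mv x sigma h -> legalh mv x sigma (take n h).
Proof. by rewrite -{1}(cat_take_drop n h) => /legalh_cat[]. Qed.

(** If each event can still be provoked after every history, a play that provokes them in
    alternation sees both infinitely often. *)
Lemma two_events mv x sigma (Pa Pb : Ed -> Prop) :
  (forall h, legalh mv x sigma h -> exists h1, [/\ h1 <> [::], legalh mv x sigma (h ++ h1) & Pa (sigma (h ++ h1))]) ->
  (forall h, legalh mv x sigma h -> exists h1, [/\ h1 <> [::], legalh mv x sigma (h ++ h1) & Pb (sigma (h ++ h1))]) ->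
  exists rho, [/\ forall n, legalh mv x sigma (mkseq rho n),
    forall N, exists2 n, N <= n & Pa (sigma (mkseq rho n.+1)) &
    forall N, exists2 n, N <= n & Pb (sigma (mkseq rho n.+1))].
Proof.
move=> ha hb.
have H h : exists p : seq C * seq C, legalh mv x sigma h ->
    [/\ p.1 <> [::], p.2 <> [::], legalh mv x sigma (h ++ p.1 ++ p.2), Pa (sigma (h ++ p.1)) &
        Pb (sigma (h ++ p.1 ++ p.2))].
  have [l|nl] := pselect (legalh mv x sigma h); last by exists ([::], [::]).
  have [h1 [n1 l1 p1]] := ha h l; have [h2 [n2 l2 p2]] := hb _ l1.
  by exists (h1, h2) => _; rewrite /= catA.
have [f hf] := choice H.
pose g k := iter k (fun h => h ++ (f h).1 ++ (f h).2) [::].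
have lg k : legalh mv x sigma (g k) by elim: k => //= k ih; case: (hf _ ih).
have sg k : k <= size (g k).
  elim: k => //= k ih; have [n1 n2 _ _ _] := hf _ (lg k); rewrite !size_cat.
  by apply: leq_ltn_trans ih _; case: (f (g k)).1 n1 => //= *; lia.
have pre j k : j <= k -> exists h, g k = g j ++ h.
  move=> le; rewrite -(subnKC le); elim: (k - j) => [|i [h ih]]; first by exists [::]; rewrite addn0 cats0.
  by rewrite addnS; eexists; rewrite /= -/(g _) ih -catA.
(* The diagonal of the growing histories: [g n.+1] has more than n entries, so the default [c0] is
   never read. *)
pose rho n := nth c0 (g n.+1) n.
have E k n : n <= size (g k) -> mkseq rho n = take n (g k).
  move=> le; apply: (@eq_from_nth _ c0); first by rewrite size_mkseq size_takel.
  move=> i; rewrite size_mkseq => lt; rewrite nth_mkseq // nth_take // /rho.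
  case: (leqP i.+1 k) => [/pre[h ->]|/ltnW/pre[h ->]]; rewrite nth_cat.
    by rewrite sg.
  by rewrite (leq_trans lt le).
have E2 k h h' : g k.+1 = g k ++ h ++ h' -> h <> [::] ->
    exists2 n, k <= n & mkseq rho n.+1 = g k ++ h.
  move=> e; case/lastP: h e => // h c e _; exists (size (g k ++ h)).
    by rewrite size_cat (leq_trans (sg k)) // leq_addr.
  rewrite (E k.+1) e; last by rewrite !size_cat size_rcons; lia.
  by rewrite catA take_size_cat // !size_cat size_rcons addnS.
exists rho; split=> [n|N|N]; first by rewrite (E n) //; apply: legalh_take.
  have [n1 n2 l1 p1 p2] := hf _ (lg N).
  by have [n le e] := E2 N _ _ erefl n1; exists n => //; rewrite e.
have [n1 n2 l1 p1 p2] := hf _ (lg N).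
have [||n le e] := E2 N ((f (g N)).1 ++ (f (g N)).2) [::].
- by rewrite cats0.
- by case: (f (g N)).1 n1.
- by exists n => //; rewrite e.
Qed.

Lemma legal_in_G G mv opt x sigma h : closed_ar G mv opt -> x \in G -> winning mv opt x sigma ->
  legalh mv x sigma h -> posh x sigma h \in G.
Proof.
move=> cl xG [w _]; elim/last_ind: h => [|h c ih] //= /legalh_rcons[l m].
have := cl _ _ _ (ih l) m (w _ _ l m).
by case: h {ih l m}.
Qed.

(* Otherwise the rest of [sigma] after the history [h] would win while avoiding [P]. *)
Lemma unavoidable G mv opt x sigma (P : Ed -> Prop) : closed_ar G mv opt -> x \in G ->
  winning mv opt x sigma -> (forall y, y \in G -> ~ Win mv (fun z c e => opt z c e /\ ~ P e) y) ->
  forall h, legalh mv x sigma h -> exists h1, [/\ h1 <> [::], legalh mv x sigma (h ++ h1) & P (sigma (h ++ h1))].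
Proof.
move=> cl xG w no h l; apply: contrapT => H.
apply: (no _ (legal_in_G cl xG w l)); exists (fun h' => sigma (h ++ h')).
have [w1 w2] := winning_res w l; split=> // h' c l' m; split; first exact: w1.
move=> p; apply: H; exists (rcons h' c); split=> //; first by case: h' {l' m p}.
by apply/legalh_cat; split=> //; apply/legalh_rcons.
Qed.

Definition bounded_ar G mv opt A B := forall x c e, x \in G -> mv x c -> opt x c e -> pa e < A /\ pb e < B.

Lemma top_avoidable G mv opt A B : closed_ar G mv opt -> bounded_ar G mv opt A.+1 B.+1 ->
  odd A -> ~~ odd B -> (exists2 x, x \in G & Win mv opt x) ->
  (exists2 y, y \in G & Win mv (fun z c e => opt z c e /\ pa e <> A) y) \/
  (exists2 y, y \in G & Win mv (fun z c e => opt z c e /\ pb e <> B) y).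
Proof.
move=> cl bd oA oB [x xG [sigma w]]; apply: contrapT => /not_orP[na nb].
have ha y : y \in G -> ~ Win mv (fun z c e => opt z c e /\ pa e <> A) y by move=> yG wy; apply: na; exists y.
have hb y : y \in G -> ~ Win mv (fun z c e => opt z c e /\ pb e <> B) y by move=> yG wy; apply: nb; exists y.
have [rho [l ra rb]] := two_events (unavoidable cl xG w ha) (unavoidable cl xG w hb).
(* No priority of the arena exceeds [A] or [B], so recurring already makes them the largest
   recurring ones. *)
apply: (w.2 rho l); exists B, A; split=> //; split=> //; exists 0 => n _ /=.
all: have /legalh_rcons[l1 m1] : legalh mv x sigma (rcons (mkseq rho n) (rho n)) by rewrite -mkseqS.
all: have := bd _ _ _ (legal_in_G cl xG w l1) m1 (w.1 _ _ l1 m1); rewrite -mkseqS !ltnS; by case.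
Qed.

(* By induction on the number of positions and the priorities.  If the top priority is good for Eve,
   remove the attractor of the rounds of that priority.  Otherwise Eve wins from some position while
   avoiding one of the two top priorities, for else Adam could force both of them infinitely often;
   rank the set of these positions W by induction, and remove the attractor of W.  In both cases the
   attractor is ranked by the distance to its target, below the ranks of the remaining positions. *)
Theorem Win_rankable G mv opt A B : closed_ar G mv opt -> bounded_ar G mv opt A B ->
  (forall x, x \in G -> Win mv opt x) -> rankable G mv opt.
Proof.
move: {2}(#|G| + A + B) (leqnn (#|G| + A + B)) => N.
elim: N G mv opt A B => [|N IH] G mv opt A B leN cl bd win.
  exists (fun _ _ _ => 0) => x c xG; have : 0 < #|G| by rewrite (cardD1 x) xG.
  by lia.
have edge x c : x \in G -> mv x c -> exists2 e, opt x c e & pa e < A /\ pb e < B.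
  move=> xG m; have [s [w _]] := win x xG.
  by have o := w [::] c (legalh_nil _ _ _) m; eexists; first exact: o; apply: bd xG m o.
case: A leN bd edge => [|A] leN bd edge.
  by exists (fun _ _ _ => 0) => x c xG m; have [e _ []] := edge _ _ xG m.
case: B leN bd edge => [|B] leN bd edge.
  by exists (fun _ _ _ => 0) => x c xG m; have [e _ []] := edge _ _ xG m.
have attr_out (W : {set T}) (fav : Ed -> Prop) : W \subset G -> closed_ar (G :\: attrT G W mv opt fav) (mv_out G W mv opt fav) opt.
  move=> sW x c e; rewrite !inE => /andP[_ xG] [m o] oe; rewrite (cl _ _ _ xG m oe) andbT.
  by case: (o e oe).
have win_out (W : {set T}) (fav : Ed -> Prop) x : x \in G :\: attrT G W mv opt fav -> Win (mv_out G W mv opt fav) opt x.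
  rewrite inE => /andP[_ /win[s w]]; exists s; apply: winning_mono w => y c; by case.
have card_out (W : {set T}) (fav : Ed -> Prop) : #|G :\: attrT G W mv opt fav| <= #|G|.
  by apply: subset_leq_card; apply: subsetDl.
have [oA|oA] := boolP (odd A); last first.
  (* Eve's top priority [A] is even. Its rounds exceed the thresholds of every pair with a < A,
     while an odd a > A never occurs. Outside their attractor the priority [A] is gone, so the bound
     drops. *)
  have := @rankable_attr G set0 mv opt (fun e => pa e = A) cl (sub0set _) _ (fun _ _ _ => 0).
  apply=> [b a eb oa|x c|]; last 1 first.
  - apply: (IH _ _ _ A B.+1); [|exact: attr_out (sub0set _)| |exact: win_out].
      by have := card_out set0 (fun e => pa e = A); lia.
    move=> x c e; rewrite inE => /andP[_ xG] [m o] oe; have [nA _] := o e oe.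
    have [ltA ltB] := bd _ _ _ xG m oe; split=> //.
    by rewrite ltn_neqAle -ltnS ltA andbT; apply/eqP.
  - case: (ltngtP a A) => lt; last by rewrite -lt oa in oA.
      by left=> e -> [_]; rewrite leqNgt lt.
    right; exists true => x c e xG m oe e_a.
    by have [] := bd _ _ _ xG m oe; rewrite e_a ltnS leqNgt lt.
  - by rewrite inE.
have [oB|oB] := boolP (odd B).
  (* The mirror case: Adam's top priority [B] is odd, which exceeds every even b < B, and larger b
     never occur. *)
  have := @rankable_attr G set0 mv opt (fun e => pb e = B) cl (sub0set _) _ (fun _ _ _ => 0).
  apply=> [b a eb oa|x c|]; last 1 first.
  - apply: (IH _ _ _ A.+1 B); [|exact: attr_out (sub0set _)| |exact: win_out].
      by have := card_out set0 (fun e => pb e = B); lia.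
    move=> x c e; rewrite inE => /andP[_ xG] [m o] oe; have [nB _] := o e oe.
    have [ltA ltB] := bd _ _ _ xG m oe; split=> //.
    by rewrite ltn_neqAle -ltnS ltB andbT; apply/eqP.
  - case: (ltngtP b B) => lt; last by rewrite lt oB in eb.
      by left=> e -> []; rewrite leqNgt lt.
    right; exists false => x c e xG m oe e_b.
    by have [_] := bd _ _ _ xG m oe; rewrite e_b ltnS leqNgt lt.
  - by rewrite inE.
have [/pred0P G0|/pred0Pn[x0 x0G]] := boolP (pred0b (mem G)).
  by exists (fun _ _ _ => 0) => x c xG; have := G0 x; rewrite /= xG.
suff [W [rW [sW W0 hW]]] : exists (W : {set T}) (rW : nat -> nat -> T -> nat), [/\ W \subset G, W != set0 &
    forall x c, x \in W -> mv x c -> exists2 e, opt x c e & tg e \in W /\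
     forall b a, ~~ odd b -> odd a -> okr rW x e b a].
  have := @rankable_attr G W mv opt (fun _ => False) cl sW _ rW hW; apply; first by left.
  apply: (IH _ _ _ A.+1 B.+1); [|exact: attr_out| |exact: win_out]; last first.
    by move=> x c e; rewrite inE => /andP[_ xG] [m o]; apply: bd.
  have : #|G :\: attrT G W mv opt (fun _ => False)| < #|G|.
    apply: proper_card; case/set0Pn: W0 => w wW; apply/properP; split; first exact: subsetDl.
    exists w; first exact: (subsetP sW).
    by rewrite inE negb_and negbK (subsetP (attr_sub G W mv opt _ (leq0n _))).
  by move: leN; lia.
have sub opt' : (forall x c e, opt' x c e -> opt x c e) ->
   forall A' B', A' + B' <= A + B.+1 -> bounded_ar G mv opt' A' B' ->
   (exists2 y, y \in G & Win mv opt' y) -> exists (W : {set T}) (rW : nat -> nat -> T -> nat), [/\ W \subset G, W != set0 &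
    forall x c, x \in W -> mv x c -> exists2 e, opt x c e & tg e \in W /\
     forall b a, ~~ odd b -> odd a -> okr rW x e b a].
  (* [W] is the winning region for the reduced answers while Adam keeps all his moves;
     [Win_restrict] makes it closed, and one priority bound has dropped, so the induction hypothesis
     applies. *)
  move=> so A' B' leAB bd' [y yG wy]; pose W := [set x in G | `[< Win mv opt' x >]].
  have sW : W \subset G by apply/subsetP => x; rewrite inE => /andP[].
  have cl' : closed_ar W mv (fun y c e => opt' y c e /\ Win mv opt' (tg e)).
    move=> x c e; rewrite !inE => /andP[xG _] m [o w]; rewrite (cl _ _ _ xG m (so _ _ _ o)).
    exact/asboolP.
  have [] := IH W mv (fun y c e => opt' y c e /\ Win mv opt' (tg e)) A' B'.
  - by have := subset_leq_card sW; lia.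
  - exact: cl'.
  - by move=> x c e xW m [o _]; apply: bd' m o; apply: (subsetP sW).
  - by move=> x; rewrite inE => /andP[_ /asboolP]; apply: Win_restrict.
  move=> rW hW; exists W, rW; split=> //; first by apply/set0Pn; exists y; rewrite inE yG; apply/asboolP.
  move=> x c xW m; have [e o ok] := hW _ _ xW m; exists e; first by apply: so; case: o.
  by split=> //; apply: cl' xW m o.
have [wa|wb] := top_avoidable cl bd oA oB (ex_intro2 _ _ x0 x0G (win x0 x0G)).
  apply: (sub _ _ A B.+1 _ _ wa) => [x c e []|//|] //.
  move=> x c e xG m [o n]; have [ltA ltB] := bd _ _ _ xG m o; split=> //.
  by rewrite ltn_neqAle -ltnS ltA andbT; apply/eqP.
apply: (sub _ _ A.+1 B _ _ wb) => [x c e []||] //; first by rewrite addSnnS.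
move=> x c e xG m [o n]; have [ltA ltB] := bd _ _ _ xG m o; split=> //.
by rewrite ltn_neqAle -ltnS ltB andbT; apply/eqP.
Qed.

End Game.

(** * Rankings of simulation games *)

Definition rank_ok (r : nat -> nat -> nat -> nat -> nat) p q (t u : trans) b a :=
  t_pri t <= b -> t_pri u <= a -> r b a (t_dst t) (t_dst u) <= r b a p q /\
  (r b a (t_dst t) (t_dst u) = r b a p q -> if odd (r b a p q) then t_pri u <> a else t_pri t <> b).

Definition ranked (A B : NPA) (Inv : nat -> nat -> Prop) r :=
  Inv (init B) (init A) /\
  forall p q t, Inv p q -> t \in delta B -> t_src t = p -> exists u,
    [/\ u \in delta A, t_src u = q, t_let u = t_let t, Inv (t_dst t) (t_dst u) &
        forall b a, ~~ odd b -> odd a -> rank_ok r p q t u b a].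

Lemma le_maxpri A u : u \in delta A -> t_pri u <= \max_(u <- delta A) t_pri u.
Proof. by move=> m; apply: leq_bigmax_seq. Qed.

Lemma is_path_rcons A q s t : is_path A q (rcons s t) =
  [&& is_path A q s, t \in delta A & t_src t == last q (map t_dst s)].
Proof.
elim: s q => [|u s ih] q /=; first by rewrite andbT.
by rewrite ih -!andbA.
Qed.

Lemma eve_answers_rcons sigma h t :
  eve_answers sigma (rcons h t) = rcons (eve_answers sigma h) (sigma (rcons h t)).
Proof.
rewrite /eve_answers size_rcons mkseqS -[in sigma (take (size h).+1 _)](size_rcons h t) take_size; congr rcons.
by apply/eq_in_map => i; rewrite mem_iota add0n => /andP[_ lt]; rewrite -cats1 takel_cat.
Qed.

Lemma is_runP B rho : is_run B rho -> forall n,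
  rho n \in delta B /\ t_src (rho n) = (if n is m.+1 then t_dst (rho m) else init B).
Proof.
move=> h n; have := h n.+1; rewrite mkseqS is_path_rcons => /and3P[_ -> /eqP->]; split=> //.
by case: n => // n; rewrite mkseqS map_rcons last_rcons.
Qed.

Lemma limsup_bounded (s : nat -> nat) K : (forall n, s n <= K) -> exists m, limsup_is s m.
Proof.
move=> hK.
have [m [] ]: exists m, (forall N, exists2 n, N <= n & m <= s n) /\ ~ (forall N, exists2 n, N <= n & m.+1 <= s n).
  apply: contrapT => /forallNP H.
  have : forall m N, exists2 n, N <= n & m <= s n.
    elim=> [N|m ih]; first by exists N.
    by apply: contrapT => h; apply: (H m).
  by move=> /(_ K.+1 0)[n _]; rewrite ltnNge hK.
move=> h1 /existsNP[N0 h2]; exists m.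
have le n : N0 <= n -> s n <= m.
  by move=> ln; rewrite leqNgt; apply/negP => lt; apply: h2; exists n.
split; last by exists N0.
move=> N; have [n ln ge] := h1 (maxn N N0); exists n; first by apply: leq_trans ln; apply: leq_maxl.
by apply/eqP; rewrite eqn_leq ge le // (leq_trans _ ln) // leq_maxr.
Qed.

Lemma nonincr_const (s : nat -> nat) N0 : (forall n, N0 <= n -> s n.+1 <= s n) ->
  exists2 N, N0 <= N & forall n, N <= n -> s n = s N.
Proof.
move: {2}(s N0) (leqnn (s N0)) => k; elim: k N0 => [|k ih] N0 le mono.
all: have dec n : N0 <= n -> s n <= s N0 by
  (move=> ln; rewrite -(subnKC ln); elim: (n - N0) => [|i hi];
   [by rewrite addn0|rewrite addnS; apply: leq_trans hi; apply: mono; apply: leq_addr]).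
  by exists N0 => // n /dec; lia.
have [h|/existsNP[n /not_implyP[ln ne]]] := pselect (forall n, N0 <= n -> s n = s N0); first by exists N0.
have [||N lN hN] := ih n.
- by have := dec n ln; lia.
- by move=> i li; apply: mono; apply: leq_trans li.
by exists N => //; apply: leq_trans lN.
Qed.

(** Let b be the even largest recurring priority of Adam and suppose Eve's is an odd a. From some
    round on the priorities are at most b and a, so the rank for (b, a) never increases and becomes
    constant; its parity then excludes a or b from all later rounds. *)
Theorem ranked_simulates A B Inv r : ranked A B Inv r -> simulates A B.
Proof.
move=> [I0 step].
have H (x : nat * nat * trans) : exists u, Inv x.1.1 x.1.2 -> x.2 \in delta B -> t_src x.2 = x.1.1 ->
    [/\ u \in delta A, t_src u = x.1.2, t_let u = t_let x.2, Inv (t_dst x.2) (t_dst u) &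
        forall b a, ~~ odd b -> odd a -> rank_ok r x.1.1 x.1.2 x.2 u b a].
  case: x => [[p q] t] /=.
  have [h|h] := pselect [/\ Inv p q, t \in delta B & t_src t = p].
    by have [u hu] := step _ _ _ (let: And3 a b c := h in a) (let: And3 a b c := h in b) (let: And3 a b c := h in c); exists u.
  by exists t => h1 h2 h3; case: h.
have [f hf] := choice H.
pose ans q t := f (t_src t, q, t).
have {H hf} hans q t : Inv (t_src t) q -> t \in delta B ->
    [/\ ans q t \in delta A, t_src (ans q t) = q, t_let (ans q t) = t_let t, Inv (t_dst t) (t_dst (ans q t)) &
        forall b a, ~~ odd b -> odd a -> rank_ok r (t_src t) q t (ans q t) b a].
  by move=> i m; apply: (hf (t_src t, q, t)).
(* Eve's state is recomputed by replaying her positional answers. The default transition answers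
   only the empty history, which never arises in a round. *)
pose stq s := foldl (fun q t => t_dst (ans q t)) (init A) s.
pose sigma (h : seq trans) := if rev h is t :: s then ans (stq (rev s)) t else (0, 0, 0, 0).
have sigE s t : sigma (rcons s t) = ans (stq s) t by rewrite /sigma rev_rcons revK.
have path h : is_path B (init B) h -> [/\ is_path A (init A) (eve_answers sigma h),
    [seq t_let t | t <- eve_answers sigma h] = [seq t_let t | t <- h],
    stq h = last (init A) (map t_dst (eve_answers sigma h)) &
    Inv (last (init B) (map t_dst h)) (stq h)].
  elim/last_ind: h => [|h t ih] //.
  rewrite is_path_rcons => /and3P[/ih[h1 h2 h3 h4] mt /eqP es]; rewrite -es in h4.
  have [m1 e1 e2 i2 _] := hans _ _ h4 mt; rewrite eve_answers_rcons sigE is_path_rcons h1 m1 e1 -h3 eqxx.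
  by rewrite !map_rcons h2 e2 !last_rcons /stq foldl_rcons.
exists sigma; split; first by move=> h /path[].
move=> rho hr; have [|] := pselect (accepting rho); last by right.
move=> [b [eb [hb1 hb2]]]; left.
pose q n := stq (mkseq rho n).
have uE n : eve_run sigma rho n = ans (q n) (rho n) by rewrite /eve_run mkseqS sigE.
have inv n : Inv (t_src (rho n)) (q n).
  have [_ _ _] := path _ (hr n); have [_ ->] := is_runP hr n.
  by case: n => // n; rewrite {1}mkseqS map_rcons last_rcons.
have inB n := (is_runP hr n).1.
have [a [ha1 [Na ha2]]] : exists m, limsup_is (fun n => t_pri (ans (q n) (rho n))) m.
  apply: (@limsup_bounded _ (\max_(u <- delta A) t_pri u)) => n.
  by have [m _ _ _ _] := hans _ _ (inv n) (inB n); apply: le_maxpri.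
have [oa|ea] := boolP (odd a); last first.
  exists a; split=> //; split; first by move=> N; have [n ln e] := ha1 N; exists n; rewrite // uE.
  by exists Na => n ln; rewrite uE; apply: ha2.
have [Nb hNb] := hb2.
pose x n := r b a (t_src (rho n)) (q n).
have qS n : q n.+1 = t_dst (ans (q n) (rho n)) by rewrite /q mkseqS /stq foldl_rcons.
have ok n : maxn Na Nb <= n -> x n.+1 <= x n /\ (x n.+1 = x n -> if odd (x n) then t_pri (ans (q n) (rho n)) <> a else t_pri (rho n) <> b).
  rewrite geq_max => /andP[la lb]; have [_ _ _ _ h] := hans _ _ (inv n) (inB n).
  have := h b a eb oa (hNb n lb) (ha2 n la).
  by rewrite /x qS (is_runP hr n.+1).2.
have [N lN cst] := nonincr_const (fun n ln => (ok n ln).1).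
have {}ok n : N <= n -> if odd (x N) then t_pri (ans (q n) (rho n)) <> a else t_pri (rho n) <> b.
  move=> ln; have := (ok n (leq_trans lN ln)).2; rewrite (cst n ln) (cst n.+1 (leqW ln)); exact.
case o: (odd (x N)) ok => ok; first by have [n ln e] := ha1 N; case: (ok n ln).
by have [n ln e] := hb1 N; case: (ok n ln).
Qed.

Section Renumber.
Variables (T : finType) (C Ed : Type) (pb pa : Ed -> nat) (tg : Ed -> T).

(* Replaces ranks by small ones of the same order and parity, so that certificates have polynomial size. *)
Definition renum (r : nat -> nat -> T -> nat) b a x :=
  #|[set y | r b a y < r b a x]|.*2 + odd (r b a x).

Lemma renum_le r b a x : renum r b a x <= #|T|.*2.+1.
Proof.
rewrite /renum -addn1 leq_add ?leq_b1 // leq_double; exact: max_card.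
Qed.

Lemma odd_renum r b a x : odd (renum r b a x) = odd (r b a x).
Proof. by rewrite /renum oddD odd_double oddb. Qed.

(** The position x is counted below y but not below itself, so the doubled part grows by at least
    two, more than the parity bit can undo. *)
Lemma renum_lt r b a x y : r b a x < r b a y -> renum r b a x < renum r b a y.
Proof.
move=> lt; suff : #|[set z | r b a z < r b a x]| < #|[set z | r b a z < r b a y]|.
  by rewrite /renum; case: (odd _); case: (odd _) => /=; lia.
apply: proper_card; apply/properP; split.
  by apply/subsetP => z; rewrite !inE => h; apply: ltn_trans lt.
by exists x; rewrite !inE ?ltnn.
Qed.

Lemma renum_okr r x e b a : okr pb pa tg r x e b a -> okr pb pa tg (renum r) x e b a.
Proof.
move=> ok h1 h2; have [le eq] := ok h1 h2; rewrite odd_renum.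
move: le; rewrite leq_eqVlt => /orP[/eqP e1|lt].
  have e2 : renum r b a (tg e) = renum r b a x by rewrite /renum e1.
  by rewrite e2 leqnn; split=> // _; apply: eq.
have lt2 := renum_lt lt; split; first exact: ltnW.
by move=> e2; rewrite e2 ltnn in lt2.
Qed.

End Renumber.

(** [nst A] may be exponential in the length of the instance; only these states can occur in a
    run. *)
Definition states_of (A : NPA) := undup (init A :: map t_dst (delta A)).

Lemma init_states A : init A \in states_of A.
Proof. by rewrite mem_undup mem_head. Qed.
Lemma dst_states A t : t \in delta A -> t_dst t \in states_of A.
Proof. by move=> h; rewrite mem_undup inE map_f ?orbT. Qed.
Lemma size_states A : size (states_of A) <= (size (delta A)).+1.
Proof. by apply: leq_trans (size_undup _) _; rewrite /= size_map. Qed.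

Theorem simulates_ranked A B : simulates A B -> exists Inv r,
  [/\ ranked A B Inv r, forall p q, Inv p q -> p \in states_of B /\ q \in states_of A &
      forall b a p q, r b a p q <= ((size (delta A)).+1 * (size (delta B)).+1).*2.+1].
Proof.
move=> [sigma [leg win]].
pose T := (seq_sub (states_of B) * seq_sub (states_of A))%type.
pose x0 : T := (SeqSub (init_states B), SeqSub (init_states A)).
(* Outside the states of the automata [mk] falls back on the initial ones; the invariant given below
   excludes such arguments. *)
pose mk p q : T := (insubd x0.1 p, insubd x0.2 q).
have mk1 p q : p \in states_of B -> ssval (mk p q).1 = p by move=> h; rewrite /mk /= val_insubd h.
have mk2 p q : q \in states_of A -> ssval (mk p q).2 = q by move=> h; rewrite /mk /= val_insubd h.
have mk_val (x : T) : mk (ssval x.1) (ssval x.2) = x.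
  by case: x => x1 x2; rewrite /mk /= !valKd.
pose Ed := (trans * trans * T)%type.
pose pb (e : Ed) := t_pri e.1.1; pose pa (e : Ed) := t_pri e.1.2; pose tg (e : Ed) := e.2.
pose mv (x : T) t := t \in delta B /\ t_src t = ssval x.1.
pose opt (x : T) (t : trans) (e : Ed) :=
  [/\ e.1.1 = t, e.1.2 \in delta A, t_src e.1.2 = ssval x.2, t_let e.1.2 = t_let t &
      e.2 = mk (t_dst t) (t_dst e.1.2)].
pose d0 : trans := (0, 0, 0, 0).
pose s' (h : seq trans) : Ed := (last d0 h, sigma h, mk (t_dst (last d0 h)) (t_dst (sigma h))).
have inv h : legalh tg d0 mv x0 s' h -> is_path B (init B) h /\
    posh tg x0 s' h = mk (last (init B) (map t_dst h)) (last (init A) (map t_dst (eve_answers sigma h))).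
  elim/last_ind: h => [|h t ih]; first by rewrite /= -[x0 in LHS]mk_val.
  move=> /legalh_rcons[/ih[p1 e1] [mt st]].
  have p2 : is_path B (init B) (rcons h t).
    rewrite is_path_rcons p1 mt st e1 mk1 ?eqxx //.
    case/lastP: h {e1 st ih} p1 => [_|h u]; first exact: init_states.
    by rewrite is_path_rcons map_rcons last_rcons => /and3P[_ /dst_states].
  split=> //; rewrite eve_answers_rcons !map_rcons !last_rcons.
  have -> : posh tg x0 s' (rcons h t) = tg (s' (rcons h t)) by case: (h).
  by rewrite /tg /s' /= last_rcons.
have wx0 : Win pb pa tg d0 mv opt x0.
  exists s'; split=> [h t l m|rho l].
    have [p2 _] := inv _ (iffRL (legalh_rcons _ _ _ _ _ _ _) (conj l m)).
    have [_ e1] := inv _ l; have := leg _ p2; rewrite eve_answers_rcons is_path_rcons !map_rcons => -[/and3P[pA mA /eqP sA] /eqP].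
    rewrite eqseq_rcons => /andP[_ /eqP eL]; rewrite /opt /s' /= last_rcons; split=> //.
    rewrite sA e1 mk2 //; case/lastP: (eve_answers sigma h) pA => [_|h' u]; first exact: init_states.
    by rewrite is_path_rcons map_rcons last_rcons => /and3P[_ /dst_states].
  have hr : is_run B rho by move=> n; case: (inv _ (l n)).
  move=> [b [a [eb oa lb la]]]; have eqr : pb \o (fun n => s' (mkseq rho n.+1)) = (fun n => t_pri (rho n)).
    by apply: funext => n; rewrite -[LHS]/(t_pri (last d0 (mkseq rho n.+1))) mkseqS last_rcons.
  rewrite eqr in lb; have [[m [em [h1 [N1 h2]]]]|na] := win rho hr; last by apply: na; exists b; split.
  (* A run has only one largest recurring priority, so the even m of an accepting run would equal
     the odd a. *)
  have [h3 [N2 h4]] := la; have e : m = a; last by rewrite e oa in em.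
  apply/eqP; rewrite eqn_leq; apply/andP; split.
    have [n ln e] := h1 N2; rewrite -e; exact: h4.
  have [n ln e] := h3 N1; rewrite -e; exact: h2.
pose G := [set x : T | `[< Win pb pa tg d0 mv opt x >]].
pose opt' (x : T) t e := opt x t e /\ Win pb pa tg d0 mv opt (tg e).
have inG x : x \in G <-> Win pb pa tg d0 mv opt x by rewrite inE; split=> [/asboolP|/asboolP].
have [|x c e _ [m _] [[e1 m' _ _ _] _]||r hr] := @Win_rankable T trans Ed pb pa tg d0 G mv opt'
   (\max_(u <- delta A) t_pri u).+1 (\max_(u <- delta B) t_pri u).+1.
- by move=> x c e _ _ [_ w]; apply/inG.
- rewrite /pa /pb !ltnS e1; split; first exact: le_maxpri.
  exact: le_maxpri.
- by move=> x /inG; apply: Win_restrict.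
exists (fun p q => [/\ p \in states_of B, q \in states_of A & mk p q \in G]).
exists (fun b a p q => renum r b a (mk p q)); split.
- split; first by split; [exact: init_states|exact: init_states|]; apply/inG; rewrite -[mk _ _]/(mk (ssval x0.1) (ssval x0.2)) mk_val.
  move=> p q t [pB qA pG] mt st.
  have [|e [[e1 mA sA eL eT] w] ok] := hr (mk p q) t pG; first by split; rewrite // mk1.
  exists e.1.2; rewrite -eT; split=> //; first by rewrite sA mk2.
    split; [exact: dst_states|exact: dst_states|].
    by apply/inG.
  move=> b a eb oa; have := renum_okr (ok b a eb oa); rewrite /okr /rank_ok /pb /pa /tg e1 -eT; exact.
- by move=> p q [].
- move=> b a p q; apply: leq_trans (renum_le _ _ _ _) _; rewrite ltnS leq_double card_prod mulnC.
  by rewrite !card_seq_sub ?undup_uniq // leq_mul // size_states.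
Qed.

(** * Binary numbers and encodings of instances *)

Section BinaryArith.
Variables (X : Type) (e : enc_of X).

Lemma fp_bitsN (f : X -> nat) : fp e eN f -> fp e (eL eB) (fun x => bits (f x)).
Proof. by move=> h; apply: fp_comp h (fp_repr _). Qed.

Lemma odd_bits n : odd n = head false (bits n).
Proof. by case: n => // n; rewrite bits_rec. Qed.

Lemma fp_odd (f : X -> nat) : fp e eN f -> fp e eB (fun x => odd (f x)).
Proof.
by move=> h; apply: fp_ext (fp_head false (fp_bitsN h)) => x; rewrite odd_bits.
Qed.

(** Comparison from the least significant bit: the flag is the verdict so far, overruled by each
    later difference. In [cmp_end], bits left over make the first number the larger one, as
    expansions have no leading zeros. *)
Definition cmp_step (p : seq bool * bool) (b : bool) : seq bool * bool :=
  (behead p.1, if head false p.1 == b then p.2 else b).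

Definition cmp_end (p : seq bool * bool) := nilp p.1 && p.2.

Lemma foldl_cmp m n r :
  cmp_end (foldl cmp_step (bits m, r) (bits n)) = (m < n) || ((m == n) && r).
Proof.
elim/bits_ind: n m r => [|n n0 ih] m r.
  case: m => //= m; by rewrite bits_rec.
rewrite [bits n]bits_rec //=.
have -> : cmp_step (bits m, r) (odd n) = (bits m./2, if odd m == odd n then r else odd n).
  by case: m => [|m]; rewrite // bits_rec.
rewrite ih; have := odd_double_half m; have := odd_double_half n.
move: (m./2) (n./2) (odd m) (odd n) => m' n' a b <- <-.
by case: a; case: b; case: r; rewrite /= ?andbT ?andbF ?orbF; lia.
Qed.

Lemma fp_ltn (f g : X -> nat) : fp e eN f -> fp e eN g -> fp e eB (fun x => f x < g x).
Proof.
move=> hf hg; apply: (@fp_ext _ _ _ _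
  (fun x => cmp_end (foldl cmp_step (bits (f x), false) (bits (g x))))) => [x|].
  by rewrite foldl_cmp andbF orbF.
apply: (fp_comp (eB' := eP (eL eB) eB) (g := cmp_end)); last first.
  by apply: fp_andb (fp_nilp (fp_fst (fp_id _))) (fp_snd (fp_id _)).
apply: (fp_foldl_add (f := fun _ => cmp_step) (q := fun _ => 3)) (fp_bitsN hg) (fp_pair (fp_bitsN hf) (fp_const _ _ _)) _ _.
- by polyn_tac.
- have hid := fp_id (eP (eP e (eP (eL eB) eB)) eB); have hp := fp_snd (fp_fst hid).
  apply: fp_pair (fp_behead (fp_fst hp)) (fp_if _ (fp_snd hp) (fp_snd hid)).
  exact: fp_eq eB_inj (fp_head false (fp_fst hp)) (fp_snd hid).
- move=> x [s r] b; rewrite /cmp_step /eP /= !tsize_Nd.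
  have := tsize_bool (if head false s == b then r else b).
  by case: s => [|c s] /=; rewrite ?tsize_Nd /=; have := tsize_gt0 (eB r); lia.
Qed.

Lemma fp_leq (f g : X -> nat) : fp e eN f -> fp e eN g -> fp e eB (fun x => f x <= g x).
Proof.
by move=> hf hg; apply: fp_ext (fp_negb (fp_ltn hg hf)) => x; rewrite -leqNgt.
Qed.

Lemma fp_eqN (f g : X -> nat) : fp e eN f -> fp e eN g -> fp e eB (fun x => f x == g x).
Proof. exact: fp_eq eN_inj. Qed.

End BinaryArith.

Definition eTr : enc_of trans := eP (eP (eP eN eN) eN) eN.
Definition eNPA : enc_of NPA := fun A => eP eN (eP eN (eL eTr)) (nst A, (init A, delta A)).

Section Fields.
Variables (X : Type) (e : enc_of X).

Lemma fp_src (f : X -> trans) : fp e eTr f -> fp e eN (fun x => t_src (f x)).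
Proof. by move=> h; exact: fp_fst (fp_fst (fp_fst h)). Qed.
Lemma fp_let (f : X -> trans) : fp e eTr f -> fp e eN (fun x => t_let (f x)).
Proof. by move=> h; exact: fp_snd (fp_fst (fp_fst h)). Qed.
Lemma fp_dst (f : X -> trans) : fp e eTr f -> fp e eN (fun x => t_dst (f x)).
Proof. by move=> h; exact: fp_snd (fp_fst h). Qed.
Lemma fp_pri (f : X -> trans) : fp e eTr f -> fp e eN (fun x => t_pri (f x)).
Proof. by move=> h; exact: fp_snd h. Qed.

Lemma fp_NPA (f : X -> NPA) : fp e eNPA f ->
  fp e (eP eN (eP eN (eL eTr))) (fun x => (nst (f x), (init (f x), delta (f x)))).
Proof. by move=> h; apply: (fp_comp h (g := fun A => (nst A, (init A, delta A)))); apply: fp_repr. Qed.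

Lemma fp_nst (f : X -> NPA) : fp e eNPA f -> fp e eN (fun x => nst (f x)).
Proof. by move/fp_NPA/fp_fst. Qed.
Lemma fp_init (f : X -> NPA) : fp e eNPA f -> fp e eN (fun x => init (f x)).
Proof. by move/fp_NPA/fp_snd/fp_fst. Qed.
Lemma fp_delta (f : X -> NPA) : fp e eNPA f -> fp e (eL eTr) (fun x => delta (f x)).
Proof. by move/fp_NPA/fp_snd/fp_snd. Qed.
Lemma fp_mkNPA (f g : X -> nat) (h : X -> seq trans) : fp e eN f -> fp e eN g -> fp e (eL eTr) h ->
  fp e eNPA (fun x => mkNPA (f x) (g x) (h x)).
Proof.
move=> hf hg hh; apply: (fp_comp (fp_pair hf (fp_pair hg hh)) (g := fun p => mkNPA p.1 p.2.1 p.2.2)).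
exact: fp_repr.
Qed.

End Fields.

Ltac fp_tac := lazymatch goal with
  | |- fp _ _ (fun x => x) => exact: fp_id
  | |- fp _ _ (fun x => (_, _)) => apply: fp_pair; fp_tac
  | |- fp _ _ (fun x => fst _) => apply: fp_fst; fp_tac
  | |- fp _ _ (fun x => snd _) => apply: fp_snd; fp_tac
  | |- fp _ _ (fun x => t_src _) => apply: fp_src; fp_tac
  | |- fp _ _ (fun x => t_let _) => apply: fp_let; fp_tac
  | |- fp _ _ (fun x => t_dst _) => apply: fp_dst; fp_tac
  | |- fp _ _ (fun x => t_pri _) => apply: fp_pri; fp_tac
  | |- fp _ _ (@fst _ _) => exact: fp_fst (fp_id _)
  | |- fp _ _ (@snd _ _) => exact: fp_snd (fp_id _)
  | |- fp _ _ _ => first [exact: fp_const | assumption | idtac]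
  end.

Lemma eSym_inj : injective eSym.
Proof. by case=> [[]|] [[]|]. Qed.

Lemma fp_Some X (e : enc_of X) (f : X -> bool) : fp e eB f -> fp e eSym (fun x => Some (f x)).
Proof.
move=> h; apply: (fp_comp h); apply: (fp_via (g := Nd Lf)) => //.
by apply: fp_comp (fp_pair (fp_const eT eT Lf) (fp_id eT)) (fp_repr (f := fun p => Nd p.1 p.2) _).
Qed.

Section Encode.
Variables (X : Type) (e : enc_of X).

Lemma fp_enc_nats (f : X -> seq nat) : fp e (eL eN) f -> fp e (eL eSym) (fun x => enc_nats (f x)).
Proof.
move=> h; rewrite /enc_nats; apply: fp_flatten.
apply: (fp_map (g := fun _ n => rcons (map Some (bits n)) None)) h.
apply: (@fp_ext _ _ _ _ (fun p => map Some (bits p.2) ++ [:: None])) => [p|]; first by rewrite cats1.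
apply: fp_cat (fp_const _ _ _).
apply: (fp_map (eA := eB) (g := fun _ b => Some b)); first exact: fp_Some (fp_snd (fp_id _)).
by apply: fp_bitsN; fp_tac.
Qed.

Lemma fp_ser_NPA (f : X -> NPA) : fp e eNPA f -> fp e (eL eN) (fun x => ser_NPA (f x)).
Proof.
move=> h; rewrite /ser_NPA.
apply: fp_cons (fp_nst h) _; apply: fp_cons (fp_init h) _; apply: fp_cons.
  exact: fp_bits (fp_sizeU (fp_delta h)).
apply: fp_flatten; apply: (fp_map (g := fun _ t => [:: t_src t; t_let t; t_dst t; t_pri t])) (fp_delta h).
by do 4![apply: fp_cons; first by fp_tac]; exact: fp_const.
Qed.

Lemma fp_enc_instance (k : X -> nat) (f g : X -> NPA) : fp e eN k -> fp e eNPA f -> fp e eNPA g ->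
  fp e (eL eSym) (fun x => enc_instance (k x) (f x) (g x)).
Proof.
move=> hk hf hg; apply: fp_enc_nats; apply: fp_cons hk _.
by apply: fp_cat; apply: fp_ser_NPA.
Qed.

Definition wfb k (A : NPA) := [&& init A < nst A,
  all (fun t => [&& t_src t < nst A, t_let t < k & t_dst t < nst A]) (delta A) &
  undup (map fst (delta A)) == map fst (delta A)].

Lemma wfP k A : reflect (wf_NPA k A) (wfb k A).
Proof.
apply: (iffP and3P) => [[h1 /allP h2 /eqP h3]|[h1 [h2 h3]]].
  split=> //; split; first by move=> t /h2/and3P[].
  by rewrite -h3 undup_uniq.
by split=> //; [apply/allP => t /h2[-> -> ->] | rewrite undup_id].
Qed.

Lemma fp_wfb (k : X -> nat) (f : X -> NPA) : fp e eN k -> fp e eNPA f -> fp e eB (fun x => wfb (k x) (f x)).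
Proof.
move=> hk hf; apply: fp_andb; first exact: fp_ltn (fp_init hf) (fp_nst hf).
apply: fp_andb.
  have hid := fp_id (eP e eTr); have hf' := fp_comp (fp_fst hid) hf; have hk' := fp_comp (fp_fst hid) hk.
  apply: (fp_all (p := fun x t => [&& t_src t < nst (f x), t_let t < k x & t_dst t < nst (f x)])) (fp_delta hf).
  apply: fp_andb; first exact: fp_ltn (fp_src (fp_snd hid)) (fp_nst hf').
  apply: fp_andb; first exact: fp_ltn (fp_let (fp_snd hid)) hk'.
  exact: fp_ltn (fp_dst (fp_snd hid)) (fp_nst hf').
have hm : fp e (eL (eP (eP eN eN) eN)) (fun x => map fst (delta (f x))).
  by apply: (fp_map (g := fun _ t => t.1)) (fp_delta hf); apply: fp_fst; apply: (fp_snd (eB' := eTr)); fp_tac.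
have inj : injective (eP (eP eN eN) eN) by do ![apply: eP_inj | apply: eN_inj].
by apply: fp_eq (eL_inj inj) (fp_undup inj hm) hm.
Qed.

End Encode.

(** Decoders are total: a malformed witness decodes to some certificate, which is harmless because
    [check_sound] covers every certificate. *)
Fixpoint t2l t := if t is Nd a l then a :: t2l l else [::].
Definition decL A (dec : tree -> A) t := map dec (t2l t).
Definition decB t := ~~ isLf t.
Definition decN t := bval (decL decB t).
Definition decP A B (d1 : tree -> A) (d2 : tree -> B) t := (d1 (thd t), d2 (ttl t)).

Lemma decLK A (eA : enc_of A) dec : cancel eA dec -> cancel (eL eA) (decL dec).
Proof. by move=> h; elim=> //= a l ih; rewrite /decL /= h -/(decL _ _) ih. Qed.
Lemma decBK : cancel eB decB. Proof. by case. Qed.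
Lemma decNK : cancel eN decN.
Proof. by move=> n; rewrite /decN (decLK decBK) bitsK. Qed.
Lemma decPK A B (eA : enc_of A) (eB' : enc_of B) d1 d2 : cancel eA d1 -> cancel eB' d2 ->
  cancel (eP eA eB') (decP d1 d2).
Proof. by move=> h1 h2 [a b]; rewrite /decP /= h1 h2. Qed.

Lemma fp_decL A (eA : enc_of A) dec : fp eT eA dec -> fp eT (eL eA) (decL dec).
Proof.
move=> h; apply: (fp_map (g := fun _ => dec)); first exact: fp_comp (fp_snd (fp_id _)) h.
by apply: fp_repr; elim=> //= a _ l ->.
Qed.
Lemma fp_decB : fp eT eB decB.
Proof. exact: fp_negb fp_isLf. Qed.
Lemma fp_decP A B (eA : enc_of A) (eB' : enc_of B) d1 d2 : fp eT eA d1 -> fp eT eB' d2 ->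
  fp eT (eP eA eB') (decP d1 d2).
Proof. by move=> h1 h2; apply: fp_pair (fp_comp fp_thd h1) (fp_comp fp_ttl h2). Qed.

(** A witness may spell a number with leading zeros, which must be dropped to obtain its code under
    [eN]. *)
Definition strip_step (u : seq bool) (b : bool) := if ~~ b && nilp u then [::] else b :: u.

Lemma bits_bval s : bits (bval s) = foldl strip_step [::] (rev s).
Proof.
elim: s => //= b s ih; rewrite bits_cons ih rev_cons foldl_rcons /strip_step.
by case: (foldl _ _ _).
Qed.

Lemma fp_decN : fp eT eN decN.
Proof.
suff h : fp eT (eL eB) (fun t => bits (decN t)).
  by move=> S; have [c [p hp hc]] := h S; exists c, p.
apply: (@fp_ext _ _ _ _ (fun t => foldl strip_step [::] (rev (decL decB t)))) => [t|].
  by rewrite -bits_bval.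
apply: (fp_foldl_add (f := fun _ => strip_step) (q := fun n => n.+1)) (fp_rev (fp_decL fp_decB)) (fp_const _ _ _) _ _.
- by polyn_tac.
- have hid := fp_id (eP (eP eT (eL eB)) eB); have hu := fp_snd (fp_fst hid).
  apply: fp_if (fp_andb (fp_negb (fp_snd hid)) (fp_nilp hu)) (fp_const _ _ _) _.
  exact: fp_cons (fp_snd hid) hu.
- move=> x s b; rewrite /strip_step; case: ifP => _; rewrite /eP /= ?tsize_Nd; last by lia.
  by have := tsize_gt0 (eL eB s); rewrite /tsize /=; lia.
Qed.

(** A preorder code is parsed from right to left on a stack of trees, each [true] joining the two
    topmost ones; [Lf] stands in for missing trees of malformed words. *)
Definition parse_step (s : seq tree) (b : bool) :=
  if b then Nd (head Lf s) (head Lf (behead s)) :: behead (behead s) else Lf :: s.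
Definition parse (w : seq bool) := head Lf (foldl parse_step [::] (rev w)).

Lemma parse_code t : parse (code t) = t.
Proof.
suff H s : foldl parse_step s (rev (code t)) = t :: s by rewrite /parse H.
elim: t s => //= a iha b ihb s.
by rewrite rev_cons foldl_rcons rev_cat foldl_cat ihb iha.
Qed.

Lemma fp_parse X (e : enc_of X) (f : X -> seq bool) : fp e (eL eB) f -> fp e eT (fun x => parse (f x)).
Proof.
move=> h; apply: fp_head.
apply: (fp_foldl_add (f := fun _ => parse_step) (q := fun n => 10)) (fp_rev h) (fp_const _ _ _) _ _.
- by polyn_tac.
- have hid := fp_id (eP (eP e (eL eT)) eB); have hs := fp_snd (fp_fst hid).
  apply: fp_if (fp_snd hid) _ (fp_cons (fp_const _ _ _) hs).
  apply: fp_cons (fp_behead (fp_behead hs)).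
  apply: (fp_comp (fp_pair (fp_head Lf hs) (fp_head Lf (fp_behead hs))) (g := fun p => Nd p.1 p.2)).
  exact: fp_repr.
- move=> x s b; rewrite /parse_step; case: b; rewrite /= ?tsize_Nd /=; last by rewrite /tsize /=; lia.
  by case: s => [|a [|c s]] /=; rewrite ?tsize_Nd /eT /= /tsize /=; lia.
Qed.

(** * Membership in NP *)

(* An entry ((b, a), (p, q), r) of a certificate gives the rank r of the position
   (p, q) for the pair (b, a) of priorities. *)
Definition key := ((nat * nat) * (nat * nat))%type.
Definition cert := (nat * NPA * NPA * seq (nat * nat) * seq (key * nat))%type.
Definition eNN : enc_of (nat * nat) := eP eN eN.
Definition eKey : enc_of key := eP eNN eNN.
Definition eCert : enc_of cert :=
  eP (eP (eP (eP eN eNPA) eNPA) (eL eNN)) (eL (eP eKey eN)).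

Definition lookup (R : seq (key * nat)) (x : key) : nat :=
  foldl (fun s e => if e.1 == x then e.2 else s) 0 R.

Definition rank_okb R p q (t u : trans) b a :=
  (t_pri t <= b) && (t_pri u <= a) ==>
  (lookup R ((b, a), (t_dst t, t_dst u)) <= lookup R ((b, a), (p, q))) &&
  ((lookup R ((b, a), (t_dst t, t_dst u)) == lookup R ((b, a), (p, q))) ==>
    (if odd (lookup R ((b, a), (p, q))) then t_pri u != a else t_pri t != b)).

(** The automata belong to the certificate and are re-encoded for comparison with x, so the input is
    never parsed. The pairs (b, a) range over priorities that occur, which keeps their number
    polynomial. *)
Definition check (x : seq sym) (d : cert) : bool :=
  let: (k, A, B, Ps, R) := d in
  [&& enc_instance k A B == x, wfb k A, wfb k B, (init B, init A) \in Ps &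
   all (fun pq => all (fun t => (t_src t == pq.1) ==>
     has (fun u => [&& t_src u == pq.2, t_let u == t_let t, (t_dst t, t_dst u) \in Ps &
       all (fun t' => all (fun u' => ~~ odd (t_pri t') && odd (t_pri u') ==>
          rank_okb R pq.1 pq.2 t u (t_pri t') (t_pri u')) (delta A)) (delta B)])
     (delta A)) (delta B)) Ps].

Lemma rank_okbP R r p q t u b a :
  (forall p q, lookup R ((b, a), (p, q)) = r b a p q) -> rank_okb R p q t u b a <-> rank_ok r p q t u b a.
Proof.
move=> e; rewrite /rank_okb /rank_ok !e; split=> [/implyP h h1 h2|h].
  move: h; rewrite h1 h2 => /(_ isT)/andP[-> /implyP h]; split=> // /eqP/h.
  by case: (odd _) => /eqP.
apply/implyP => /andP[h1 h2]; have [-> h3] := h h1 h2; apply/implyP => /eqP/h3.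
by case: (odd _) => /eqP.
Qed.

Lemma check_sound x d : check x d -> SIM x.
Proof.
case: d => [[[[k A] B] Ps] R] /and5P[/eqP ex /wfP wA /wfP wB i0 /allP H].
exists k, A, B; split=> //; split=> //; split=> //.
pose pB b := has (fun t => t_pri t == b) (delta B); pose pA a := has (fun u => t_pri u == a) (delta A).
(* A priority b absent from [B] cannot recur, so the even constant 0 is a valid rank; if a is absent
   from [A], the odd constant 1 is. *)
pose r b a p q := if pB b then if pA a then lookup R ((b, a), (p, q)) else 1 else 0.
apply: (@ranked_simulates A B (fun p q => (p, q) \in Ps) r); split=> //.
move=> p q t pq mt st; have /allP/(_ t mt)/implyP := H _ pq; rewrite st eqxx => /(_ isT).
case/hasP => u mu /and4P[/eqP su /eqP lu iu /allP H2]; exists u; split=> // b a eb oa.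
case hb: (pB b); last first.
  rewrite /rank_ok /r hb => _ _; split=> // _ /= e; move/hasP: hb; apply; exists t => //; exact/eqP.
case ha: (pA a); last first.
  rewrite /rank_ok /r hb ha => _ _; split=> // _ /= e; move/hasP: ha; apply; exists u => //; exact/eqP.
apply/(@rank_okbP R); first by move=> p' q'; rewrite /r hb ha.
move/hasP: hb => [t' mt' /eqP et]; move/hasP: ha => [u' mu' /eqP eu].
by have /allP/(_ u' mu')/implyP := H2 t' mt'; rewrite et eu eb oa; apply.
Qed.

Lemma lookup_graph (R : seq (key * nat)) g x : (forall e, e \in R -> e.2 = g e.1) -> x \in map fst R -> lookup R x = g x.
Proof.
move=> hg; rewrite /lookup; have : forall s, (x \in map fst R) || (s == g x) ->
  foldl (fun s (e : key * nat) => if e.1 == x then e.2 else s) s R = g x; last by move=> h m; apply: h; rewrite m.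
elim: R hg => [|e R ih] hg s /=; first by move/eqP.
rewrite inE => h; apply: ih => [e' m|]; first by apply: hg; rewrite inE m orbT.
case: (eqVneq e.1 x) h => [<- _|ne] //.
by rewrite (hg e) ?mem_head // eqxx orbT.
Qed.

Lemma tsize_eL_bound (A : eqType) (eA : enc_of A) c l :
  (forall a, a \in l -> tsize (eA a) <= c) -> tsize (eL eA l) <= (size l * c.+1).+1.
Proof.
elim: l => //= a l ih h; rewrite tsize_Nd mulSn.
have := h a (mem_head _ _); have := ih (fun i hi => h i (mem_behead (s := a :: l) hi)); lia.
Qed.

Lemma size_enc_nats s : size s <= size (enc_nats s) /\
  forall n, n \in s -> size (bits n) <= size (enc_nats s).
Proof.
elim: s => //= n s [ih1 ih2]; rewrite /enc_nats /= size_cat -/(enc_nats s) size_rcons size_map.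
split; first by lia.
by move=> m; rewrite inE => /orP[/eqP->|/ih2]; lia.
Qed.

Lemma mem_ser A t : t \in delta A ->
  [/\ t_src t \in ser_NPA A, t_let t \in ser_NPA A, t_dst t \in ser_NPA A & t_pri t \in ser_NPA A].
Proof.
move=> m; pose f t := [:: t_src t; t_let t; t_dst t; t_pri t].
have h n : n \in f t -> n \in ser_NPA A.
  by move=> hn; rewrite /ser_NPA !inE; apply/orP; right; apply/orP; right; apply/orP; right;
     apply/flattenP; exists (f t) => //; apply: map_f.
by split; apply: h; rewrite !inE eqxx ?orbT.
Qed.

Lemma size_ser A : size (delta A) <= size (ser_NPA A).
Proof.
rewrite /ser_NPA /= size_flatten /shape -map_comp.
by elim: (delta A) => //= t l ih; lia.
Qed.

(** For an instance of length Z: b bounds the code of a number, [dl] that of a list of transitions,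
    [npa] that of an automaton, and P the number of positions. The table has at most one entry per
    pair of transitions and position, with ranks up to 2P + 1; the final 4 counts the outer
    pairs. *)
Definition cert_bound Z :=
  let b := 4 * Z + 1 in let dl := Z * (4 * b + 4) + 1 in let npa := 2 * b + 2 + dl in
  let P := Z.+1 * Z.+1 in
  b + 2 * npa + (P * (2 * b + 2) + 1) +
  (Z * Z * P * (4 * b + 4 * (2 * P + 1) + 6) + 1) + 4.

Lemma polyn_cert_bound : polyn cert_bound.
Proof. by rewrite /cert_bound; polyn_tac. Qed.

Lemma check_complete k A B : wf_NPA k A -> wf_NPA k B -> simulates A B ->
  exists2 d, check (enc_instance k A B) d & tsize (eCert d) <= cert_bound (size (enc_instance k A B)).
Proof.
move=> wA wB sim; have [Inv [r [[i0 hr] dom bnd]]] := simulates_ranked sim.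
pose Ps := [seq x <- [seq (p, q) | p <- states_of B, q <- states_of A] | `[< Inv x.1 x.2 >]].
have memPs p q : ((p, q) \in Ps) <-> Inv p q.
  rewrite mem_filter /=; split=> [/andP[/asboolP]//|i]; have [hp hq] := dom _ _ i.
  by rewrite allpairs_f // andbT; apply/asboolP.
pose ba := [seq (t_pri t, t_pri u) | t <- delta B, u <- delta A].
pose pq := [seq (p, q) | p <- states_of B, q <- states_of A].
pose R := [seq ((x, y), r x.1 x.2 y.1 y.2) | x <- ba, y <- pq].
have rkE t u p q : t \in delta B -> u \in delta A -> p \in states_of B -> q \in states_of A ->
    lookup R ((t_pri t, t_pri u), (p, q)) = r (t_pri t) (t_pri u) p q.
  move=> mt mu hp hq; apply: (lookup_graph (g := fun x : key => r x.1.1 x.1.2 x.2.1 x.2.2)).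
    by move=> e /allpairsP[[x y] [_ _ ->]].
  apply/mapP; exists (((t_pri t, t_pri u), (p, q)), r (t_pri t) (t_pri u) p q) => //.
  apply/allpairsP; exists ((t_pri t, t_pri u), (p, q)); split=> //=; exact: allpairs_f.
exists (k, A, B, Ps, R).
  apply/and5P; split=> //; try exact/wfP; first exact/memPs.
  apply/allP => -[p q] /memPs i /=; apply/allP => t mt; apply/implyP => /eqP st.
  have [u [mu su lu iu ok]] := hr _ _ _ i mt st.
  apply/hasP; exists u => //; rewrite su lu !eqxx /=; apply/andP; split; first exact/memPs.
  apply/allP => t' mt'; apply/allP => u' mu'; apply/implyP => /andP[eb oa].
  have [hp hq] := dom _ _ i; have [hp' hq'] := dom _ _ iu.
  have := ok _ _ eb oa; rewrite /rank_okb /rank_ok !rkE // => {}ok.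
  apply/implyP => /andP[h1 h2]; have [-> h3] := ok h1 h2; apply/implyP => /eqP/h3.
  by case: (odd _) => /eqP.
have : enc_instance k A B = enc_nats (k :: ser_NPA A ++ ser_NPA B) by [].
move: (size_enc_nats (k :: ser_NPA A ++ ser_NPA B)) => [].
move=> + + ->; set x := enc_nats _; set Z := size x.
rewrite -[size (k :: _)]/((size (ser_NPA A ++ ser_NPA B)).+1) size_cat => szl memb.
have bN n : n \in k :: ser_NPA A ++ ser_NPA B -> tsize (eN n) <= 4 * Z + 1.
  by move=> /memb; have := tsize_eLB (bits n); rewrite -/(eN n) -/Z; lia.
have bA n : n \in ser_NPA A -> tsize (eN n) <= 4 * Z + 1.
  by move=> h; apply: bN; rewrite inE mem_cat h orbT.
have bB n : n \in ser_NPA B -> tsize (eN n) <= 4 * Z + 1.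
  by move=> h; apply: bN; rewrite inE mem_cat h !orbT.
have szA : size (delta A) <= Z by have := size_ser A; lia.
have szB : size (delta B) <= Z by have := size_ser B; lia.
set b := 4 * Z + 1 in bN bA bB.
have bNPA C : (forall n, n \in ser_NPA C -> tsize (eN n) <= b) -> size (delta C) <= Z ->
    tsize (eNPA C) <= 2 * b + 2 + (Z * (4 * b + 4) + 1).
  move=> hC szC; rewrite /eNPA /eP /= !tsize_Nd.
  have h1 : tsize (eN (nst C)) <= b by apply: hC; rewrite mem_head.
  have h2 : tsize (eN (init C)) <= b by apply: hC; rewrite !inE eqxx orbT.
  have h3 : tsize (eL eTr (delta C)) <= (size (delta C) * (4 * b + 3).+1).+1.
    apply: tsize_eL_bound => t /mem_ser[/hC s1 /hC s2 /hC s3 /hC s4].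
    move: s1 s2 s3 s4; rewrite /eTr /eP /t_src /t_let /t_dst /t_pri /= !tsize_Nd; lia.
  have h4 : size (delta C) * (4 * b + 3).+1 <= Z * (4 * b + 4) by rewrite leq_mul //; lia.
  by lia.
have bst C p : (forall n, n \in ser_NPA C -> tsize (eN n) <= b) -> p \in states_of C -> tsize (eN p) <= b.
  move=> hC; rewrite mem_undup inE => /orP[/eqP->|/mapP[t /mem_ser[_ _ h _] ->]]; last exact: hC.
  by apply: hC; rewrite !inE eqxx orbT.
have szpq : size pq <= Z.+1 * Z.+1.
  rewrite size_allpairs leq_mul //; apply: leq_trans (size_states _) _; by rewrite ltnS.
have hPs : tsize (eL eNN Ps) <= Z.+1 * Z.+1 * (2 * b + 2) + 1.
  have h1 : tsize (eL eNN Ps) <= (size Ps * (2 * b + 1).+1).+1.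
    apply: tsize_eL_bound => -[p q] /memPs/dom[/(bst _ _ bB) h1 /(bst _ _ bA) h2].
    by rewrite /eNN /eP /= tsize_Nd; lia.
  have h2 : size Ps <= Z.+1 * Z.+1 by apply: leq_trans szpq; rewrite size_filter count_size.
  by apply: leq_trans h1 _; rewrite -addn1 leq_add2r leq_mul //; lia.
have hR : tsize (eL (eP eKey eN) R) <= Z * Z * (Z.+1 * Z.+1) * (4 * b + 4 * (2 * (Z.+1 * Z.+1) + 1) + 6) + 1.
  have h1 : tsize (eL (eP eKey eN) R) <= (size R * (4 * b + 4 * (2 * (Z.+1 * Z.+1) + 1) + 5).+1).+1.
    apply: tsize_eL_bound => _ /allpairsP[[[b' a'] [p q]] [/= h1 h2 ->]].
    move: h1 h2 => /allpairsP[[t u] [/= mt mu [-> ->]]] /allpairsP[[p' q'] [/= hp hq [-> ->]]].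
    have [_ _ _ /bB s1] := mem_ser mt; have [_ _ _ /bA s2] := mem_ser mu.
    have s3 := bst _ _ bB hp; have s4 := bst _ _ bA hq.
    have s5 : tsize (eN (r (t_pri t) (t_pri u) p' q')) <= 4 * (2 * (Z.+1 * Z.+1) + 1) + 1.
      have := bnd (t_pri t) (t_pri u) p' q'; set n := r _ _ _ _ => hn.
      have h0 : (size (delta A)).+1 * (size (delta B)).+1 <= Z.+1 * Z.+1 by rewrite leq_mul.
      have := tsize_eLB (bits n); rewrite -/(eN n); have := size_bits n.
      by move: (_ * _) (Z.+1 * Z.+1) hn h0 => v v'; lia.
    by move: s1 s2 s3 s4 s5; rewrite /eKey /eNN /eP /= !tsize_Nd; lia.
  have h2 : size R <= Z * Z * (Z.+1 * Z.+1).
    have -> : size R = size ba * size pq by exact: size_allpairs.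
    by rewrite leq_mul // size_allpairs leq_mul.
  apply: leq_trans h1 _; rewrite -addn1 leq_add2r leq_mul //; lia.
have hA := bNPA A bA szA; have hB := bNPA B bB szB; have hk := bN k (mem_head _ _).
have -> : tsize (eCert (k, A, B, Ps, R)) = ((((tsize (eN k) + tsize (eNPA A)).+1 + tsize (eNPA B)).+1 +
    tsize (eL eNN Ps)).+1 + tsize (eL (eP eKey eN) R)).+1 by rewrite -!tsize_Nd.
rewrite /cert_bound -/b; move: hA hB hk hPs hR.
move: (tsize (eN k)) (tsize (eNPA A)) (tsize (eNPA B)) (tsize (eL eNN Ps)) (tsize (eL _ R)) => n1 n2 n3 n4 n5.
move: (_ * (_ + 6)) (_ * (2 * b + 2)) (_ * (4 * b + 4)) => m1 m2 m3; lia.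
Qed.

Lemma fp_lookup X (e : enc_of X) (R : X -> seq (key * nat)) (x : X -> key) :
  fp e (eL (eP eKey eN)) R -> fp e eKey x -> fp e eN (fun y => lookup (R y) (x y)).
Proof.
move=> hR hx; have [q [hq le _]] := fp_size hR.
have inj : injective eKey by do ![apply: eP_inj | apply: eN_inj].
apply: (fp_foldl (f := fun y s (z : key * nat) => if z.1 == x y then z.2 else s) (q := q)) hR (fp_const _ _ _) _ _.
- by polyn_tac.
- have hid := fp_id (eP (eP e eN) (eP eKey eN)).
  apply: fp_if (fp_snd (fp_snd hid)) (fp_snd (fp_fst hid)).
  exact: fp_eq inj (fp_fst (fp_snd hid)) (fp_comp (fp_fst (fp_fst hid)) hx).
- move=> y l1 l2 h; have := le y; rewrite h; apply: leq_trans.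
  have : tsize (eL (eP eKey eN) l1) <= tsize (eL (eP eKey eN) (l1 ++ l2)).
    by elim: (l1) => [|z l ih] /=; [exact: tsize_gt0 | rewrite !tsize_Nd; lia].
  apply: leq_trans.
  have H : forall l s L, tsize (eN s) <= L -> tsize (eL (eP eKey eN) l) <= L ->
    tsize (eN (foldl (fun s (z : key * nat) => if z.1 == x y then z.2 else s) s l)) <= L.
    elim=> //= z l ih s L hs; rewrite !tsize_Nd => hL; apply: ih; last by lia.
    by case: ifP => // _; lia.
  by apply: H => //; exact: tsize_gt0.
Qed.

Lemma fp_rank_okb X (e : enc_of X) R p q t u b a :
  fp e (eL (eP eKey eN)) R -> fp e eN p -> fp e eN q -> fp e eTr t -> fp e eTr u ->
  fp e eN b -> fp e eN a -> fp e eB (fun x => rank_okb (R x) (p x) (q x) (t x) (u x) (b x) (a x)).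
Proof.
move=> hR hp hq ht hu hb ha; rewrite /rank_okb.
have h0 : fp e eN (fun x => lookup (R x) (b x, a x, (p x, q x))).
  by apply: fp_lookup hR _; rewrite /eKey /eNN; fp_tac.
have h1 : fp e eN (fun x => lookup (R x) (b x, a x, (t_dst (t x), t_dst (u x)))).
  by apply: fp_lookup hR _; rewrite /eKey /eNN; fp_tac.
apply: fp_implb.
  by apply: fp_andb; apply: fp_leq => //; exact: fp_pri.
apply: fp_andb (fp_leq h1 h0) _; apply: fp_implb (fp_eqN h1 h0) _.
by apply: fp_if (fp_odd h0) _ _; apply: fp_negb; apply: fp_eqN => //; exact: fp_pri.
Qed.

Lemma eNN_inj : injective eNN.
Proof. by apply: eP_inj; apply: eN_inj. Qed.

Lemma fp_check : fp (eP (eL eSym) eCert) eB (fun p => check p.1 p.2).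
Proof.
apply: (@fp_ext _ _ _ _ (fun p =>
  let k := p.2.1.1.1.1 in let A := p.2.1.1.1.2 in let B := p.2.1.1.2 in
  let Ps := p.2.1.2 in let R := p.2.2 in check p.1 (k, A, B, Ps, R))).
  by case=> x [[[[k A] B] Ps] R].
rewrite /=; set E := eP (eL eSym) eCert.
have hd : fp E eCert (fun p => p.2) by exact: fp_snd (fp_id _).
have hR : fp E (eL (eP eKey eN)) (fun p => p.2.2) := fp_snd hd.
have hPs : fp E (eL eNN) (fun p => p.2.1.2) := fp_snd (fp_fst hd).
have hB : fp E eNPA (fun p => p.2.1.1.2) := fp_snd (fp_fst (fp_fst hd)).
have hA : fp E eNPA (fun p => p.2.1.1.1.2) := fp_snd (fp_fst (fp_fst (fp_fst hd))).
have hk : fp E eN (fun p => p.2.1.1.1.1) := fp_fst (fp_fst (fp_fst (fp_fst hd))).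
apply: fp_andb; first exact: fp_eq (eL_inj eSym_inj) (fp_enc_instance hk hA hB) (fp_fst (fp_id _)).
apply: fp_andb; first exact: fp_wfb hk hA.
apply: fp_andb; first exact: fp_wfb hk hB.
apply: fp_andb; first exact: fp_mem eNN_inj (fp_pair (fp_init hB) (fp_init hA)) hPs.
apply: (fp_all (eA := eNN)); last exact: hPs.
set E1 := eP E eNN; have i1 := fp_id E1.
have hd1 : fp E1 E (fun p => p.1) := fp_fst i1.
apply: (fp_all (eA := eTr)); last exact: fp_delta (fp_comp hd1 hB).
set E2 := eP E1 eTr; have i2 := fp_id E2.
have hd2 : fp E2 E (fun p => p.1.1) := fp_fst (fp_fst i2).
have t2 : fp E2 eTr (fun p => p.2) := fp_snd i2.
have pq2 : fp E2 eNN (fun p => p.1.2) := fp_snd (fp_fst i2).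
apply: fp_implb; first exact: fp_eqN (fp_src t2) (fp_fst pq2).
apply: (fp_has (eA := eTr)); last exact: fp_delta (fp_comp hd2 hA).
set E3 := eP E2 eTr; have i3 := fp_id E3.
have hd3 : fp E3 E (fun p => p.1.1.1) := fp_comp (fp_fst i3) hd2.
have t3 : fp E3 eTr (fun p => p.1.2) := fp_comp (fp_fst i3) t2.
have u3 : fp E3 eTr (fun p => p.2) := fp_snd i3.
have pq3 : fp E3 eNN (fun p => p.1.1.2) := fp_comp (fp_fst i3) pq2.
apply: fp_andb; first exact: fp_eqN (fp_src u3) (fp_snd pq3).
apply: fp_andb; first exact: fp_eqN (fp_let u3) (fp_let t3).
apply: fp_andb; first exact: fp_mem eNN_inj (fp_pair (fp_dst t3) (fp_dst u3)) (fp_comp hd3 hPs).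
apply: (fp_all (eA := eTr)); last exact: fp_delta (fp_comp hd3 hB).
set E4 := eP E3 eTr; have i4 := fp_id E4.
apply: (fp_all (eA := eTr)); last exact: fp_delta (fp_comp (fp_fst i4) (fp_comp hd3 hA)).
set E5 := eP E4 eTr; have i5 := fp_id E5.
have l5 : fp E5 E3 (fun p => p.1.1) := fp_fst (fp_fst i5).
have t5 : fp E5 eTr (fun p => p.1.2) := fp_snd (fp_fst i5).
have u5 : fp E5 eTr (fun p => p.2) := fp_snd i5.
apply: fp_implb.
  by apply: fp_andb (fp_negb (fp_odd (fp_pri t5))) (fp_odd (fp_pri u5)).
by apply: fp_rank_okb (fp_comp l5 (fp_comp hd3 hR)) (fp_comp l5 (fp_fst pq3)) (fp_comp l5 (fp_snd pq3))
  (fp_comp l5 t3) (fp_comp l5 u3) (fp_pri t5) (fp_pri u5).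
Qed.

Definition decNPA t : NPA :=
  mkNPA (decN (thd t)) (decN (thd (ttl t))) (decL (decP (decP (decP decN decN) decN) decN) (ttl (ttl t))).

Lemma decNPAK : cancel eNPA decNPA.
Proof.
case=> n i d; rewrite /decNPA /eNPA /= !decNK; congr mkNPA.
by apply: decLK; do ![apply: decPK | exact: decNK].
Qed.

Lemma fp_decNPA : fp eT eNPA decNPA.
Proof.
apply: fp_mkNPA (fp_comp fp_thd fp_decN) (fp_comp fp_ttl (fp_comp fp_thd fp_decN)) _.
apply: (fp_comp fp_ttl (fp_comp fp_ttl (fp_decL _))).
by do ![apply: fp_decP | exact: fp_decN].
Qed.

Definition decCert : tree -> cert :=
  decP (decP (decP (decP decN decNPA) decNPA) (decL (decP decN decN)))
    (decL (decP (decP (decP decN decN) (decP decN decN)) decN)).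

Lemma decCertK : cancel eCert decCert.
Proof. by do ![apply: decPK | apply: decLK | exact: decNK | exact: decNPAK]. Qed.

Lemma fp_decCert : fp eT eCert decCert.
Proof. by do ![apply: fp_decP | apply: fp_decL | exact: fp_decN | exact: fp_decNPA]. Qed.

Definition in_part (y : seq (sym + bool)) : seq sym :=
  flatten [seq (if a is inl s then [:: s] else [::]) | a <- y].
Definition wit_part (y : seq (sym + bool)) : seq bool :=
  flatten [seq (if a is inr b then [:: b] else [::]) | a <- y].

Lemma in_part_cat x w : in_part (map inl x ++ map inr w) = x.
Proof.
rewrite /in_part map_cat flatten_cat -!map_comp.
have -> : flatten (map (fun s : sym => [:: s]) x) = x by elim: x => //= s x ->.
by rewrite -[RHS]cats0; congr (_ ++ _); elim: w.
Qed.

Lemma wit_part_cat x w : wit_part (map inl x ++ map inr w) = w.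
Proof.
rewrite /wit_part map_cat flatten_cat -!map_comp.
have -> : flatten (map (fun s : bool => [:: s]) w) = w by elim: w => //= s w ->.
by rewrite -[RHS]cat0s; congr (_ ++ _); elim: x.
Qed.

Definition verify (y : seq (sym + bool)) : bool := check (in_part y) (decCert (parse (wit_part y))).

Lemma fp_verify : fp (eL (@eF (sym + bool)%type)) eB verify.
Proof.
set E := eL _; have i := fp_id E.
have h1 : fp E (eL eSym) in_part.
  apply: fp_flatten; apply: (fp_map (g := fun _ (a : sym + bool) => if a is inl s then [:: s] else [::])) i.
  exact: (fp_comp (fp_snd (fp_id (eP E (@eF (sym + bool)%type)))) (fp_fin _ (fun a : sym + bool => if a is inl s then [:: s] else [::]))).
have h2 : fp E (eL eB) wit_part.
  apply: fp_flatten; apply: (fp_map (g := fun _ (a : sym + bool) => if a is inr b then [:: b] else [::])) i.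
  exact: (fp_comp (fp_snd (fp_id (eP E (@eF (sym + bool)%type)))) (fp_fin _ (fun a : sym + bool => if a is inr b then [:: b] else [::]))).
exact: fp_comp (fp_pair h1 (fp_comp (fp_parse h2) fp_decCert)) fp_check.
Qed.

Theorem SIM_in_NP : in_NP SIM.
Proof.
have [c hc] := polynP polyn_cert_bound.
exists (fun y => verify y), c; split; first exact: fp_in_P fp_verify.
move=> x; split=> [[k [A [B [-> [wA [wB sim]]]]]]|[w [_ ]]]; last first.
  by rewrite /verify in_part_cat => /check_sound.
have [d hd szd] := check_complete wA wB sim; exists (code (eCert d)).
split; first by apply: leq_trans szd (hc _).
by rewrite /verify in_part_cat wit_part_cat parse_code decCertK.
Qed.

(** * From satisfiability to simulation *)

(* The literals over the variable v are 2v (positive) and 2v+1 (negative). *)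
Definition lit (alpha : nat -> bool) l := odd l (+) alpha l./2.
Definition satisfiable (cls : seq (seq nat)) :=
  exists alpha, forall c, c \in cls -> has (lit alpha) c.

Definition lits (cls : seq (seq nat)) := undup (flatten cls).
(** Any strict bound on the literals serves; the sum is simple to compute and polynomial because
    literals are in unary. *)
Definition nlit (cls : seq (seq nat)) := (foldl addn 0 (flatten cls)).+1.
(** The alphabet: clause j and literal j share the letter j, and the state tells them apart. *)
Definition nlet (cls : seq (seq nat)) := size cls + nlit cls.

(** A round on variable v gives Adam and Eve the priorities 2v + 2 and 2v for the positive literal,
    and 2v + 1 twice for the negative one. Only both together produce an even maximum for Adam and
    an odd one for Eve. The rounds that pick a clause carry the negligible 1 and 0. *)
Definition prioB (x : nat * nat * nat) := if x.1.1 == 0 then 1 else if odd x.1.2 then x.1.2 else x.1.2.+2.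
Definition prioA (x : nat * nat * nat) := if x.2 == 0 then x.1.2 else 0.

Definition triB cls : seq (nat * nat * nat) :=
  [seq (0, j, 1) | j <- iota 0 (size cls)] ++ [seq (1, l, 0) | l <- lits cls].
(** State l + 2 commits Eve to the literal l. State 1 is a sink of priority 0 in which she wins; she
    can enter it at once if Adam repeats a literal other than l. *)
Definition triA cls : seq (nat * nat * nat) :=
  flatten [seq [seq (0, j, l.+2) | l <- nth [::] cls j] | j <- iota 0 (size cls)] ++
  (flatten [seq [seq (l.+2, l', if l == l' then 0 else 1) | l' <- lits cls] | l <- lits cls] ++
   [seq (1, j, 1) | j <- iota 0 (nlet cls)]).

(* Adam (in [autB]) picks a clause, Eve (in [autA]) answers by a literal of it, which Adam
   must then repeat; the literal decides the priorities of that round.  The largest variable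
   chosen infinitely often makes Adam win iff both its literals are chosen infinitely often. *)
Definition autB cls := mkNPA 2 0 [seq (x, prioB x) | x <- undup (triB cls)].
Definition autA cls := mkNPA (nlit cls).+2 0 [seq (x, prioA x) | x <- undup (triA cls)].

Section Correct.
Variable cls : seq (seq nat).
Local Notation A := (autA cls).
Local Notation B := (autB cls).

Lemma mem_lits l : (l \in lits cls) = (l \in flatten cls).
Proof. by rewrite mem_undup. Qed.

Lemma lit_clause j l : j < size cls -> l \in nth [::] cls j -> l \in lits cls.
Proof. by move=> lt m; rewrite mem_lits; apply/flattenP; exists (nth [::] cls j) => //; apply: mem_nth. Qed.

Lemma lits_lt l : l \in lits cls -> l < nlit cls.
Proof.
rewrite mem_lits /nlit ltnS; elim: (flatten cls) (0) => //= n s ih i.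
rewrite inE => /orP[/eqP->|/ih]; last exact.
have : forall s i, i <= foldl addn i s by elim=> //= k s' ih' i'; apply: leq_trans (ih' _); rewrite leq_addr.
by move/(_ s (i + n)); apply: leq_trans; rewrite leq_addl.
Qed.

Lemma mem_delta (P : nat * nat * nat -> nat) tri (t : trans) :
  t \in [seq (x, P x) | x <- undup tri] -> t.1 \in tri /\ t_pri t = P t.1.
Proof. by case/mapP => x; rewrite mem_undup => m ->. Qed.

Lemma mem_triB x : x \in triB cls ->
  (exists2 j, j < size cls & x = (0, j, 1)) \/ (exists2 l, l \in lits cls & x = (1, l, 0)).
Proof.
rewrite mem_cat => /orP[/mapP[j]|/mapP[l m ->]]; last by right; exists l.
by rewrite mem_iota => m ->; left; exists j.
Qed.

Lemma mem_triA x : x \in triA cls ->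
  [\/ exists j l, [/\ j < size cls, l \in nth [::] cls j & x = (0, j, l.+2)],
      exists l l', [/\ l \in lits cls, l' \in lits cls & x = (l.+2, l', if l == l' then 0 else 1)] |
      exists2 j, j < nlet cls & x = (1, j, 1)].
Proof.
rewrite !mem_cat => /or3P[/flatten_mapP[j]|/flatten_mapP[l ml /mapP[l' ml' ->]]|/mapP[j]].
- by rewrite mem_iota => mj /mapP[l ml ->]; apply: Or31; exists j, l.
- by apply: Or32; exists l, l'.
- by rewrite mem_iota => mj ->; apply: Or33; exists j.
Qed.

Lemma inB1 j : j < size cls -> ((0, j, 1), 1) \in delta B.
Proof.
move=> lt; apply: (map_f (fun x => (x, prioB x)) (x := (0, j, 1))).
by rewrite mem_undup mem_cat map_f ?mem_iota.
Qed.

Lemma inB2 l : l \in lits cls -> ((1, l, 0), if odd l then l else l.+2) \in delta B.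
Proof.
move=> m; apply: (map_f (fun x => (x, prioB x)) (x := (1, l, 0))).
by rewrite mem_undup mem_cat (map_f (fun l => (1, l, 0))) ?orbT.
Qed.

Lemma inA1 j l : j < size cls -> l \in nth [::] cls j -> ((0, j, l.+2), 0) \in delta A.
Proof.
move=> lt m; apply: (map_f (fun x => (x, prioA x)) (x := (0, j, l.+2))).
rewrite mem_undup mem_cat; apply/orP; left; apply/flatten_mapP; exists j; first by rewrite mem_iota.
exact: map_f.
Qed.

Lemma inA2 l l' : l \in lits cls -> l' \in lits cls ->
  ((l.+2, l', if l == l' then 0 else 1), if l == l' then l' else 0) \in delta A.
Proof.
move=> m m'; have := map_f (fun x => (x, prioA x)) (x := (l.+2, l', if l == l' then 0 else 1)) (s := undup (triA cls)).
rewrite [prioA _]/prioA /= [(if l == l' then 0 else 1) == 0](_ : _ = (l == l')); last by case: (l == l').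
apply; rewrite mem_undup !mem_cat; apply/or3P; apply: Or32; apply/flatten_mapP; exists l => //.
exact: map_f.
Qed.

Lemma inA3 j : j < nlet cls -> ((1, j, 1), 0) \in delta A.
Proof.
move=> lt; apply: (map_f (fun x => (x, prioA x)) (x := (1, j, 1))).
by rewrite mem_undup !mem_cat (map_f (fun j => (1, j, 1))) ?mem_iota ?orbT.
Qed.

Lemma ltn_lits_let l : l \in lits cls -> l < nlet cls.
Proof. by move/lits_lt => h; rewrite (leq_trans h) // leq_addl. Qed.

Lemma wf_autB : wf_NPA (nlet cls) B.
Proof.
split=> //; split; last by rewrite /= -map_comp map_id undup_uniq.
move=> t /mem_delta[/mem_triB h _]; rewrite /t_src /t_let /t_dst.
case: h => [[j lt ->]|[l /ltn_lits_let h ->]]; split=> //=.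
by rewrite (leq_trans lt) // leq_addr.
Qed.

Lemma wf_autA : wf_NPA (nlet cls) A.
Proof.
split=> //; split; last by rewrite /= -map_comp map_id undup_uniq.
move=> t /mem_delta[/mem_triA h _]; rewrite /t_src /t_let /t_dst.
case: h => [[j [l [lt /(lit_clause lt)/lits_lt h ->]]]|[l [l' [/lits_lt h /ltn_lits_let h' ->]]]|[j lt ->]];
  split=> //=; rewrite ?ltnS //.
- by rewrite (leq_trans lt) // leq_addr.
- by case: eqP.
Qed.

Lemma sat_simulates : satisfiable cls -> simulates A B.
Proof.
move=> [alpha sat].
pose Inv (p q : nat) : Prop := if p == 0 then is_true (q <= 1) else q = 1 \/ exists2 l, l \in lits cls & q = l.+2 /\ lit alpha l.
(* Away from the sink the rank is constant. If a is a true literal and a <= b, it is even: a round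
   of priority b would come from the true positive literal b - 2 <= a, forcing a = b - 1, its
   negation. Otherwise it is odd: a is false and never picked, or its round has priority a > b for
   Adam. *)
pose r b a (p q : nat) := if q == 1 then 1 else if lit alpha a && (a <= b) then 2 else 3.
have r3 b a p q : q <> 1 -> r b a p q = if lit alpha a && (a <= b) then 2 else 3.
  by rewrite /r; case: eqP.
have sink p q (t u : trans) b a : odd a -> t_dst u = 1 -> t_pri u = 0 -> rank_ok r p q t u b a.
  move=> oa du pu _ _; rewrite /r du /= pu; split; first by case: ifP => // _; case: ifP.
  by case: ifP => // _; [move=> _ e|case: ifP]; rewrite // -e in oa.
apply: (@ranked_simulates _ _ Inv r); split=> // p q t i mt st.
have [/mem_triB h pt] := mem_delta mt; case: t mt st h pt => x pr mt st /= h pt.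
rewrite -[pr]/(t_pri (x, pr)) in pt *.
case: h => [[j lt ex]|[l ml ex]]; subst x; rewrite -st in i *; move: i; rewrite /Inv /t_src /=.
- rewrite leq_eqVlt ltnS leqn0 => /orP[|] /eqP -> {q}.
    exists ((1, j, 1), 0); split=> //; last by move=> b a eb oa; apply: sink.
      by apply: inA3; rewrite (leq_trans lt) // leq_addr.
    by left.
  have /hasP[l ml tl] := sat _ (mem_nth [::] lt).
  exists ((0, j, l.+2), 0); split=> //; first exact: inA1.
    by right; exists l => //; apply: lit_clause lt ml.
  move=> b a eb oa _ _; rewrite !r3 //; split=> // _; rewrite pt.
  case: (_ && _); first by move=> e; move: eb; rewrite -e.
  by move=> e; move: oa; rewrite -e.
- case=> [->|[l' ml' [-> tl']]].
    exists ((1, l, 1), 0); split=> //; first exact/inA3/ltn_lits_let.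
    by move=> b a eb oa; apply: sink.
  exists ((l'.+2, l, if l' == l then 0 else 1), if l' == l then l else 0); split=> //; first exact: inA2.
    by rewrite /t_dst /=; case: eqP.
  move=> b a eb oa; case: eqP => [e|_]; last exact: sink.
  move: pt; rewrite {}e in tl' *; rewrite /rank_ok => -> /=; rewrite /t_pri /t_dst /= /prioB /= => hb ha.
  rewrite !r3 //; split=> // _; case h: (_ && _); last first.
    by move=> e; move: h; rewrite -e tl' /=; move: hb; rewrite e oa => ->.
  move: h => /andP[ta leab]; case ol: (odd l) => e; first by rewrite -e ol in eb.
  have ea : a = l.+1.
    move: leab; rewrite -e leq_eqVlt => /orP[/eqP ea|]; first by rewrite ea /= ol in oa.
    rewrite ltnS leq_eqVlt => /orP[/eqP //|]; rewrite ltnS => le.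
    have ea : a = l by apply/eqP; rewrite eqn_leq le ha.
    by rewrite ea ol in oa.
  move: ta tl'; rewrite /lit ea /= ol /= uphalf_half ol /= add0n.
  by case: (alpha _).
Qed.

(** Every clause is picked at the same position (0, 0), to which Adam returns by repeating Eve's
    literal. The ranks there link the literals she uses for different clauses. *)
Lemma simulates_sat : simulates A B -> satisfiable cls.
Proof.
move=> /simulates_ranked[Inv [r [[i0 hr] _ _]]]; rewrite /= in i0.
pose prB l := if odd l then l else l.+2.
(* The constraints imposed on the ranks by answering l: the clause round from (0, 0) to (1, l + 2),
   where the priorities are 1 and 0, then the repetition of l back to (0, 0). *)
pose good l := forall b a, ~~ odd b -> odd a ->
  (0 < b -> r b a 1 l.+2 <= r b a 0 0) /\
  (prB l <= b -> l <= a -> r b a 0 0 <= r b a 1 l.+2 /\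
    (r b a 0 0 = r b a 1 l.+2 -> if odd (r b a 1 l.+2) then l <> a else prB l <> b)).
exists (fun v => `[< good v.*2 >]) => c /(nthP [::])[j lt <-].
have [u [mu su lu iu ok]] := hr 0 0 _ i0 (inB1 lt) erefl.
have [/mem_triA h pu] := mem_delta mu; move: su lu iu ok; case: u mu h pu => x pr mu /= h pu.
case: h => [[j' [l [lt' ml ex]]]|[l [l' [_ _ ex]]]|[j' _ ex]]; subst x; rewrite /t_src /t_let /t_dst //= => _ e.
rewrite {}e in ml mu pu *; move=> iu ok; have ml' := lit_clause lt ml.
have gl : good l.
  have [u [mu' su' lu' _ ok']] := hr _ _ _ iu (inB2 ml') erefl.
  have [/mem_triA h pu'] := mem_delta mu'; move: su' lu' ok'; case: u mu' h pu' => x pr' mu' /= h pu'.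
  case: h => [[? [? [_ _ ex]]]|[l1 [l2 [_ _ ex]]]|[? _ ex]]; subst x; rewrite /t_src /t_let /t_dst //= => -[e1] e2.
  subst l1 l2; rewrite eqxx in pu' * => ok' b a eb oa; split.
    move=> b0; have [||] // := ok b a eb oa; by rewrite pu.
  move=> hb ha; have [||h1 h2] := ok' b a eb oa; rewrite ?pu' //.
  by split=> // e; have := h2 e; case: ifP; rewrite ?pu'.
apply/hasP; exists l => //; rewrite /lit.
case ol: (odd l) => /=; last first.
  by apply/asboolP; have := odd_double_half l; rewrite ol add0n => ->.
apply/negP => /asboolP gl'; have el := odd_double_half l; rewrite ol add1n in el.
set v := l./2 in gl' el.
(* If both literals of v are good, the ranks for b = 2v + 2 and a = 2v + 1 agree at (0, 0) and at
   both literal positions. An odd value forbids the round of the negative literal, an even one that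
   of the positive literal. *)
have eb : ~~ odd v.*2.+2 by rewrite /= odd_double.
have oa : odd v.*2.+1 by rewrite /= odd_double.
have [/(_ isT) p1 p2] := gl' _ _ eb oa; have [/(_ isT) q1 q2] := gl _ _ eb oa.
rewrite /prB odd_double in p2; have [p4 p3] := p2 (leqnn _) (leqnSn _).
have lb : l <= v.*2.+2 by rewrite -el.
have la : l <= v.*2.+1 by rewrite -el.
rewrite /prB ol in q2; have [q4 q3] := q2 lb la.
have e1 : r v.*2.+2 v.*2.+1 0 0 = r v.*2.+2 v.*2.+1 1 v.*2.+2.
  by apply/eqP; rewrite eqn_leq p1 p4.
have e2 : r v.*2.+2 v.*2.+1 0 0 = r v.*2.+2 v.*2.+1 1 l.+2.
  by apply/eqP; rewrite eqn_leq q1 q4.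
have := p3 e1; have := q3 e2; rewrite -e1 -e2.
by case: ifP => _ h1 h2; [apply: h1; rewrite el|apply: h2].
Qed.

End Correct.

Lemma enc_nats_inj : injective enc_nats.
Proof.
have split_inj (s1 s2 : seq bool) r1 r2 : rcons (map Some s1) None ++ r1 = rcons (map Some s2) None ++ r2 ->
    s1 = s2 /\ r1 = r2.
  elim: s1 s2 => [|b s1 ih] [|c s2] //=; first by case=> ->.
  by case=> -> /ih[-> ->].
elim=> [|m s ih] [|n t] //.
- by rewrite /enc_nats /=; case: (map _ _).
- by rewrite /enc_nats /=; case: (map _ _).
by rewrite /enc_nats /= => /split_inj[/bits_inj-> /ih->].
Qed.

Lemma ser_NPA_inj A B s t : ser_NPA A ++ s = ser_NPA B ++ t -> A = B /\ s = t.
Proof.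
case: A B => [n i d] [n' i' d']; rewrite /ser_NPA /= => -[-> -> + e].
elim: d d' e => [|x d ih] [|x' d'] //=.
case=> e1 e2 e3 e4 /ih h /eqP; rewrite eqSS => /eqP/h[[->] ->]; split=> //.
case: x e1 e2 e3 e4 => [[[a b] c] p]; case: x' => [[[a' b'] c'] p']; rewrite /t_src /t_let /t_dst /t_pri /=.
by move=> -> -> -> ->.
Qed.

(** [SIM] asserts that some instance encoded by the word is positive; injectivity identifies it with
    the instance built by the reduction. *)
Lemma enc_instance_inj k A B k' A' B' : enc_instance k A B = enc_instance k' A' B' ->
  [/\ k = k', A = A' & B = B'].
Proof.
move=> /enc_nats_inj h; have [-> eB] := ser_NPA_inj (congr1 behead h : ser_NPA A ++ _ = ser_NPA A' ++ _).
have [|-> _] := @ser_NPA_inj B B' [::] [::]; first by rewrite !cats0.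
by split=> //; move: (congr1 (head 0) h).
Qed.

Definition sat_instance cls := enc_instance (nlet cls) (autA cls) (autB cls).

Theorem sat_instanceP cls : satisfiable cls <-> SIM (sat_instance cls).
Proof.
split=> [h|[k [A [B [/enc_instance_inj[_ <- <-] [_ [_ h]]]]]]]; last exact: simulates_sat h.
exists (nlet cls), (autA cls), (autB cls); split=> //; split; first exact: wf_autA.
by split; [exact: wf_autB | exact: sat_simulates].
Qed.

(** * Computing the instance from the clauses in polynomial time *)

Section Reduction.
Variables (X : Type) (e : enc_of X).

Lemma fp_nth A (eA : enc_of A) d (l : X -> seq A) (i : X -> nat) :
  fp e (eL eA) l -> fp e eU i -> fp e eA (fun x => nth d (l x) (i x)).
Proof.
move=> hl hi; apply: (@fp_ext _ _ _ _ (fun x => head d (iter (i x) behead (l x)))) => [x|].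
  by elim: (i x) (l x) => [|k ih] [|a s] //=; rewrite -?iterS ?iterSr ?nth0 //= ?ih ?nth_nil.
apply: fp_head; apply: (fp_iter_add (g := fun _ => behead) (q := fun _ => 0)) hi hl _ _.
- by polyn_tac.
- exact: fp_behead (fp_snd (fp_id _)).
- by move=> x [|a s]; rewrite //= tsize_Nd; lia.
Qed.

Lemma fp_foldl_addn (l : X -> seq nat) : fp e (eL eU) l -> fp e eU (fun x => foldl addn 0 (l x)).
Proof.
move=> hl; apply: (fp_foldl_add (f := fun _ => addn) (q := fun n => n)) hl (fp_const _ _ _) _ _.
- by polyn_tac.
- by have hid := fp_id (eP (eP e eU) eU); apply: fp_addn (fp_snd (fp_fst hid)) (fp_snd hid).
- by move=> x s a; rewrite /eP /= tsize_Nd !tsize_eU; lia.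
Qed.

End Reduction.

Definition eTri : enc_of (nat * nat * nat) := eP (eP eU eU) eU.
Lemma eTri_inj : injective eTri.
Proof. by do ![apply: eP_inj | apply: eU_inj]. Qed.

Section Reduction2.
Variables (X : Type) (e : enc_of X) (cls : X -> seq (seq nat)).
Hypothesis hcls : fp e (eL (eL eU)) cls.

Lemma fp_lits : fp e (eL eU) (fun x => lits (cls x)).
Proof. exact: fp_undup eU_inj (fp_flatten hcls). Qed.

Lemma fp_nlit : fp e eU (fun x => nlit (cls x)).
Proof. exact: fp_succ (fp_foldl_addn (fp_flatten hcls)). Qed.

Lemma fp_nlet : fp e eU (fun x => nlet (cls x)).
Proof. exact: fp_addn (fp_sizeU hcls) fp_nlit. Qed.

Lemma fp_triB : fp e (eL eTri) (fun x => triB (cls x)).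
Proof.
apply: fp_cat.
  apply: (fp_map (eA := eU)); last exact: fp_iota (fp_sizeU hcls).
  by rewrite /eTri; fp_tac.
apply: (fp_map (eA := eU)); last exact: fp_lits.
by rewrite /eTri; fp_tac.
Qed.

Lemma fp_triA : fp e (eL eTri) (fun x => triA (cls x)).
Proof.
apply: fp_cat.
  apply: fp_flatten; apply: (fp_map (eA := eU)); last exact: fp_iota (fp_sizeU hcls).
  have hid := fp_id (eP e eU).
  apply: (fp_map (eA := eU)); last exact: fp_nth (fp_comp (fp_fst hid) hcls) (fp_snd hid).
  have hid2 := fp_id (eP (eP e eU) eU).
  exact: fp_pair (fp_pair (fp_const _ _ _) (fp_snd (fp_fst hid2))) (fp_succ (fp_succ (fp_snd hid2))).
apply: fp_cat.
  apply: fp_flatten; apply: (fp_map (eA := eU)); last exact: fp_lits.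
  have hid := fp_id (eP e eU).
  apply: (fp_map (eA := eU)); last exact: fp_comp (fp_fst hid) fp_lits.
  have hid2 := fp_id (eP (eP e eU) eU); have l1 := fp_snd (fp_fst hid2); have l2 := fp_snd hid2.
  apply: fp_pair (fp_pair (fp_succ (fp_succ l1)) l2) _.
  exact: fp_if (fp_eq eU_inj l1 l2) (fp_const _ _ _) (fp_const _ _ _).
apply: (fp_map (eA := eU)); last exact: fp_iota fp_nlet.
by rewrite /eTri; fp_tac.
Qed.

(** Triples and priorities are computed in unary and turned into binary only on entering an
    automaton. *)
Lemma fp_trans (tri : X -> seq (nat * nat * nat)) (P : nat * nat * nat -> nat) : fp eTri eU P ->
  fp e (eL eTri) tri -> fp e (eL eTr) (fun x => [seq (y, P y) | y <- undup (tri x)]).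
Proof.
move=> hP htri; apply: (fp_map (eA := eTri)); last exact: fp_undup eTri_inj htri.
have y := fp_snd (fp_id (eP e eTri)).
apply: fp_pair (fp_bits (fp_comp y hP)).
apply: (@fp_ext _ _ _ _ (fun p => (p.2.1.1, p.2.1.2, p.2.2))); first by case=> x [[a b] c].
exact: fp_pair (fp_pair (fp_bits (fp_fst (fp_fst y))) (fp_bits (fp_snd (fp_fst y)))) (fp_bits (fp_snd y)).
Qed.

Lemma fp_prioB : fp eTri eU prioB.
Proof.
have i := fp_id eTri; have l := fp_snd (fp_fst i).
apply: fp_if (fp_eq eU_inj (fp_fst (fp_fst i)) (fp_const _ _ _)) (fp_const _ _ _) _.
exact: fp_if (fp_oddU l) l (fp_succ (fp_succ l)).
Qed.

Lemma fp_prioA : fp eTri eU prioA.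
Proof.
have i := fp_id eTri.
exact: fp_if (fp_eq eU_inj (fp_snd i) (fp_const _ _ _)) (fp_snd (fp_fst i)) (fp_const _ _ _).
Qed.

Lemma fp_sat_instance : fp e (eL eSym) (fun x => sat_instance (cls x)).
Proof.
apply: fp_enc_instance; first exact: fp_bits fp_nlet.
  apply: fp_mkNPA; [exact: fp_bits (fp_succ (fp_succ fp_nlit)) | exact: fp_const |].
  exact: fp_trans fp_prioA fp_triA.
by apply: fp_mkNPA; [exact: fp_const | exact: fp_const | exact: fp_trans fp_prioB fp_triB].
Qed.

End Reduction2.

(** * From NP to satisfiability *)

Section Tableau.
Variables (Sig : Type) (M : TM Sig).

(* [None] is the border to the left of the tape. *)
Definition tcell := option (tape M * option (state M)).

Definition row (c : config M) (i : nat) : tcell :=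
  if i is j.+1 then Some (cont c j, if j == pos c then Some c.1.1 else None) else None.

Definition leaves (mv : Defs.move) (a : tcell) : option (state M) :=
  if a is Some (s, Some q) then
    if halted M q is Some _ then None else
    let: (q', _, mv') := tstep M q s in
    match mv, mv' with MoveL, MoveL | MoveR, MoveR => Some q' | _, _ => None end
  else None.

(* [b] is the cell to rewrite, [a] and [c] are its neighbours. *)
Definition next_cell (a b c : tcell) : tcell :=
  if b is Some (s, h) then
    if h is Some q then
      if halted M q is Some _ then b else
      let: (q', w, mv) := tstep M q s in
      Some (w, match mv with MoveN => Some q' | MoveR => None | MoveL => if a is None then Some q' else None end)
    else Some (s, if leaves MoveR a is Some q then Some q else leaves MoveL c)
  else None.

(** Locality of computation: the head moves by at most one cell, so a cell depends on itself and its
    two neighbours one step earlier. A halted configuration is reproduced unchanged. *)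
Lemma row_step c i : row (step c) i.+1 = next_cell (row c i) (row c i.+1) (row c i.+2).
Proof.
case h: (halted M c.1.1) => [b|].
  rewrite (step_halted h) /=; case: (i =P pos c) => [->|ne]; first by rewrite h.
  have -> : leaves MoveR (row c i) = None.
    by case: i ne => //= j _; case: eqP => // _; rewrite /= h.
  by rewrite /=; case: eqP => // _; rewrite /= h.
case st: (tstep M c.1.1 (cont c (pos c))) => [[q' w] mv].
have [e1 e2 e3] := step_spec h st; rewrite [LHS]/= e3 e1 e2.
case: (i =P pos c) => [->|ne].
  rewrite /= eqxx /= h st; case: mv {st e2} => /=; rewrite ?eqxx //.
    by case: (pos c) => //= p; rewrite ?eqxx // gtn_eqF.
  by rewrite ltn_eqF.
have lR : leaves MoveR (row c i) = if (i == (pos c).+1) && (if mv is MoveR then true else false) then Some q' else None.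
  case: i ne => //= j _; rewrite eqSS; case: eqP => [->|_] //=.
  by rewrite h st; case: (mv).
have lL : leaves MoveL (row c i.+2) = if (i.+1 == pos c) && (if mv is MoveL then true else false) then Some q' else None.
  by rewrite /=; case: eqP => [e|_] //=; rewrite e h st; case: (mv).
rewrite [row c i.+1]/= (introF eqP ne) /next_cell lR lL; congr (Some (_, _)).
case: mv {st e2 lR lL} => /=; rewrite ?andbT ?andbF.
- by case: (pos c) ne => [|p] ne /=; [case: i ne | rewrite eqSS].
- by case: eqP.
- by case: eqP ne.
Qed.

(** After t steps the head is at position t at most and everything beyond the input and t further
    cells is blank; rows can therefore be cut off at a finite width. *)
Lemma run_support y t : pos (run M t (init_config M y)) <= t /\
  forall j, size y + t <= j -> cont (run M t (init_config M y)) j = blank M.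
Proof.
elim: t => [|t [ih1 ih2]].
  by split=> // j; rewrite addn0 => le; rewrite /cont /= nth_default ?size_map.
have -> : run M t.+1 (init_config M y) = step (run M t (init_config M y)) by [].
move: (run M t (init_config M y)) ih1 ih2 => c ih1 ih2.
case h: (halted M c.1.1) => [b|].
  by rewrite (step_halted h); split=> [|j le]; [exact: leqW | apply: ih2; lia].
case st: (tstep M c.1.1 (cont c (pos c))) => [[q' w] mv].
have [_ -> e3] := step_spec h st; split; first by case: mv {st}; rewrite /shift; lia.
by move=> j le; rewrite e3 ih2; [case: eqP => // e; lia | lia].
Qed.

End Tableau.

Section CookLevin.
Variables (S1 : finType) (M : TM (S1 + bool)%type) (cw cv : nat).

Definition cells : finType := option (tape M * option (state M)).
Definition tsym : finType := (cells + option bool)%type.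
Definition rank (s : tsym) : nat := enum_rank s.
Definition crank (a : tape M) (h : option (state M)) : nat := rank (inl (Some (a, h))).

(* [wsym z] is written on a cell of the witness zone, [None] standing for its end. *)
Definition wsym (z : option bool) : tape M := if z is Some b then inp M (inr b) else blank M.

(** Each letter is tabulated with and without the head, because the witness begins under the head
    when x is empty. *)
Definition guess_tbl := [seq (rank (inr z), (crank (wsym z) (Some (start M)), crank (wsym z) None)) |
  z <- [:: None; Some true; Some false]].
Definition step_tbl := [seq (rank (inl q.1.1), rank (inl q.1.2), rank (inl q.2),
  rank (inl (next_cell q.1.1 q.1.2 q.2))) | q <- enum {: cells * cells * cells}].
Definition rejecting (a : cells) := if a is Some (_, Some q) then halted M q != Some true else false.
Definition bad_tbl := [seq rank (inl a) | a <- enum cells & rejecting a].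

Definition wlen (x : seq S1) := poly_bound cw (size x).
Definition time (x : seq S1) := poly_bound cv (size x + wlen x).
Definition span (x : seq S1) := size x + wlen x + time x.
(** The border and the positions 0 to [span x] + 1. The head never reaches the last one, so a blank
    can be imposed there at all times. *)
Definition width (x : seq S1) := (span x).+3.

Definition var x t i r := (t * width x + i) * #|tsym| + r.
Definition poslit x t i r := 2 * var x t i r.
Definition neglit x t i r := (poslit x t i r).+1.

(* The variables of index 0 in time also describe the witness: cell j holds its j-th letter or its end. *)
Definition cl_input x := [seq [:: poslit x 0 j.+1 (nth 0
    (if j == 0 then [seq crank (inp M (inl a)) (Some (start M)) | a <- x]
     else [seq crank (inp M (inl a)) None | a <- x]) j)] | j <- iota 0 (size x)].
Definition cl_some x := [seq [:: poslit x 0 j (rank (inr None)); poslit x 0 j (rank (inr (Some true)));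
    poslit x 0 j (rank (inr (Some false)))] | j <- iota 0 (wlen x)].
Definition cl_end x := [seq [:: neglit x 0 j (rank (inr None)); poslit x 0 j.+1 (rank (inr None))] | j <- iota 0 (wlen x)].
Definition cl_wit x := flatten [seq [seq [:: neglit x 0 j z.1;
    poslit x 0 (size x + j).+1 (if size x + j == 0 then z.2.1 else z.2.2)] | z <- guess_tbl] | j <- iota 0 (wlen x)].
Definition cl_rest x := [seq [:: poslit x 0 (size x + wlen x + j).+1
    (if size x + wlen x + j == 0 then crank (blank M) (Some (start M)) else crank (blank M) None)] |
    j <- iota 0 (time x).+2].
Definition cl_left x := [seq [:: poslit x t 0 (rank (inl None))] | t <- iota 0 (time x).+1].
Definition cl_right x := [seq [:: poslit x t (span x).+2 (crank (blank M) None)] | t <- iota 0 (time x).+1].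
Definition cl_step x := flatten [seq flatten [seq [seq
    [:: neglit x t i q.1.1.1; neglit x t i.+1 q.1.1.2; neglit x t i.+2 q.1.2; poslit x t.+1 i.+1 q.2] | q <- step_tbl] |
    i <- iota 0 (span x).+1] | t <- iota 0 (time x)].
Definition cl_final x := flatten [seq [seq [:: neglit x (time x) i r] | r <- bad_tbl] | i <- iota 0 (width x)].

Definition tableau x := cl_input x ++ (cl_some x ++ (cl_end x ++ (cl_wit x ++ (cl_rest x ++
  (cl_left x ++ (cl_right x ++ (cl_step x ++ cl_final x))))))).

Section FpTableau.
Let E := eL (@eF S1).

Lemma fp_wlen X (e : enc_of X) x : fp e E x -> fp e eU (fun y => wlen (x y)).
Proof. by move=> h; apply: fp_poly_bound (fp_sizeU h). Qed.
Lemma fp_time X (e : enc_of X) x : fp e E x -> fp e eU (fun y => time (x y)).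
Proof. by move=> h; apply: fp_poly_bound (fp_addn (fp_sizeU h) (fp_wlen h)). Qed.
Lemma fp_span X (e : enc_of X) x : fp e E x -> fp e eU (fun y => span (x y)).
Proof. by move=> h; apply: fp_addn (fp_addn (fp_sizeU h) (fp_wlen h)) (fp_time h). Qed.
Lemma fp_width X (e : enc_of X) x : fp e E x -> fp e eU (fun y => width (x y)).
Proof. by move=> h; do 3!apply: fp_succ; apply: fp_span. Qed.

Lemma fp_poslit X (e : enc_of X) x t i r : fp e E x -> fp e eU t -> fp e eU i -> fp e eU r ->
  fp e eU (fun y => poslit (x y) (t y) (i y) (r y)).
Proof.
move=> hx ht hi hr; apply: fp_muln (fp_const _ _ _) _; apply: fp_addn hr; apply: fp_muln (fp_const _ _ _).
exact: fp_addn (fp_muln ht (fp_width hx)) hi.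
Qed.
Lemma fp_neglit X (e : enc_of X) x t i r : fp e E x -> fp e eU t -> fp e eU i -> fp e eU r ->
  fp e eU (fun y => neglit (x y) (t y) (i y) (r y)).
Proof. by move=> *; apply: fp_succ; apply: fp_poslit. Qed.

Lemma fp_sing X (e : enc_of X) A (eA : enc_of A) (f : X -> A) : fp e eA f -> fp e (eL eA) (fun y => [:: f y]).
Proof. by move=> h; apply: fp_cons h (fp_const _ _ _). Qed.

Lemma fp_is0 X (e : enc_of X) (f : X -> nat) (a b : X -> nat) : fp e eU f -> fp e eU a -> fp e eU b ->
  fp e eU (fun y => if f y == 0 then a y else b y).
Proof. by move=> h ha hb; apply: fp_if (fp_eq eU_inj h (fp_const _ _ _)) ha hb. Qed.

Local Notation O := (fp_const _ _ _).
Let i0 := fp_id E.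
Let i1 := fp_id (eP E eU).
Let x1 := fp_fst i1.
Let j1 := fp_snd i1.

Lemma fp_cl_input : fp E (eL (eL eU)) cl_input.
Proof.
have hc h : fp E (eL eU) (fun x => [seq crank (inp M (inl a)) h | a <- x]).
  by apply: (fp_map (eA := @eF S1)) i0; apply: fp_comp (fp_snd (fp_id _)) (fp_fin _ (fun a => crank (inp M (inl a)) h)).
apply: (fp_map (eA := eU)); last exact: fp_iota (fp_sizeU i0).
apply: fp_sing; apply: fp_poslit x1 O (fp_succ j1) _; apply: fp_nth j1.
exact: fp_if (fp_eq eU_inj j1 O) (fp_comp x1 (hc _)) (fp_comp x1 (hc _)).
Qed.

Lemma fp_cl_some : fp E (eL (eL eU)) cl_some.
Proof.
apply: (fp_map (eA := eU)); last exact: fp_iota (fp_wlen i0).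
exact: fp_cons (fp_poslit x1 O j1 O) (fp_cons (fp_poslit x1 O j1 O) (fp_sing (fp_poslit x1 O j1 O))).
Qed.

Lemma fp_cl_end : fp E (eL (eL eU)) cl_end.
Proof.
apply: (fp_map (eA := eU)); last exact: fp_iota (fp_wlen i0).
exact: fp_cons (fp_neglit x1 O j1 O) (fp_sing (fp_poslit x1 O (fp_succ j1) O)).
Qed.

Lemma fp_cl_wit : fp E (eL (eL eU)) cl_wit.
Proof.
apply: fp_flatten; apply: (fp_map (eA := eU)); last exact: fp_iota (fp_wlen i0).
apply: (fp_map (eA := eP eU (eP eU eU))); last exact: fp_const.
have i2 := fp_id (eP (eP E eU) (eP eU (eP eU eU))); have x2 := fp_fst (fp_fst i2).
have j2 := fp_snd (fp_fst i2); have z2 := fp_snd i2; have s2 := fp_addn (fp_sizeU x2) j2.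
apply: fp_cons (fp_neglit x2 O j2 (fp_fst z2)) (fp_sing (fp_poslit x2 O (fp_succ s2) _)).
exact: fp_is0 s2 (fp_fst (fp_snd z2)) (fp_snd (fp_snd z2)).
Qed.

Lemma fp_cl_rest : fp E (eL (eL eU)) cl_rest.
Proof.
apply: (fp_map (eA := eU)); last exact: fp_iota (fp_succ (fp_succ (fp_time i0))).
have s1 := fp_addn (fp_addn (fp_sizeU x1) (fp_wlen x1)) j1.
exact: fp_sing (fp_poslit x1 O (fp_succ s1) (fp_is0 s1 O O)).
Qed.

Lemma fp_cl_left : fp E (eL (eL eU)) cl_left.
Proof.
apply: (fp_map (eA := eU)); last exact: fp_iota (fp_succ (fp_time i0)).
exact: fp_sing (fp_poslit x1 j1 O O).
Qed.

Lemma fp_cl_right : fp E (eL (eL eU)) cl_right.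
Proof.
apply: (fp_map (eA := eU)); last exact: fp_iota (fp_succ (fp_time i0)).
exact: fp_sing (fp_poslit x1 j1 (fp_succ (fp_succ (fp_span x1))) O).
Qed.

Lemma fp_cl_step : fp E (eL (eL eU)) cl_step.
Proof.
apply: fp_flatten; apply: (fp_map (eA := eU)); last exact: fp_iota (fp_time i0).
apply: fp_flatten; apply: (fp_map (eA := eU)); last exact: fp_iota (fp_succ (fp_span x1)).
apply: (fp_map (eA := eP (eP (eP eU eU) eU) eU)); last exact: fp_const.
have i3 := fp_id (eP (eP (eP E eU) eU) (eP (eP (eP eU eU) eU) eU)).
have x3 := fp_fst (fp_fst (fp_fst i3)); have t3 := fp_snd (fp_fst (fp_fst i3)).
have j3 := fp_snd (fp_fst i3); have q3 := fp_snd i3.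
apply: fp_cons (fp_neglit x3 t3 j3 (fp_fst (fp_fst (fp_fst q3)))) _.
apply: fp_cons (fp_neglit x3 t3 (fp_succ j3) (fp_snd (fp_fst (fp_fst q3)))) _.
apply: fp_cons (fp_neglit x3 t3 (fp_succ (fp_succ j3)) (fp_snd (fp_fst q3))) _.
exact: fp_sing (fp_poslit x3 (fp_succ t3) (fp_succ j3) (fp_snd q3)).
Qed.

Lemma fp_cl_final : fp E (eL (eL eU)) cl_final.
Proof.
apply: fp_flatten; apply: (fp_map (eA := eU)); last exact: fp_iota (fp_width i0).
apply: (fp_map (eA := eU)); last exact: fp_const.
have i2 := fp_id (eP (eP E eU) eU); have x2 := fp_fst (fp_fst i2).
exact: fp_sing (fp_neglit x2 (fp_time x2) (fp_snd (fp_fst i2)) (fp_snd i2)).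
Qed.

Lemma fp_tableau : fp E (eL (eL eU)) tableau.
Proof.
apply: fp_cat fp_cl_input (fp_cat fp_cl_some (fp_cat fp_cl_end (fp_cat fp_cl_wit (fp_cat fp_cl_rest _)))).
exact: fp_cat fp_cl_left (fp_cat fp_cl_right (fp_cat fp_cl_step fp_cl_final)).
Qed.
End FpTableau.

Lemma rank_lt s : rank s < #|tsym|.
Proof. exact: ltn_ord. Qed.

Lemma rank_inj : injective rank.
Proof. by move=> a b /val_inj/enum_rank_inj. Qed.

Lemma lit_poslit alpha x t i r : lit alpha (poslit x t i r) = alpha (var x t i r).
Proof. by rewrite /lit /poslit mul2n odd_double doubleK. Qed.

Lemma lit_neglit alpha x t i r : lit alpha (neglit x t i r) = ~~ alpha (var x t i r).
Proof. by rewrite /lit /neglit /poslit mul2n /= odd_double uphalf_double. Qed.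

Definition input x w : seq (S1 + bool) := map inl x ++ map inr w.
Definition conf x w t := run M t (init_config M (input x w)).

Lemma cont_input x w j : j < size x -> cont (conf x w 0) j = nth (blank M) (map (inp M \o inl) x) j.
Proof.
move=> lt; rewrite /cont /= map_cat -!map_comp nth_cat size_map lt.
by apply: set_nth_default; rewrite size_map.
Qed.

Lemma cont_wit x w j : cont (conf x w 0) (size x + j) = wsym (onth w j).
Proof.
rewrite /cont /= map_cat -!map_comp nth_cat size_map ltnNge leq_addr /= addKn.
by elim: w j => [|b w ih] [|j] //=.
Qed.

Definition hd0 j := if j == 0 then Some (start M) else None.

Lemma row0 x w j : row (conf x w 0) j.+1 = Some (cont (conf x w 0) j, hd0 j).
Proof. by []. Qed.

Lemma row_blank x w t : size w <= wlen x -> t <= time x ->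
  row (conf x w t) (span x).+2 = Some (blank M, None).
Proof.
move=> lw lt; have [h1 h2] := run_support M (input x w) t.
rewrite /conf /= h2; last by rewrite size_cat !size_map /span; lia.
by rewrite gtn_eqF // (leq_ltn_trans h1) // /span; lia.
Qed.

Section Complete.
Variables (x : seq S1) (w : seq bool).
Hypotheses (lew : size w <= wlen x) (acc : halted M (conf x w (time x)).1.1 = Some true).

Definition holds t i (s : tsym) : bool :=
  match s with inl a => (row (conf x w t) i : cells) == a | inr z => z == onth w i end.

Definition assign v := let ti := v %/ #|tsym| in
  [exists s : tsym, (rank s == v %% #|tsym|) && holds (ti %/ width x) (ti %% width x) s].

Lemma assign_var t i s : i < width x -> assign (var x t i (rank s)) = holds t i s.
Proof.
move=> lt; have K0 : 0 < #|tsym| := leq_ltn_trans (leq0n _) (rank_lt s).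
have e1 : var x t i (rank s) %/ #|tsym| = t * width x + i.
  by rewrite /var divnMDl // divn_small ?rank_lt // addn0.
have e2 : var x t i (rank s) %% #|tsym| = rank s by rewrite /var modnMDl modn_small ?rank_lt.
have e3 : (t * width x + i) %/ width x = t.
  by rewrite divnMDl ?(leq_ltn_trans _ lt) // divn_small // addn0.
have e4 : (t * width x + i) %% width x = i by rewrite modnMDl modn_small.
rewrite /assign e1 e2 e3 e4.
apply/existsP/idP => [[s' /andP[/eqP/rank_inj->]]//|h].
by exists s; rewrite eqxx.
Qed.

Lemma tableau_sat : satisfiable (tableau x).
Proof.
have W1 : (span x).+2 < width x by [].
exists assign => cl; rewrite 8!mem_cat.
case/or3P => [/mapP[j]|/mapP[j]|].
- rewrite mem_iota /= add0n => lt ->; rewrite /= orbF lit_poslit.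
  have -> : nth 0 (if j == 0 then [seq crank (inp M (inl a)) (Some (start M)) | a <- x]
     else [seq crank (inp M (inl a)) None | a <- x]) j = crank (nth (blank M) (map (inp M \o inl) x) j) (hd0 j).
    case: x lt => [|a0 x'] // lt; rewrite (nth_map a0) // /hd0.
    by case: eqP => _; rewrite (nth_map a0).
  rewrite assign_var /holds ?row0 ?cont_input //.
  by move: lt; rewrite /width /span; lia.
- rewrite mem_iota /= add0n => lt ->; rewrite /= orbF !lit_poslit !assign_var /holds; try (by rewrite /width /span; lia).
  by case: (onth w j) => [[]|].
case/or3P => [/mapP[j]|/flatten_mapP[j]|].
- rewrite mem_iota /= add0n => lt ->; rewrite /= orbF lit_poslit lit_neglit !assign_var /holds; try (by rewrite /width /span; lia).
  rewrite -implybE; apply/implyP => /eqP; move: (w) j {lt} => w'.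
  by elim: w' => [|b w' ih] [|j] //=; exact: ih.
- rewrite mem_iota add0n => /andP[_ lt] /mapP[zz zin ->]; have /mapP[z _ ->] := zin.
  rewrite [has _ _]/= orbF lit_neglit lit_poslit.
  have -> : (if size x + j == 0 then crank (wsym z) (Some (start M)) else crank (wsym z) None) =
    crank (wsym z) (hd0 (size x + j)) by rewrite /hd0; case: ifP.
  rewrite !assign_var /holds; try (by rewrite /width /span; lia).
  by rewrite -implybE; apply/implyP => /eqP ->; rewrite row0 cont_wit.
case/or3P => [/mapP[j]|/mapP[t]|].
- rewrite mem_iota /= add0n => lt ->; rewrite /= orbF lit_poslit.
  have -> : (if size x + wlen x + j == 0 then crank (blank M) (Some (start M)) else crank (blank M) None) =
    crank (blank M) (hd0 (size x + wlen x + j)) by rewrite /hd0; case: ifP.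
  rewrite assign_var /holds; last by rewrite /width /span; lia.
  have [_ h2] := run_support M (input x w) 0.
  rewrite row0 /conf h2 //; by rewrite size_cat !size_map; lia.
- rewrite mem_iota /= add0n => lt ->; rewrite /= orbF lit_poslit assign_var /holds //.
case/or3P => [/mapP[t]|/flatten_mapP[t]|/flatten_mapP[i]].
- rewrite mem_iota /= add0n ltnS => lt ->; rewrite /= orbF lit_poslit assign_var // /holds.
  by rewrite row_blank.
- rewrite mem_iota add0n => /andP[_ lt] /flatten_mapP[i]; rewrite mem_iota add0n ltnS => /andP[_ li].
  case/mapP => q qin ->; have /mapP[[[a b] c] _ ->] := qin; rewrite [has _ _]/=; rewrite orbF !lit_neglit lit_poslit !assign_var /holds; try (by rewrite /width; lia).
  rewrite -!implybE; apply/implyP => /eqP ea; apply/implyP => /eqP eb; apply/implyP => /eqP ec.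
  have -> : conf x w t.+1 = step (conf x w t) by [].
  by rewrite row_step ea eb ec.
- rewrite mem_iota add0n => /andP[_ lt] /mapP[r rin ->]; have /mapP[a] := rin; rewrite mem_filter => /andP[rej _] ->.
  rewrite [has _ _]/= orbF lit_neglit assign_var // /holds; apply/eqP => ea; move: rej; rewrite -ea.
  by case: i lt ea => //= i _ _; case: eqP => //= _; rewrite acc.
Qed.
End Complete.

Section Sound.
Variables (x : seq S1) (alpha : nat -> bool).
Hypothesis sat : forall c, c \in tableau x -> has (lit alpha) c.
Let y t i s := alpha (var x t i (rank s)).

Definition guess j : option bool :=
  if y 0 j (inr None) then None else Some (y 0 j (inr (Some true))).
(* The true variables may describe several witnesses; this one is read off greedily.  Since the
   clauses of a step are Horn, all the variables of the run on it are true as well. *)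
Definition glen := find (fun j => guess j == None) (iota 0 (wlen x)).
Definition gword := mkseq (fun j => odflt false (guess j)) glen.

Lemma size_gword : size gword <= wlen x.
Proof. by rewrite size_mkseq -[X in _ <= X](size_iota 0); apply: find_size. Qed.

(** Before [glen] the letter was chosen among true variables; at [glen] the end symbol is true, and
    the clauses of [cl_end] propagate it to all later cells. *)
Lemma y_gword j : j < wlen x -> y 0 j (inr (onth gword j)).
Proof.
move=> lt.
have some : y 0 j (inr None) || y 0 j (inr (Some true)) || y 0 j (inr (Some false)).
  have := sat (c := [:: poslit x 0 j (rank (inr None)); poslit x 0 j (rank (inr (Some true))); poslit x 0 j (rank (inr (Some false)))]).
  rewrite /= orbF !lit_poslit orbA; apply; rewrite 8!mem_cat (_ : _ \in cl_some x) ?orbT //.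
  by apply/mapP; exists j; rewrite ?mem_iota.
case: (ltnP j glen) => ltg.
  have -> : onth gword j = Some (odflt false (guess j)).
    by rewrite onth_nth (nth_map false) ?size_mkseq // nth_mkseq.
  have := before_find 0 ltg; rewrite nth_iota // add0n /guess.
  case e: (y 0 j (inr None)) some => //=; case e1: (y 0 j (inr (Some true))) => //=.
have -> : onth gword j = None by rewrite onth_nth nth_default // size_map size_mkseq.
have gl : glen < wlen x by apply: leq_ltn_trans lt.
have : y 0 glen (inr None).
  have hh : has (fun j => guess j == None) (iota 0 (wlen x)) by rewrite has_find size_iota.
  by have := nth_find 0 hh; rewrite nth_iota // add0n /guess; case: (y 0 _ _).
have mono i : i < wlen x -> y 0 i (inr None) -> y 0 i.+1 (inr None).
  move=> li yi; have := sat (c := [:: neglit x 0 i (rank (inr None)); poslit x 0 i.+1 (rank (inr None))]).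
  rewrite /= orbF lit_neglit lit_poslit -/(y 0 i (inr None)) yi /=; apply; rewrite 8!mem_cat (_ : _ \in cl_end x) ?orbT //.
  by apply/mapP; exists i; rewrite ?mem_iota.
rewrite -(subnKC ltg); move: lt; rewrite -{1}(subnKC ltg); elim: (j - glen) => [|k ih]; first by rewrite addn0.
by rewrite addnS => lt /(ih (ltnW lt)); apply: mono; apply: ltnW.
Qed.

Lemma y_row0 i : i < width x -> y 0 i (inl (row (conf x gword 0) i)).
Proof.
case: i => [|j] lt.
  have := sat (c := [:: poslit x 0 0 (rank (inl None))]); rewrite /= orbF lit_poslit; apply.
  by rewrite 8!mem_cat (_ : _ \in cl_left x) ?orbT //; apply/mapP; exists 0; rewrite ?mem_iota.
rewrite row0; case: (ltnP j (size x)) => lj.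
  rewrite cont_input //.
  have := sat (c := [:: poslit x 0 j.+1 (crank (nth (blank M) (map (inp M \o inl) x) j) (hd0 j))]).
  rewrite /= orbF lit_poslit; apply; rewrite mem_cat; apply/orP; left.
  apply/mapP; exists j; rewrite ?mem_iota //; congr [:: poslit _ _ _ _].
  case: x lj => [|a0 x'] // lj; rewrite (nth_map a0) // /hd0.
  by case: eqP => _; rewrite (nth_map a0).
case: (ltnP j (size x + wlen x)) => lj2.
  rewrite -(subnKC lj); set i := j - size x; rewrite cont_wit.
  have li : i < wlen x by rewrite ltn_subLR.
  have yg := y_gword li; set z := onth gword i in yg *.
  have := sat (c := [:: neglit x 0 i (rank (inr z)); poslit x 0 (size x + i).+1 (crank (wsym z) (hd0 (size x + i)))]).
  rewrite /= orbF lit_neglit lit_poslit -/(y 0 i (inr z)) yg /=; apply; rewrite 8!mem_cat (_ : _ \in cl_wit x) ?orbT //.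
  apply/flatten_mapP; exists i; first by rewrite mem_iota.
  apply/mapP; exists (rank (inr z), (crank (wsym z) (Some (start M)), crank (wsym z) None)).
    by apply/mapP; exists z => //; case: z {yg} => [[]|].
  by rewrite /hd0 /=; case: ifP.
rewrite -(subnKC lj2); set i := j - _.
have [_ h2] := run_support M (input x gword) 0.
rewrite /conf h2; last by have := size_gword; rewrite size_cat !size_map; lia.
have := sat (c := [:: poslit x 0 (size x + wlen x + i).+1 (crank (blank M) (hd0 (size x + wlen x + i)))]).
rewrite /= orbF lit_poslit; apply; rewrite 8!mem_cat (_ : _ \in cl_rest x) ?orbT //.
apply/mapP; exists i; last by rewrite /hd0; case: ifP.
by rewrite mem_iota add0n /=; move: lt; rewrite /i /width /span; lia.
Qed.

Lemma y_row t i : t <= time x -> i < width x -> y t i (inl (row (conf x gword t) i)).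
Proof.
elim: t i => [|t ih] i lt li; first exact: y_row0.
case: i li => [|i] li.
  have := sat (c := [:: poslit x t.+1 0 (rank (inl None))]); rewrite /= orbF lit_poslit; apply.
  by rewrite 8!mem_cat (_ : _ \in cl_left x) ?orbT //; apply/mapP; exists t.+1; rewrite ?mem_iota.
case: (ltnP i (span x).+1) => lis; last first.
  have -> : i.+1 = (span x).+2 by move: li; rewrite /width; lia.
  rewrite row_blank ?size_gword //.
  have := sat (c := [:: poslit x t.+1 (span x).+2 (crank (blank M) None)]); rewrite /= orbF lit_poslit; apply.
  by rewrite 8!mem_cat (_ : _ \in cl_right x) ?orbT //; apply/mapP; exists t.+1; rewrite ?mem_iota.
have -> : conf x gword t.+1 = step (conf x gword t) by [].
rewrite row_step; set a := row _ i; set b := row _ i.+1; set c := row _ i.+2.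
have ya : y t i (inl a) by apply: ih; [exact: ltnW | exact: ltnW].
have yb : y t i.+1 (inl b) by apply: ih; first exact: ltnW.
have yc : y t i.+2 (inl c) by apply: ih; first exact: ltnW.
have := sat (c := [:: neglit x t i (rank (inl a)); neglit x t i.+1 (rank (inl b)); neglit x t i.+2 (rank (inl c));
   poslit x t.+1 i.+1 (rank (inl (next_cell a b c)))]).
rewrite /= orbF !lit_neglit lit_poslit -/(y t i (inl a)) -/(y t i.+1 (inl b)) -/(y t i.+2 (inl c)) ya yb yc /=; apply.
rewrite 8!mem_cat (_ : _ \in cl_step x) ?orbT //.
apply/flatten_mapP; exists t; first by rewrite mem_iota.
apply/flatten_mapP; exists i; first by rewrite mem_iota.
apply/mapP; exists (rank (inl a), rank (inl b), rank (inl c), rank (inl (next_cell a b c))) => //.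
by apply/mapP; exists (a, b, c); rewrite ?mem_enum.
Qed.

(** The head still lies within the tableau, so the variable of its cell is true; were the state not
    accepting, a clause of [cl_final] would deny it. *)
Lemma sat_accepts : halted M (conf x gword (time x)).1.1 = Some true.
Proof.
apply/eqP; apply: contraT => rej; have [ps _] := run_support M (input x gword) (time x).
set c := conf x gword (time x) in rej *.
have lt : (pos c).+1 < width x by rewrite /width /span; move: ps; rewrite -/(conf x gword (time x)) -/c; lia.
have := y_row (leqnn _) lt; rewrite -/c.
have := sat (c := [:: neglit x (time x) (pos c).+1 (rank (inl (row c (pos c).+1)))]).
rewrite [has _ _]/= orbF lit_neglit -/(y _ _ (inl _)) => h yy; have {}h m := negP (h m) yy; exfalso; apply: h.
rewrite 8!mem_cat (_ : _ \in cl_final x) ?orbT //.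
apply/flatten_mapP; exists (pos c).+1; first by rewrite mem_iota.
apply/mapP; eexists; last by [].
apply/mapP; exists (row c (pos c).+1) => //.
by rewrite mem_filter mem_enum andbT /= eqxx.
Qed.
End Sound.

Theorem tableauP x : satisfiable (tableau x) <->
  exists w, size w <= wlen x /\ halted M (conf x w (time x)).1.1 = Some true.
Proof.
split=> [[alpha sat]|[w [lw acc]]]; last exact: tableau_sat lw acc.
by exists (gword x alpha); split; [exact: size_gword | exact: sat_accepts sat].
Qed.

End CookLevin.

Theorem SIM_NP_hard : NP_hard SIM.
Proof.
move=> S1 L1 [V [cw [[M [cv hM]] hL]]].
exists (fun x => sat_instance (tableau M cw cv x)); split.
  exact: fp_computable (fp_sat_instance (fp_tableau M cw cv)).
move=> x; apply: iff_trans (sat_instanceP _); apply: iff_trans (iff_sym (tableauP _ _ _ _)).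
rewrite hL; split=> -[w [lw h]]; exists w; split=> //.
all: have [n [b [le [hh hV]]]] := hM (input x w).
(* The verifier may halt earlier, but halted configurations no longer change, so its answer can be
   read at the fixed time of the tableau. *)
all: have e : conf M x w (time cw cv x) = run M n (init_config M (input x w)).
1,3: have le2 : n <= time cw cv x by apply: leq_trans le _; apply: leq_poly_bound; rewrite size_cat !size_map leq_add2l.
1,2: by rewrite /conf -(subnKC le2) run_add (run_halted _ hh).
  by rewrite e hh; congr Some; apply/hV.
by move: h; rewrite e hh => -[/hV].
Qed.

Theorem theorem2 : NP_complete SIM.
Proof. by split; [exact: SIM_in_NP | exact: SIM_NP_hard]. Qed.
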